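(* Let $X\subset\mathbb{P}^4$ be a smooth quintic threefold over $\mathbb{C}$. Suppose $\mathrm{Aut}(X)$ contains an element of order $17$. Then $\mathrm{Aut}(X)$ is isomorphic to a subgroup of the group $G_{13}\subset \mathrm{PGL}(5,\mathbb{C})$ generated by the classes of the four matrices $$\mathrm{diag}(\xi_{17},\xi_{17}^{-4},\xi_{17}^{16},\xi_{17}^{4},1),\quad \mathrm{diag}(\xi_3,\xi_3^2,\xi_3,\xi_3^2,1),\quad \begin{pmatrix}0&1&0&0&0\\0&0&1&0&0\\0&0&0&1&0\\1&0&0&0&0\\0&0&0&0&1\end{pmatrix},\quad \mathrm{diag}(1,1,1,1,\xi_5),$$ and $|\mathrm{Aut}(X)|$ is divisible by $2$.
   Context: $\xi_k=e^{2\pi i/k}$. A smooth quintic threefold is a smooth hypersurface of degree $5$ in $\mathbb{P}^4$; its automorphism group is finite and is identified with $\{\varphi\in\mathrm{PGL}(5,\mathbb{C}) : \varphi(X)=X\}$. *)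

(* Defs.v *)
From HB Require Import structures.
From mathcomp Require Import all_boot all_order all_algebra.
From mathcomp Require Import boolp classical_sets functions cardinality.
From mathcomp Require Import reals trigo complex mpoly.

Set Implicit Arguments.
Unset Strict Implicit.
Unset Printing Implicit Defensive.

Import Order.TTheory GRing.Theory Num.Theory.
Local Open Scope classical_set_scope.
Local Open Scope quotient_scope.
Local Open Scope ring_scope.

Section Proportional.
Variables (F : fieldType) (V : lmodType F).

Definition proportional (u v : V) : bool :=
  `[< exists2 c : F, c != 0 & u = c *: v >].

Lemma proportional_refl : reflexive proportional.
Proof. by move=> u; apply/asboolP; exists 1; rewrite ?oner_eq0 ?scale1r. Qed.

Lemma proportional_sym : ssrbool.symmetric proportional.
Proof.
have imp u v : proportional u v -> proportional v u.
  move=> /asboolP[c c0 ->]; apply/asboolP; exists c^-1; first by rewrite invr_eq0.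
  by rewrite scalerA mulVf // scale1r.
by move=> u v; apply/idP/idP; apply: imp.
Qed.

Lemma proportional_trans : transitive proportional.
Proof.
move=> v u w /asboolP[c c0 ->] /asboolP[d d0 ->]; apply/asboolP.
by exists (c * d); rewrite ?mulf_neq0 ?scalerA.
Qed.

End Proportional.

Section ProjectiveSpace.
Variables (F : fieldType) (n : nat).

Definition nzvec := {v : 'cV[F]_n.+1 | v != 0}.
HB.instance Definition _ := Choice.on nzvec.

Definition mk_nzvec (v : 'cV[F]_n.+1) (v0 : v != 0) : nzvec :=
  exist (fun v => v != 0) v v0.

Definition nzvec_rel (u v : nzvec) := proportional (val u) (val v).

Lemma nzvec_rel_refl : reflexive nzvec_rel.
Proof. by move=> u; apply: proportional_refl. Qed.
Lemma nzvec_rel_sym : ssrbool.symmetric nzvec_rel.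
Proof. by move=> u v; apply: proportional_sym. Qed.
Lemma nzvec_rel_trans : transitive nzvec_rel.
Proof. by move=> v u w; apply: proportional_trans. Qed.
Canonical nzvec_equiv := EquivRel nzvec_rel
  nzvec_rel_refl nzvec_rel_sym nzvec_rel_trans.

Definition projspace := {eq_quot nzvec_equiv}.
HB.instance Definition _ := Choice.on projspace.
HB.instance Definition _ := EqQuotient.on projspace.

End ProjectiveSpace.

Section GeneralLinear.
Variables (F : fieldType) (n : nat).

Definition GL := {A : 'M[F]_n | A \in unitmx}.
HB.instance Definition _ := Choice.on GL.

Definition mkGL (A : 'M[F]_n) (Au : A \in unitmx) : GL :=
  exist (fun A => A \in unitmx) A Au.

Definition GL1 : GL := mkGL (unitmx1 F n).

Lemma GLmul_subproof (A B : GL) : val A *m val B \in unitmx.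
Proof. by rewrite unitmx_mul (valP A) (valP B). Qed.
Definition GLmul (A B : GL) : GL := mkGL (GLmul_subproof A B).

Lemma GLinv_subproof (A : GL) : invmx (val A) \in unitmx.
Proof. by rewrite unitmx_inv (valP A). Qed.
Definition GLinv (A : GL) : GL := mkGL (GLinv_subproof A).

Definition GL_rel (A B : GL) := proportional (val A) (val B).

Lemma GL_rel_refl : reflexive GL_rel.
Proof. by move=> A; apply: proportional_refl. Qed.
Lemma GL_rel_sym : ssrbool.symmetric GL_rel.
Proof. by move=> A B; apply: proportional_sym. Qed.
Lemma GL_rel_trans : transitive GL_rel.
Proof. by move=> B A C; apply: proportional_trans. Qed.
Canonical GL_equiv := EquivRel GL_rel GL_rel_refl GL_rel_sym GL_rel_trans.

Definition PGL := {eq_quot GL_equiv}.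
HB.instance Definition _ := Choice.on PGL.
HB.instance Definition _ := EqQuotient.on PGL.

Definition PGLone : PGL := \pi_PGL GL1.
Definition PGLmul (g h : PGL) : PGL := \pi_PGL (GLmul (repr g) (repr h)).
Definition PGLinv (g : PGL) : PGL := \pi_PGL (GLinv (repr g)).

Lemma PGL_eqP (A B : GL) :
  reflect (exists2 c : F, c != 0 & val A = c *: val B)
          (\pi_PGL A == \pi_PGL B).
Proof. by rewrite piE; apply: asboolP. Qed.

Lemma PGL_reprP (A : GL) :
  exists2 c : F, c != 0 & val (repr (\pi_PGL A)) = c *: val A.
Proof. by apply/PGL_eqP; rewrite reprK. Qed.

Lemma PGLmul_pi (A B : GL) :
  PGLmul (\pi_PGL A) (\pi_PGL B) = \pi_PGL (GLmul A B).
Proof.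
apply/eqP/PGL_eqP => /=.
have [c c0 ->] := PGL_reprP A; have [d d0 ->] := PGL_reprP B.
by exists (c * d); rewrite ?mulf_neq0 // -scalemxAl -scalemxAr scalerA.
Qed.

Lemma PGLinv_pi (A : GL) : PGLinv (\pi_PGL A) = \pi_PGL (GLinv A).
Proof.
apply/eqP/PGL_eqP => /=; have [c c0 ->] := PGL_reprP A.
exists c^-1; first by rewrite invr_eq0.
by rewrite invmxZ // unitmxZ ?unitfE // (valP A).
Qed.

Lemma PGL_mulA : associative PGLmul.
Proof.
elim/quotW=> A; elim/quotW=> B; elim/quotW=> C; rewrite (PGLmul_pi A B) (PGLmul_pi B C) !PGLmul_pi.
by apply: (congr1 (fun A => \pi_PGL A)); apply: val_inj; rewrite /= mulmxA.
Qed.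

Lemma PGL_mul1 : left_id PGLone PGLmul.
Proof.
elim/quotW=> A; rewrite /PGLone PGLmul_pi.
by apply: (congr1 (fun A => \pi_PGL A)); apply: val_inj; rewrite /= mul1mx.
Qed.

Lemma PGL_mulg1 : right_id PGLone PGLmul.
Proof.
elim/quotW=> A; rewrite /PGLone PGLmul_pi.
by apply: (congr1 (fun A => \pi_PGL A)); apply: val_inj; rewrite /= mulmx1.
Qed.

Lemma PGL_mulV : left_inverse PGLone PGLinv PGLmul.
Proof.
elim/quotW=> A; rewrite PGLinv_pi PGLmul_pi.
by apply: (congr1 (fun A => \pi_PGL A)); apply: val_inj; rewrite /= mulVmx //; apply: valP.
Qed.

Lemma PGL_mulgV : right_inverse PGLone PGLinv PGLmul.
Proof.
elim/quotW=> A; rewrite PGLinv_pi PGLmul_pi.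
by apply: (congr1 (fun A => \pi_PGL A)); apply: val_inj; rewrite /= mulmxV //; apply: valP.
Qed.

HB.instance Definition _ :=
  isGroup.Build PGL PGL_mulA PGL_mul1 PGL_mulg1 PGL_mulV PGL_mulgV.

End GeneralLinear.

Section Action.
Variables (F : fieldType) (n : nat).
Implicit Types (g : PGL F n.+1) (x : projspace F n).

Lemma GLact_subproof (A : GL F n.+1) (v : nzvec F n) : val A *m val v != 0.
Proof.
apply: contra (valP v) => /eqP Av0.
by rewrite -(mulKmx (valP A) (val v)) Av0 mulmx0.
Qed.
Definition GLact (A : GL F n.+1) (v : nzvec F n) : nzvec F n :=
  mk_nzvec (GLact_subproof A v).

Definition PGLact g x : projspace F n :=
  \pi_(projspace F n) (GLact (repr g) (repr x)).

Lemma PGLact_pi (A : GL F n.+1) (v : nzvec F n) :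
  PGLact (\pi_(PGL F n.+1) A) (\pi_(projspace F n) v)
  = \pi_(projspace F n) (GLact A v).
Proof.
have projE (u w : nzvec F n) :
    reflect (exists2 c : F, c != 0 & val u = c *: val w)
            (\pi_(projspace F n) u == \pi_(projspace F n) w).
  by rewrite piE; apply: asboolP.
apply/eqP/projE => /=; have [c c0 ->] := PGL_reprP A.
have /projE[d d0 ->] : \pi_(projspace F n) (repr (\pi_(projspace F n) v))
    == \pi_(projspace F n) v by rewrite reprK.
by exists (c * d); rewrite ?mulf_neq0 // -scalemxAl -scalemxAr scalerA.
Qed.

Lemma PGLact1 x : PGLact 1%g x = x.
Proof.
elim/quotW: x => v; rewrite -[1%g]/(\pi_(PGL F n.+1) (GL1 F n.+1)) PGLact_pi.
apply: (congr1 (fun v => \pi_(projspace F n) v)); apply: val_inj.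
by rewrite /= mul1mx.
Qed.

Lemma PGLactM g h x : PGLact (g * h)%g x = PGLact g (PGLact h x).
Proof.
elim/quotW: x => v; elim/quotW: g => A; elim/quotW: h => B.
rewrite [(_ * _)%g](PGLmul_pi A B) (PGLact_pi B v) !PGLact_pi.
apply: (congr1 (fun v => \pi_(projspace F n) v)); apply: val_inj.
by rewrite /= mulmxA.
Qed.

End Action.

Section Hypersurface.
Variables (F : fieldType) (n : nat).
Implicit Types (P : {mpoly F[n.+1]}) (X : set (projspace F n)).

Definition coords (v : nzvec F n) : 'I_n.+1 -> F := fun i => val v i 0.

(* Only meaningful for homogeneous P, whose vanishing at v depends on the class
   of v alone. *)
Definition proj_zeros P : set (projspace F n) :=
  [set \pi_(projspace F n) v | v in [set v | P.@[coords v] = 0]].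

(* Jacobian criterion: P and its partial derivatives have no common projective
   zero. *)
Definition smooth_form P : Prop :=
  forall v : nzvec F n, P.@[coords v] = 0 ->
    exists i : 'I_n.+1, (P^`M(i)).@[coords v] != 0.

Definition smooth_hypersurface (d : nat) X : Prop :=
  exists P, [/\ P \is d.-homog, P != 0, smooth_form P & X = proj_zeros P].

(* Automorphisms of X are taken in the linear form {g in PGL | g(X) = X}, with X
   its set of closed points. *)
Definition Aut X : set (PGL F n.+1) :=
  [set g | [set PGLact g x | x in X] = X].

End Hypersurface.

Section Groups.

Definition subgroup (G : groupType) (H : set G) : Prop :=
  group_closed (mem H).

Definition subgroup_generated (G : groupType) (S : set G) : set G :=
  smallest (@subgroup G) S.

Definition has_order (G : groupType) (g : G) (m : nat) : Prop :=
  [/\ (0 < m)%N, (g ^+ m = 1)%g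
    & forall k, (0 < k < m)%N -> (g ^+ k <> 1)%g].

(* Meant for subgroups H1 and H2; values of f outside H1 are irrelevant. *)
Definition isomorphic (G1 G2 : groupType) (H1 : set G1) (H2 : set G2) : Prop :=
  exists f : G1 -> G2,
    set_bij H1 H2 f /\ {in H1 &, {morph f : x y / (x * y)%g}}.

End Groups.

Lemma Aut_subgroup (F : fieldType) (n : nat) (X : set (projspace F n)) :
  subgroup (Aut X).
Proof.
split=> [|g h].
  rewrite inE; apply/seteqP; split=> [_ [x Xx <-]|x Xx]; first by rewrite PGLact1.
  by exists x => //; rewrite PGLact1.
rewrite !inE => gX hX; have ghK x : PGLact (g / h)%g (PGLact h x) = PGLact g x.
  by rewrite -PGLactM mulgVK.
apply/seteqP; split=> [y [x + <-]|x].
  by rewrite -{1}hX => -[z Xz <-]; rewrite ghK -gX; exists z.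
rewrite -{1}gX => -[z Xz <-]; exists (PGLact h z); last exact: ghK.
by rewrite -hX; exists z.
Qed.

Section G13.
Variable R : realType.

(* e^{2 pi i / k}, written through Euler's formula *)
Definition xi (k : nat) : R[i] :=
  Complex (cos (2 * pi / k%:R)) (sin (2 * pi / k%:R)).

Lemma xi_neq0 k : xi k != 0.
Proof.
apply/eqP => -[c0 s0]; have := cos2Dsin2 (2 * pi / k%:R : R).
by rewrite c0 s0 expr0n addr0 => /eqP; rewrite eq_sym oner_eq0.
Qed.

Definition diag5 (a b c d e : R[i]) : 'M[R[i]]_5 :=
  diag_mx (\row_j [:: a; b; c; d; e]`_j).

Lemma diag5_unit a b c d e : a != 0 -> b != 0 -> c != 0 -> d != 0 -> e != 0 ->
  diag5 a b c d e \in unitmx.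
Proof.
move=> a0 b0 c0 d0 e0; rewrite unitmxE unitfE det_diag.
by rewrite !big_ord_recl big_ord0 !mxE /= !mulf_neq0 // oner_eq0.
Qed.

Definition mx_shift : 'M[R[i]]_5 := \matrix_(i, j)
  (nth [::] [:: [:: 0; 1; 0; 0; 0];
                [:: 0; 0; 1; 0; 0];
                [:: 0; 0; 0; 1; 0];
                [:: 1; 0; 0; 0; 0];
                [:: 0; 0; 0; 0; 1]] i)`_j.

Lemma mx_shift_unit : mx_shift \in unitmx.
Proof.
suff /mulmx1_unit[] : mx_shift *m mx_shift^T = 1%:M by [].
apply/matrixP => i j; rewrite !mxE.
under eq_bigr do rewrite !mxE.
rewrite !big_ord_recl big_ord0.
case: i => -[|[|[|[|[|//]]]]] ?; case: j => -[|[|[|[|[|//]]]]] ? /=;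
  by rewrite ?(mul0r, mulr0, mul1r, addr0, add0r).
Qed.

Lemma diag17_unit :
  diag5 (xi 17) (xi 17 ^- 4) (xi 17 ^+ 16) (xi 17 ^+ 4) 1 \in unitmx.
Proof.
by apply: diag5_unit; rewrite ?invr_eq0 ?expf_neq0 ?xi_neq0 ?oner_eq0.
Qed.

Lemma diag3_unit :
  diag5 (xi 3) (xi 3 ^+ 2) (xi 3) (xi 3 ^+ 2) 1 \in unitmx.
Proof. by apply: diag5_unit; rewrite ?expf_neq0 ?xi_neq0 ?oner_eq0. Qed.

Lemma diag1_unit : diag5 1 1 1 1 (xi 5) \in unitmx.
Proof. by apply: diag5_unit; rewrite ?xi_neq0 ?oner_eq0. Qed.

Definition G13 : set (PGL R[i] 5) := subgroup_generated
  [set \pi_(PGL R[i] 5) (mkGL diag17_unit);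
       \pi_(PGL R[i] 5) (mkGL diag3_unit);
       \pi_(PGL R[i] 5) (mkGL mx_shift_unit);
       \pi_(PGL R[i] 5) (mkGL diag1_unit)].

End G13.
Arguments G13 : clear implicits.

(* Main.v *)
(** A projective automorphism of the zero locus of a smooth form multiplies the form by a scalar
(Nullstellensatz). An element of order 17 is diagonalizable, and smoothness at the coordinate points
forces its eigenvalues to be z, z^-4, z^16, z^4, 1 up to order and scaling; the quintic then becomes
  F = x0^4 x1 + x1^4 x2 + x2^4 x3 + x3^4 x0 + a w^5
      + b w^3 x0 x2 + c w^3 x1 x3 + d w (x0 x2)^2 + e w (x1 x3)^2 + f w x0 x1 x2 x3,  a <> 0.
The point is that every linear T preserving F is monomial. T acts on the second-order operators
tr (C Hess), with C a symmetric matrix; the operators that annihilate F, or send it to w^3, are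
few, and T must respect them. This shows that T preserves the hyperplane w = 0 or, when f = 0, the
point x0 = x1 = x2 = x3 = 0, at which the differential of F is a multiple of w. On the hyperplane F
is a Klein form, whose second polar forces the columns of T to have disjoint supports. A monomial
symmetry is a power of the cyclic shift times a diagonal matrix whose first entry t satisfies
t^255 = 1; since 255 = 17 * 3 * 5, it lies in G13 up to a scalar, and there are finitely many. The
square of the shift preserves every F, whence the even order. *)
From HB Require Import structures.
Require Import Defs.
From mathcomp Require Import all_boot all_order all_algebra all_field.
From mathcomp Require Import boolp classical_sets functions cardinality.
From mathcomp Require Import reals trigo complex mpoly finmap perm ring zify.

Set Implicit Arguments.
Unset Strict Implicit.
Unset Printing Implicit Defensive.

Import Order.TTheory GRing.Theory Num.Theory.
Local Open Scope quotient_scope.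
Local Open Scope classical_set_scope.
Local Open Scope ring_scope.

(** The obstacle is that [b], ..., [f] are arbitrary, so that no coordinate is visibly distinguished
    by F. When [f] is nonzero, each entry of C outside the positions (0,2), (1,3), (4,4) is alone in
    front of some monomial, so an operator killing F has three parameters; killing w x0 x2 and w x1
    x3 is a linear system with matrix ((4d, f), (f, 4e)). If its determinant 16de - f^2 vanishes,
    some operator either yields w^3 or is a quadric of rank 4 killing F, and both single out w. If
    not, one operator is left up to scaling: it yields w^3, or it kills F and is a quadric of rank 5
    or 3 that T preserves. When [f = 0] the Hessian entries at cyclically adjacent indices are the
    pure cubes 4 x_i^3, and these constrain the last column of T instead of its last row. The
    exponent -4 comes from the monomial x_i^4 x_j that each coordinate point requires: it makes an
    eigenvalue y occur together with y^-4. As -4 has order 4 modulo 17, four of the five eigenvalues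
    form a cycle. Likewise 255 = 4^4 - 1 is the result of going once around that cycle with t_{i+1}
    = t_i^-4. *)

Section LineRestriction.
Variables (n : nat) (K A : comNzRingType) (f : {rmorphism K -> A}).
Implicit Types (P : {mpoly K[n]}) (x z : 'I_n -> A).

Lemma rmorph_mmap (B : comNzRingType) (g : {rmorphism A -> B}) x P :
  g (mmap f x P) = mmap (g \o f) (g \o x) P.
Proof.
rewrite /mmap rmorph_sum; apply: eq_bigr => m _.
rewrite rmorphM rmorph_prod; congr (_ * _); apply: eq_bigr => i _.
by rewrite rmorphXn.
Qed.

(** The ring [A] is kept apart from [K] so that one definition covers both lines with scalar
    direction and the generic line, whose direction is the vector of indeterminates and whose
    restriction has coefficients in [{mpoly K[n]}]. *)
Definition line P x z : {poly A} :=
  mmap (polyC \o f) (fun i => (x i)%:P + (z i)%:P * 'X) P.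

Lemma horner_line P x z t :
  (line P x z).[t] = mmap f (fun i => x i + z i * t) P.
Proof.
rewrite /line /mmap horner_sum; apply: eq_bigr => m _.
rewrite hornerM hornerC horner_prod; congr (_ * _); apply: eq_bigr => i _.
by rewrite horner_exp !hornerE.
Qed.

Lemma mpoly_ring_ind (Q : {mpoly K[n]} -> Prop) :
    (forall c, Q c%:MP) -> (forall i, Q 'X_i) ->
    (forall p q, Q p -> Q q -> Q (p + q)) ->
    (forall p q, Q p -> Q q -> Q (p * q)) ->
  forall p, Q p.
Proof.
move=> QC QX QD QM; elim/mpolyind=> [|c m p _ _ Qp]; first by rewrite -mpolyC0.
apply: (QD) => //; rewrite -mul_mpolyC; apply: (QM) => //; rewrite mpolyXE_id.
apply: big_ind => [||i _]; [exact: (QC 1) | exact: QM |].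
elim: (m i) => [|k IHk]; first by rewrite expr0; apply: (QC 1).
by rewrite exprS; apply: QM.
Qed.

(** Both sides are compatible with sums and obey the Leibniz rule in [P], so that constants and
    variables suffice. *)
Lemma deriv_line P x z :
  (line P x z)^`() = \sum_i (z i)%:P * line P^`M(i) x z.
Proof.
rewrite /line; elim/mpoly_ring_ind: P => [c|j|p q IHp IHq|p q IHp IHq].
- rewrite mmapC derivC big1 // => i _.
  by rewrite mderivC mmap0 mulr0.
- rewrite mmapX mmap1U derivD derivC add0r derivM derivC mul0r add0r derivX mulr1.
  rewrite (bigD1 j) //= big1 ?addr0 => [|i /negPf ij].
    by rewrite mderivX mnm1E eqxx scale1r -{1}[U_(j)%MM]add0m addmK mmapX ?mmap11 mulr1.
  by rewrite mderivX mnm1E eq_sym ij scale0r mmap0 mulr0.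
- rewrite mmapD derivD IHp IHq -big_split; apply: eq_bigr => i _ /=.
  by rewrite mderivD mmapD mulrDr.
- rewrite rmorphM derivM IHp IHq mulr_suml mulr_sumr -big_split.
  apply: eq_bigr => i _ /=; rewrite mderivM mmapD !rmorphM mulrDr; ring.
Qed.

(** The value [a] may be 0, so this is stable under products over any commutative ring, where
    degrees need not add. *)
Definition top_coef (p : {poly A}) d a := (size p <= d.+1)%N /\ p`_d = a.

Lemma top_coefM p q d e a b :
  top_coef p d a -> top_coef q e b -> top_coef (p * q) (d + e) (a * b).
Proof.
move=> [sp <-] [sq <-]; split.
  by apply: leq_trans (size_polyMleq _ _) _; lia.
have ltd : (d < (d + e).+1)%N by rewrite ltnS leq_addr.
rewrite coefM (bigD1 (Ordinal ltd)) //= big1 ?addr0 ?addKn // => i.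
rewrite -val_eqE /= neq_ltn => /orP[id|di].
  by rewrite [q`__]nth_default ?mulr0 //; apply: leq_trans sq _; lia.
by rewrite nth_default ?mul0r //; apply: leq_trans sp _.
Qed.

Lemma top_coef_mmap1 x z (m : 'X_{1..n}) :
  top_coef (mmap1 (fun i => (x i)%:P + (z i)%:P * 'X) m) (mdeg m) (mmap1 z m).
Proof.
rewrite mdegE /mmap1.
elim/big_rec3: _ => [|i p a d _ IH].
  by split; rewrite ?size_poly1 ?coef1.
apply: top_coefM => //; elim: (m i) => [|k IHk].
  by rewrite !expr0; split; rewrite ?size_poly1 ?coef1.
rewrite !exprS -add1n; apply: top_coefM => //; split.
  rewrite (leq_trans (size_polyD _ _)) // geq_max (leq_trans (size_polyC_leq1 _)) //.
  by rewrite mul_polyC (leq_trans (size_scale_leq _ _)) ?size_polyX.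
by rewrite coefD coefC coefCM coefX add0r mulr1.
Qed.

Lemma top_coef_line d P x z :
  P \is d.-homog -> top_coef (line P x z) d (mmap f z P).
Proof.
move=> /dhomogP homP; rewrite /line /mmap /top_coef coef_sum; split.
  apply: leq_trans (size_sum _ _ _) _; apply/bigmax_leqP_seq => m mP _.
  rewrite mul_polyC (leq_trans (size_scale_leq _ _)) //.
  by have [+ _] := top_coef_mmap1 x z m; rewrite [mdeg m]homP.
apply: eq_big_seq => m mP; rewrite /= mul_polyC coefZ.
by have [_ +] := top_coef_mmap1 x z m; rewrite [mdeg m]homP // => ->.
Qed.
End LineRestriction.

(** * A Nullstellensatz for smooth forms, by restriction to a generic line *)

Section Nullstellensatz.
Variable K : numClosedFieldType.

Lemma poly_eq0_everywhere (p : {poly K}) : (forall t, p.[t] = 0) -> p = 0.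
Proof.
move=> p0; apply/eqP/negPn/negP => nz_p.
have rp : all (root p) [seq k%:R | k <- iota 0 (size p)].
  by apply/allP => t _; rewrite rootE p0.
have := max_poly_roots nz_p rp; rewrite size_map size_iota ltnn => H.
by suff /H : uniq [seq k%:R : K | k <- iota 0 (size p)];
  rewrite // map_inj_uniq ?iota_uniq // => i j /eqP; rewrite eqr_nat => /eqP.
Qed.

Lemma eq_poly_everywhere (p q : {poly K}) : (forall t, p.[t] = q.[t]) -> p = q.
Proof.
move=> pq; apply/eqP; rewrite -subr_eq0; apply/eqP/poly_eq0_everywhere => t.
by rewrite hornerD hornerN pq subrr.
Qed.

Section Forms.
Variable n : nat.
Implicit Types (P Q : {mpoly K[n]}) (x z : 'I_n -> K).

Lemma horner_lineK P x z t : (line idfun P x z).[t] = P.@[fun i => x i + z i * t].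
Proof. exact: horner_line. Qed.

Lemma deriv_line0 P x z :
  (line idfun P x z)^`().[0] = \sum_i z i * P^`M(i).@[x].
Proof.
rewrite deriv_line horner_sum; apply: eq_bigr => i _.
rewrite hornerM hornerC horner_lineK; congr (_ * _); apply: meval_eq => j.
by rewrite mulr0 addr0.
Qed.

(** Induction on the degree of the monomial: the constant coefficient is the value at 0, and any
    other coefficient is, up to a positive integer, one of a partial derivative, which vanishes
    everywhere as well. *)
Lemma mpoly_eq0_everywhere P : (forall x, P.@[x] = 0) -> P = 0.
Proof.
move=> P0; apply/mpolyP => m; rewrite mcoeff0.
have [k] := ubnP (mdeg m); elim: k => // k IHk in m P P0 *; rewrite ltnS => mk.
have [->|m0] := eqVneq m 0%MM.
  rewrite -[RHS](P0 (fun=> 0)); elim/mpoly_ring_ind: (P) => [c|i|p q Hp Hq|p q Hp Hq].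
  - by rewrite mevalC mcoeffC eqxx mulr1.
  - by rewrite mevalXU mcoeffX mnm1_eq0.
  - by rewrite mcoeffD mevalD Hp Hq.
  - by rewrite mevalM -Hp -Hq; exact: (rmorphM (mcoeff 0%MM)).
have /existsP[i mi] : [exists i, m i != 0%N].
  apply: contraR m0 => /existsPn /= m0; apply/eqP/mnmP => i.
  by rewrite mnm0E; apply/eqP; have := m0 i; rewrite negbK.
have Pi0 x : P^`M(i).@[x] = 0.
  have : (line idfun P x (fun j => (j == i)%:R))^`().[0] = 0.
    rewrite (_ : line _ _ _ _ = 0) ?deriv0 ?horner0 //.
    by apply: poly_eq0_everywhere => t; rewrite horner_lineK P0.
  rewrite deriv_line0 (bigD1 i) //= big1 ?addr0 ?eqxx ?mul1r // => j /negPf ->.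
  by rewrite mul0r.
have mE : (m - U_(i) + U_(i))%MM = m.
  by apply: submK; apply/mnm_lepP => j; rewrite mnm1E; case: eqP => // <-; rewrite lt0n.
have := IHk (m - U_(i))%MM _ Pi0; rewrite mcoeff_mderiv mE => H.
have /eqP : P@_m *+ ((m - U_(i))%MM i).+1 = 0.
  by apply: H; move: mk; rewrite -{1}mE mdegD mdeg1 addn1.
by rewrite mulrn_eq0 /= => /eqP.
Qed.

Lemma mpoly_neq0_ex P : P != 0 -> exists x, P.@[x] != 0.
Proof.
move=> nzP; apply: contrapT => H; case/negP: nzP; apply/eqP.
apply: mpoly_eq0_everywhere => x; apply/eqP; apply: contrapT => Px.
by apply: H; exists x; apply/negP.
Qed.

Definition smooth_at P x := P.@[x] = 0 -> exists i, P^`M(i).@[x] != 0.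

Lemma map_line_meval P (x z : 'I_n -> {mpoly K[n]}) (v : 'I_n -> K) :
  map_poly (meval v) (line (@mpolyC n K) P x z) =
  line idfun P (meval v \o x) (meval v \o z).
Proof.
refine (eq_poly_everywhere _) => t; rewrite horner_lineK.
rewrite -[t](mevalC v) horner_map horner_line /= rmorph_mmap.
rewrite /meval /mmap; apply: eq_bigr => m _.
rewrite /= -/(meval v _) mevalC; congr (_ * _); apply: mmap1_eq => i /=.
by rewrite mevalD mevalM.
Qed.

Section GenericLine.
Variables (P : {mpoly K[n]}) (d : nat) (v0 : 'I_n -> K) (i0 j0 : 'I_n).
Hypotheses (homP : P \is d.-homog) (Pv0 : P.@[v0] != 0).
Hypotheses (v0i : v0 i0 != 0) (ij : i0 != j0).
Hypothesis smP : forall x i, x i != 0 -> smooth_at P x.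

Let G := line (@mpolyC n K) P (fun i => (v0 i)%:MP) (fun i => 'X_i).

Lemma generic_line_meval v : map_poly (meval v) G = line idfun P v0 v.
Proof.
rewrite map_line_meval; congr (line _ _ _ _); apply: funext => i /=.
  exact: mevalC.
exact: mevalXU.
Qed.

Lemma generic_line_neq0 : G != 0.
Proof.
apply: contraNneq Pv0 => G0; have := generic_line_meval v0.
rewrite G0 rmorph0 => /(congr1 (fun p => p.[0])); rewrite horner0 horner_lineK.
move=> ->; apply/eqP; apply: meval_eq => i; by rewrite mulr0 addr0.
Qed.

Lemma horner_map_line (v z : 'I_n -> K) t s (p : {poly {mpoly K[n]}}) :
  (map_poly (fun q => line idfun q v z) p).[t%:P].[s] =
  (map_poly (meval (fun i => v i + z i * s)) p).[t].
Proof.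
have -> : (map_poly (fun q => line idfun q v z) p).[t%:P].[s] =
    (map_poly (horner_eval s) (map_poly (fun q => line idfun q v z) p)).[t].
  by rewrite -[in RHS](hornerC t s) -[(t%:P).[s]]/(horner_eval s t%:P) horner_map.
rewrite -map_poly_comp_id0; last by rewrite raddf0.
by congr (_.[t]); apply: eq_map_poly => q /=; rewrite /horner_eval horner_lineK.
Qed.

(* A repeated factor would have a root at a point of the hypersurface where all partial derivatives
   vanish. *)
Lemma generic_line_square_free (u : {poly {mpoly K[n]}}) : size u != 1 -> ~~ (u ^+ 2 %| G).
Proof.
move=> su; apply/negP => u2G.
have nzu : u != 0.
  apply: contraTneq u2G => ->; rewrite expr0n /= dvd0p; exact: generic_line_neq0.
move: u2G; rewrite Pdiv.Idomain.dvdp_eq; set c := _ ^+ _; set q := G %/ _.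
have nzc : c != 0 by rewrite expf_neq0 // lead_coef_eq0 expf_neq0.
move=> /eqP Gu.
pose W := ('X_j0 * (v0 i0)%:MP - 'X_i0 * (v0 j0)%:MP : {mpoly K[n]}).
have nzW : W != 0.
  apply: contraNneq v0i => W0; have : W.@[fun i => (i == j0)%:R] = 0 by rewrite W0 meval0.
  rewrite /W mevalB !mevalM !mevalXU !mevalC eqxx (negPf ij) mul1r mul0r subr0.
  by move=> ->.
(* At [v] the leading coefficient of [u] survives, so the specialized [u] keeps its degree and has a
   root; [W] survives too, so [v] is independent of [v0] and the line through [v0] in direction [v]
   avoids the origin. *)
have [|v] := @mpoly_neq0_ex (c * lead_coef u * W).
  by rewrite !mulf_neq0 // lead_coef_eq0.
rewrite !mevalM !mulf_eq0 !negb_or => /andP[/andP[cv uv] Wv].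
have [t0 /rootP ut0] : exists t, root (map_poly (meval v) u) t.
  by apply/closed_rootP; rewrite size_map_poly_id0.
have Pt0 : (line idfun P v0 v).[t0] = 0.
  have := congr1 (fun p => (map_poly (meval v) p).[t0]) Gu.
  rewrite /= map_polyZ expr2 !rmorphM /= hornerZ !hornerM ut0.
  rewrite !mulr0 generic_line_meval => /eqP.
  by rewrite mulf_eq0 (negPf cv) => /eqP.
pose x i := v0 i + v i * t0.
have nzt0 : t0 != 0.
  apply: contraNneq Pv0 => t00; rewrite -Pt0 horner_lineK t00; apply/eqP/meval_eq => i.
  by rewrite mulr0 addr0.
have [i xi] : exists i, x i != 0.
  apply: contrapT => x0; case/negP: Wv.
  have {}x0 i : v0 i = - (v i * t0).
    apply/eqP; rewrite -addr_eq0; apply: contrapT => xi; apply: x0; exists i; exact/negP.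
  rewrite /W mevalB !mevalM !mevalXU !mevalC !x0; apply/eqP; ring.
have Px0 : P.@[x] = 0 by rewrite -Pt0 horner_lineK.
have [k] := smP xi Px0; case/negP.
pose z i : K := (i == k)%:R.
(* [Psi] freezes the parameter at the root [t0] and tilts the direction [v] along the k-th axis. The
   derivative at 0 of the factorization is then zero on the side of [u ^+ 2], and c(v) t0 times the
   k-th partial derivative of [P] at [x] on the other. *)
pose Psi p := (map_poly (fun q => line idfun q v z) p).[t0%:P].
have PsiG : Psi G = line idfun P x (fun i => z i * t0).
  refine (eq_poly_everywhere _) => s; rewrite horner_map_line generic_line_meval.
  by rewrite !horner_lineK; apply: meval_eq => l; rewrite /x; ring.
have Psieq : line idfun c v z * Psi G = Psi q * Psi u ^+ 2.
  refine (eq_poly_everywhere _) => s; rewrite 2!hornerM horner_exp !horner_map_line.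
  rewrite horner_lineK; set w := fun i => _.
  have := congr1 (fun p => (map_poly (meval w) p).[t0]) Gu.
  by rewrite /= map_polyZ expr2 !rmorphM /= hornerZ !hornerM => ->; rewrite expr2.
have Psiu0 : (Psi u).[0] = 0.
  rewrite horner_map_line -[RHS]ut0; congr (_.[_]); apply: eq_map_poly => p.
  by apply: meval_eq => l; rewrite mulr0 addr0.
move: Psieq; rewrite expr2 => /(congr1 (fun p => p^`().[0])).
rewrite /= !derivM PsiG !(hornerD, hornerM) Psiu0 (deriv_line0 P) !horner_lineK.
rewrite !(mul0r, mulr0, addr0, add0r).
rewrite [X in _ * X + _](_ : _ = 0); last first.
  rewrite -[RHS]Px0; apply: meval_eq => l; rewrite mulr0 addr0 //.
rewrite mulr0 add0r [c.@[_]](_ : _ = c.@[v]); last first.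
  by apply: meval_eq => l /=; rewrite mulr0 addr0.
rewrite (bigD1 k) //= big1 ?addr0 /z ?eqxx ?mul1r => [|l /negPf->]; last by rewrite !mul0r.
by move=> /eqP; rewrite !mulf_eq0 (negPf cv) (negPf nzt0).
Qed.

Lemma mulrn_mpoly_eq0 (p : {mpoly K[n]}) k : (p *+ k.+1 == 0) = (p == 0).
Proof.
apply/eqP/eqP => [pk0|->]; last exact: mul0rn.
apply/mpolyP => m; apply/eqP; have /eqP := congr1 (mcoeff m) pk0.
by rewrite mcoeffMn !mcoeff0 mulrn_eq0.
Qed.

Lemma generic_line_separable : separable_poly G.
Proof.
apply/separable_polyP; split; first by apply/poly_square_freeP/generic_line_square_free.
move=> u _ su; apply/eqP => u'0.
have /eqP := congr1 (fun p : {poly _} => p`_(size u).-2) u'0.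
rewrite coef_deriv coef0 mulrn_mpoly_eq0.
have -> : (size u).-2.+1 = (size u).-1 by case: (size u) su => [|[]].
by rewrite -[_`__]/(lead_coef u) lead_coef_eq0 -size_poly_eq0; case: (size u) su.
Qed.

Variable Q : {mpoly K[n]}.
Hypotheses (homQ : Q \is d.-homog) (PQ : forall x, P.@[x] = 0 -> Q.@[x] = 0).

(** In a generic direction the restriction of [P] has [d] distinct roots, all nonzero. There Q - lam
    P vanishes, and it vanishes at the parameter 0 by the choice of lam: with d + 1 roots and degree
    at most [d] it is zero on the line. *)
Lemma smooth_form_nullstellensatz : forall x, Q.@[x] = Q.@[v0] / P.@[v0] * P.@[x].
Proof.
have := generic_line_separable; rewrite separable_poly.unlock.
(* [c2] is a nonzero polynomial in the direction; wherever it does not vanish the Bezout relation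
   specializes, so the restriction of [P] stays separable. *)
case/Bezout_coprimepP => -[A B] /= /eqpP[[c1 c2] /= /andP[_ nzc2] Bez].
set lam := Q.@[v0] / P.@[v0].
have generic v : c2.@[v] != 0 -> P.@[v] != 0 -> (Q - lam *: P).@[fun i => v0 i + v i] = 0.
  move=> c2v Pv; pose p := line idfun P v0 v; pose q := line idfun (Q - lam *: P) v0 v.
  have [sp tp] : top_coef p d P.@[v] by exact: top_coef_line.
  have sp' : size p = d.+1.
    apply/eqP; rewrite eqn_leq sp ltnNge; apply: contra Pv => /leq_sizeP/(_ d).
    by rewrite tp leqnn => ->.
  have sepp : separable_poly p.
    rewrite separable_poly.unlock; apply/Bezout_coprimepP.
    exists (map_poly (meval v) A, map_poly (meval v) B) => /=; apply/eqpP.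
    have {}Bez : c1.@[v] *: (map_poly (meval v) A * p + map_poly (meval v) B * p^`()) =
        c2.@[v] *: 1.
      have := congr1 (map_poly (meval v)) Bez.
      by rewrite !map_polyZ /= rmorph1 rmorphD !rmorphM /= -deriv_map generic_line_meval.
    exists (c1.@[v], c2.@[v]) => //=; rewrite c2v andbT.
    apply: contraNneq c2v => c10; move: Bez; rewrite c10 scale0r => /esym/eqP.
    by rewrite scaler_eq0 oner_eq0 orbF.
  have [r pE] := closed_field_poly_normal p.
  have nzlp : lead_coef p != 0 by rewrite lead_coef_eq0 -size_poly_eq0 sp'.
  have ur : uniq r.
    rewrite -separable_prod_XsubC -(eqp_separable (p := p)) //.
    by rewrite {1}pE eqp_scale.
  have sr : size r = d.
    by move: sp'; rewrite pE size_scale // size_prod_XsubC => -[].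
  have p0 : p.[0] = P.@[v0].
    by rewrite horner_lineK; apply: meval_eq => i; rewrite mulr0 addr0.
  have q0 : q = 0.
    apply/eqP/negPn/negP => nzq.
    have homQP : Q - lam *: P \is d.-homog by rewrite rpredB // rpredZ.
    have [sq _] : top_coef q d (Q - lam *: P).@[v] by exact: top_coef_line.
    have rq : all (root q) (0 :: r).
      rewrite /= rootE horner_lineK; apply/andP; split.
        rewrite (_ : meval _ _ = (Q - lam *: P).@[v0]); last first.
          by apply: meval_eq => i; rewrite mulr0 addr0.
        by rewrite mevalB mevalZ divfK ?subrr.
      apply/allP => t tr; rewrite rootE horner_lineK mevalB mevalZ.
      have pt : P.@[fun i => v0 i + v i * t] = 0.
        rewrite -horner_lineK; apply/rootP; rewrite -/p pE rootZ //.
        by rewrite root_prod_XsubC.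
      by rewrite PQ // pt mulr0 subrr.
    have u0r : uniq (0 :: r).
      rewrite /= ur andbT; apply: contraNN Pv0 => r0; rewrite -p0 pE hornerZ.
      by rewrite mulf_eq0; apply/orP; right; rewrite -rootE root_prod_XsubC.
    by have := leq_trans (max_poly_roots nzq rq u0r) sq; rewrite /= sr ltnn.
  rewrite -[RHS](horner0 1) -q0 horner_lineK; apply: meval_eq => i.
  by rewrite mulr1.
move=> x; have nzP : P != 0 by apply: contraNneq Pv0 => ->; rewrite meval0.
have [|v1] := @mpoly_neq0_ex (c2 * P); first by rewrite mulf_neq0.
(* An arbitrary direction x - v0 is joined to the generic direction [v1]: along this segment the
   product of c2 P with Q - lam P vanishes, and the first factor is nonzero at the end [v1]. *)
pose z i := v1 i - (x i - v0 i).
pose S1 := line idfun (c2 * P) (fun i => x i - v0 i) z.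
pose S2 := line idfun (Q - lam *: P) x z.
have S12 : S1 * S2 = 0.
  refine (poly_eq0_everywhere _) => t; rewrite hornerM !horner_lineK mevalM.
  set v := fun i => _; have [->|c2v] := eqVneq c2.@[v] 0; first by rewrite !mul0r.
  have [->|Pv] := eqVneq P.@[v] 0; first by rewrite mulr0 mul0r.
  rewrite [X in _ * X](_ : _ = 0) ?mulr0 // -[RHS](generic _ c2v Pv).
  apply: meval_eq => i; rewrite /v; ring.
move=> nzS; have /eqP : S2 = 0.
  move/eqP: S12; rewrite mulf_eq0 => /orP[/eqP S10|/eqP//].
  case/negP: nzS; have := horner0 (1 : K); rewrite -S10 horner_lineK => /eqP.
  by rewrite (_ : meval _ _ = (c2 * P).@[v1]) //; apply: meval_eq => i; rewrite /z; ring.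
move=> /eqP/(congr1 (fun p => p.[0])); rewrite horner0 horner_lineK.
rewrite (_ : meval _ _ = (Q - lam *: P).@[x]); last first.
  by apply: meval_eq => i; rewrite mulr0 addr0.
by rewrite mevalB mevalZ => /eqP; rewrite subr_eq0 => /eqP.
Qed.

End GenericLine.
End Forms.

Lemma nullstellensatz n d (P Q : {mpoly K[n.+2]}) :
    P \is d.-homog -> Q \is d.-homog -> P != 0 ->
    (forall x i, x i != 0 -> smooth_at P x) ->
    (forall x, P.@[x] = 0 -> Q.@[x] = 0) ->
  exists lam, forall x, Q.@[x] = lam * P.@[x].
Proof.
move=> homP homQ nzP smP PQ.
have [|v0] := @mpoly_neq0_ex _ (P * 'X_ord0).
  rewrite mulf_neq0 //; apply/eqP => /(congr1 (meval (fun=> 1))).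
  by rewrite mevalXU meval0 => /eqP; rewrite oner_eq0.
rewrite mevalM mevalXU mulf_eq0 negb_or => /andP[Pv0 v0i].
exists (Q.@[v0] / P.@[v0]).
by apply: (@smooth_form_nullstellensatz _ P d v0 ord0 ord_max).
Qed.

(** * Linear substitutions, singular points and projective automorphisms *)

Section LinearSubstitution.
Variable n : nat.
Implicit Types (P : {mpoly K[n]}) (A : 'M[K]_n) (v : 'cV[K]_n).

Definition ev P v := P.@[fun i => v i 0].

Definition subst_mx P A : {mpoly K[n]} := P \mPo [tuple \sum_j A i j *: 'X_j | i < n].

Lemma ev_subst_mx P A v : ev (subst_mx P A) v = ev P (A *m v).
Proof.
rewrite /ev /subst_mx comp_mpoly_meval; apply: meval_eq => i.
rewrite tnth_mktuple mxE raddf_sum; apply: eq_bigr => j _.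
by rewrite /= mevalZ mevalXU.
Qed.

Lemma subst_mx_homog P A d : P \is d.-homog -> subst_mx P A \is d.-homog.
Proof.
move=> /dhomogP homP; rewrite /subst_mx comp_mpolyE big_seq rpred_sum // => m mP.
have -> : d = (\sum_i m i)%N by rewrite -(homP _ mP) [LHS]mdegE.
rewrite rpredZ //.
apply: (big_rec2 (fun p d => p \is d.-homog)) => [|i k p _ hp].
  exact: dhomog1.
apply: dhomogM => //; rewrite tnth_mktuple.
suff: \sum_j A i j *: 'X_j \is 1.-homog by move=> /(dhomogMn (m i)); rewrite mul1n.
by rewrite rpred_sum // => j _; rewrite rpredZ // dhomogX; apply/eqP/mdeg1.
Qed.

Lemma mpoly_ev_inj P Q : (forall v, ev P v = ev Q v) -> P = Q.
Proof.
move=> PQ; apply/eqP; rewrite -subr_eq0; apply/eqP/mpoly_eq0_everywhere => x.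
have := PQ (\col_i x i); rewrite /ev mevalB.
rewrite !(@meval_eq _ _ (fun i => (\col_i x i) i 0) x) => [->|i|i]; rewrite ?subrr //.
all: by rewrite mxE.
Qed.

Lemma ev_scale P d t v : P \is d.-homog -> ev P (t *: v) = t ^+ d * ev P v.
Proof.
move=> /dhomogP homP; rewrite /ev !mevalE mulr_sumr; apply: eq_big_seq => m mP.
rewrite mulrCA; congr (_ * _); rewrite -(homP _ mP) [X in _ ^+ X](mdegE m) -prodrXr -big_split.
by apply: eq_bigr => i _; rewrite mxE exprMn.
Qed.
End LinearSubstitution.

(** Stated for functions, by divisibility by t^2 along each line through [v], so that it transports
    under linear coordinate changes without computing derivatives. *)
Definition singular_at n (f : 'cV[K]_n -> K) v :=
  forall z, exists r : {poly K}, forall t, f (v + t *: z) = t ^+ 2 * r.[t].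

Lemma smooth_form_nonsingular n (P : {mpoly K[n.+1]}) v :
  smooth_form P -> v != 0 -> ~ singular_at (ev P) v.
Proof.
move=> smP v0 sing.
have Pv : P.@[coords (mk_nzvec v0)] = 0.
  have [r /(_ 0)] := sing 0.
  by rewrite scaler0 addr0 expr0n mul0r.
have [i /negP[]] := smP _ Pv.
pose z : 'cV[K]_n.+1 := delta_mx i 0; have [r rE] := sing z.
have lE : line idfun P (fun i => v i 0) (fun i => z i 0) = 'X^2 * r.
  refine (eq_poly_everywhere _) => t; rewrite horner_lineK hornerM hornerXn -rE.
  by apply: meval_eq => j; rewrite !mxE mulrC.
have := deriv_line0 P (fun i => v i 0) (fun i => z i 0).
rewrite lE derivM derivXn !(hornerE, hornerMn) /= !expr0n /= !(mul0r, mul0rn) ?addr0 => /esym/eqP.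
by rewrite (bigD1 i) //= mxE !eqxx mul1r big1 ?addr0 // => j /negPf ji; rewrite mxE ji mul0r.
Qed.

Section HypersurfaceAutomorphisms.
Variables (n d : nat) (P : {mpoly K[n.+2]}).
Hypothesis homP : P \is d.-homog.

Lemma proj_zerosE (v : nzvec K n.+1) :
  proj_zeros P (\pi_(projspace K n.+1) v) <-> ev P (val v) = 0.
Proof.
split=> [[u Pu /eqP]|Pv]; last by exists v.
rewrite piE => /asboolP[c c0 uE]; apply/eqP.
have : ev P (val u) = 0 by [].
by rewrite uE (ev_scale _ _ homP) => /eqP; rewrite mulf_eq0 expf_eq0 (negPf c0) andbF.
Qed.

(** The substituted form has the same degree and vanishes where [P] does, so the Nullstellensatz
    applies; the factor is nonzero because [A] is invertible. *)
Lemma Aut_proj_zeros_semi_invariant (A : GL K n.+2) :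
    P != 0 -> smooth_form P -> Aut (proj_zeros P) (\pi_(PGL K n.+2) A) ->
  exists2 lam, lam != 0 & forall v, ev P (val A *m v) = lam * ev P v.
Proof.
move=> nzP smP AutA.
have PA v : ev P v = 0 -> ev P (val A *m v) = 0.
  have [->|v0] := eqVneq v 0; first by rewrite mulmx0.
  move=> Pv; have /proj_zerosE Xv : ev P (val (mk_nzvec v0)) = 0 by [].
  apply/(proj_zerosE (GLact A (mk_nzvec v0))); rewrite -PGLact_pi.
  by rewrite -[X in X _]AutA; exists (\pi_(projspace K n.+1) (mk_nzvec v0)).
have colE (x : 'I_n.+2 -> K) Q : Q.@[x] = ev Q (\col_i x i).
  by apply: meval_eq => i; rewrite mxE.
have [|||||lam lamE] := @nullstellensatz n d P (subst_mx P (val A)) => //.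
- exact: subst_mx_homog.
- move=> x i xi; have x0 : \col_i x i != 0.
    by apply: contraNneq xi => /matrixP/(_ i 0); rewrite !mxE => ->.
  rewrite /smooth_at colE => Px; have [j] := smP (mk_nzvec x0) Px.
  by exists j; rewrite colE.
- by move=> x; rewrite !colE ev_subst_mx; exact: PA.
have {}lamE v : ev P (val A *m v) = lam * ev P v by rewrite -ev_subst_mx; exact: lamE.
exists lam => //; apply: contraNneq nzP => lam0; apply/eqP/mpoly_ev_inj => v.
by rewrite -[v](mulKVmx (valP A)) lamE lam0 mul0r /ev meval0.
Qed.

Lemma semi_invariant_Aut_proj_zeros (A : GL K n.+2) lam :
    lam != 0 -> (forall v, ev P (val A *m v) = lam * ev P v) ->
  Aut (proj_zeros P) (\pi_(PGL K n.+2) A).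
Proof.
move=> lam0 lamE; apply/seteqP; split=> [_ [x + <-]|].
  elim/quotW: x => v /proj_zerosE Pv; rewrite PGLact_pi.
  by apply/proj_zerosE; rewrite /= lamE Pv mulr0.
elim/quotW => v /proj_zerosE Pv.
exists (PGLact (\pi_(PGL K n.+2) (GLinv A)) (\pi_(projspace K n.+1) v)).
  rewrite PGLact_pi; apply/proj_zerosE; apply: (mulfI lam0).
  by rewrite -lamE /= mulKVmx ?mulr0 ?Pv //; exact: valP.
rewrite !PGLact_pi; apply: (congr1 (fun v => \pi_(projspace K n.+1) v)).
by apply: val_inj; rewrite /= mulKVmx //; exact: valP.
Qed.
End HypersurfaceAutomorphisms.
End Nullstellensatz.

(** * Diagonalization and the monomials of a semi-invariant form *)

Section NormalForm.
Variable K : numClosedFieldType.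

(** The minimal polynomial divides X^k - 1, which has simple roots in characteristic 0. *)
Lemma finite_order_diagonalizable n (A : 'M[K]_n.+1) k : (0 < k)%N -> A ^+ k = 1 ->
  exists2 C, C \in unitmx &
    exists2 z : 'rV_n.+1, A *m C = C *m diag_mx z & forall i, z 0 i ^+ k = 1.
Proof.
move=> k0 Ak.
have /diagonalizableP[C uC] : exists2 rs, uniq rs &
    mxminpoly A %| \prod_(x <- rs) ('X - x%:P).
  have [r rE] := closed_field_poly_normal ('X^k - 1 : {poly K}).
  have lk : lead_coef ('X^k - 1 : {poly K}) = 1 by apply/monicP; exact: monicXnsubC.
  rewrite lk scale1r in rE; exists r; rewrite -?separable_prod_XsubC -rE.
    have nk : k%:R != 0 :> K by rewrite pnatr_eq0 -lt0n.
    exact: cyclotomic.separable_Xn_sub_1.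
  by apply: mxminpoly_min; rewrite rmorphB rmorphXn /= horner_mx_X rmorph1 Ak subrr.
move=> /(diagonalizable_forLR uC)[z]; rewrite mxpoly.conjVmx // => AE.
exists (invmx C); rewrite ?unitmx_inv //; exists z.
  by rewrite AE mulmxK.
have CX m : A ^+ m *m invmx C = invmx C *m diag_mx (map_mx (fun x => x ^+ m) z).
  elim: m => [|m IHm].
    rewrite mul1mx (_ : map_mx _ _ = const_mx 1) ?diag_const_mx ?mulmx1 //.
    by apply/rowP => i; rewrite !mxE expr0.
  rewrite exprSr -mulmxA {2}AE mulmxK // mulmxA IHm -mulmxA mulmx_diag.
  by congr (_ *m diag_mx _); apply/rowP => i; rewrite !mxE exprSr.
move=> i; have := CX k; rewrite Ak mul1mx => /(congr1 (mulmx C)).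
rewrite mulKVmx // mulmxV // => /matrixP/(_ i i).
by rewrite !mxE eqxx => /esym.
Qed.

Section Coefficients.
Variables (n : nat) (P : {mpoly K[n]}).
Implicit Types (m : 'X_{1..n}).

Lemma semi_invariant_coef (z : 'rV[K]_n) lam m :
    (forall v, ev P (diag_mx z *m v) = lam * ev P v) ->
  P@_m != 0 -> \prod_i z 0 i ^+ m i = lam.
Proof.
move=> Pz nzm; pose zm (k : 'X_{1..n}) := \prod_i z 0 i ^+ k i.
pose Q : {mpoly K[n]} := \sum_(k <- msupp P) (P@_k * zm k) *: 'X_[k].
have : Q = lam *: P.
  apply: mpoly_ev_inj => v; rewrite {2}/ev mevalZ -/(ev P v) -Pz /ev /Q raddf_sum mevalE.
  apply: eq_bigr => k _; rewrite /= mevalZ mevalX -mulrA -big_split; congr (_ * _).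
  by apply: eq_bigr => i _; rewrite mul_diag_mx mxE exprMn.
move=> /(congr1 (mcoeff m)); rewrite mcoeffZ raddf_sum /= (bigD1_seq m) ?msupp_uniq //=; last first.
  by rewrite mcoeff_msupp.
rewrite mcoeffZ mcoeffX eqxx mulr1 big1 ?addr0 => [|k /negPf km]; last first.
  by rewrite mcoeffZ mcoeffX km mulr0.
by rewrite mulrC => /(mulIf nzm).
Qed.

(** Without such a monomial every term has degree at least 2 in the variables other than the i-th,
    and t^2 factors out along each line through the i-th coordinate point. *)
Lemma nonsingular_coef d i : P \is d.+2.-homog -> ~ singular_at (ev P) (delta_mx i 0) ->
  exists j, P@_(U_(i) *+ d.+1 + U_(j)) != 0.
Proof.
move=> /dhomogP homP nsing; apply: contrapT => H; apply: nsing => z.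
have {}H m : m \in msupp P -> (m i <= d)%N.
  move=> mP; rewrite leqNgt; apply/negP => di; apply: H.
  have dm : (\sum_k m k = d.+2)%N by rewrite -(homP _ mP) [RHS]mdegE.
  have [j jE] : exists j, m = (U_(i) *+ d.+1 + U_(j))%MM.
    have mE : m = (U_(i) *+ d.+1 + (m - U_(i) *+ d.+1))%MM.
      rewrite addmC submK //; apply/mnm_lepP => k; rewrite mulmnE mnm1E.
      by case: eqP => [<-|]; rewrite ?mul1n.
    have : mdeg (m - U_(i) *+ d.+1)%MM == 1.
      have := congr1 mdeg mE; rewrite mdegD mdegMn mdeg1 [mdeg m]homP //; lia.
    by rewrite mdeg_eq1 => /existsP[j /eqP jE]; exists j; rewrite {1}mE jE.
  by exists j; rewrite -jE -mcoeff_msupp.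
pose r (m : 'X_{1..n}) : {poly K} := (1 + z i 0 *: 'X) ^+ m i * 'X^(d - m i) *
  (\prod_(k | k != i) z k 0 ^+ m k)%:P.
exists (\sum_(m <- msupp P) P@_m *: r m) => t.
rewrite /ev mevalE horner_sum mulr_sumr; apply: eq_big_seq => m mP.
rewrite hornerZ mulrCA; congr (_ * _); rewrite (bigD1 i) //= !mxE !eqxx.
rewrite (eq_bigr (fun k => t ^+ m k * z k 0 ^+ m k)); last first.
  by move=> k /negPf ki; rewrite !mxE ki add0r exprMn.
rewrite big_split /= prodrXr.
have -> : (\sum_(k | k != i) m k = 2 + (d - m i))%N.
  have : (\sum_k m k = d.+2)%N by rewrite -(homP _ mP) [RHS]mdegE.
  by rewrite (bigD1 i) //=; have := H _ mP; lia.
rewrite exprD /r !hornerE /= [z i 0 * t]mulrC.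
set a := _ ^+ m i; set b := t ^+ (_ - _); set c := \prod_(_ | _) _; ring.
Qed.
End Coefficients.
End NormalForm.

(** * Quintic monomials in five variables and their weights modulo 17 *)

Local Notation o k := (@Ordinal 5 k isT).

Lemma ord5_ind (Q : 'I_5 -> Prop) :
  Q (o 0) -> Q (o 1) -> Q (o 2) -> Q (o 3) -> Q (o 4) -> forall i, Q i.
Proof.
move=> Q0 Q1 Q2 Q3 Q4 [[|[|[|[|[|//]]]]] p]; rewrite (bool_irrelevance p isT) //.
Qed.

Lemma sum_ord5 (V : nmodType) (F : 'I_5 -> V) :
  \sum_i F i = F (o 0) + F (o 1) + F (o 2) + F (o 3) + F (o 4).
Proof.
rewrite !big_ord_recl big_ord0 addr0 !addrA.
by do ![congr (_ + _)|congr (F _); exact: val_inj].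
Qed.

Lemma prod_ord5 (R : comNzRingType) (F : 'I_5 -> R) :
  \prod_i F i = F (o 0) * F (o 1) * F (o 2) * F (o 3) * F (o 4).
Proof.
rewrite !big_ord_recl big_ord0 mulr1 !mulrA.
by do ![congr (_ * _)|congr (F _); exact: val_inj].
Qed.

Definition mn (s : seq nat) : 'X_{1..5} := [multinom nth 0%N s i | i < 5].
Definition exps (m : 'X_{1..5}) := [:: m (o 0); m (o 1); m (o 2); m (o 3); m (o 4)].

Lemma expsK m : mn (exps m) = m.
Proof. by apply/mnmP; elim/ord5_ind; rewrite mnmE. Qed.

Lemma mnK s : size s == 5 -> exps (mn s) = s.
Proof. by case: s => [|? [|? [|? [|? [|? []]]]]] //; rewrite /exps !mnmE. Qed.

Section WeightCheck.
Local Open Scope nat_scope.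

(* The weights below are modulo 17, where 13 = -4 and 16 = (-4)^2. *)
Definition weight_check (w : seq nat) (L : seq (seq nat)) : bool :=
  all (fun a => all (fun b => all (fun c => all (fun d => all (fun e =>
      (a + b + c + d + e == 5) ==>
      (17 %| nth 0 w 0 * a + nth 0 w 1 * b + nth 0 w 2 * c + nth 0 w 3 * d + nth 0 w 4 * e)
      ==> ([:: a; b; c; d; e] \in L))
    (iota 0 6)) (iota 0 6)) (iota 0 6)) (iota 0 6)) (iota 0 6).

Definition degenerate_exps := [:: [:: 4; 1; 0; 0; 0]; [:: 3; 1; 0; 0; 1]; [:: 2; 1; 0; 0; 2];
  [:: 1; 1; 0; 0; 3]; [:: 0; 1; 0; 0; 4]; [:: 0; 4; 1; 0; 0]; [:: 0; 0; 4; 1; 0];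
  [:: 1; 0; 0; 4; 0]; [:: 0; 0; 0; 4; 1]].

Definition normal_exps := [:: [:: 4; 1; 0; 0; 0]; [:: 0; 4; 1; 0; 0]; [:: 0; 0; 4; 1; 0];
  [:: 1; 0; 0; 4; 0]; [:: 0; 0; 0; 0; 5]; [:: 1; 0; 1; 0; 3]; [:: 0; 1; 0; 1; 3];
  [:: 2; 0; 2; 0; 1]; [:: 0; 2; 0; 2; 1]; [:: 1; 1; 1; 1; 1]].

Lemma degenerate_weight_check : weight_check [:: 1; 13; 16; 4; 1] degenerate_exps.
Proof. by vm_compute. Qed.

Lemma normal_weight_check : weight_check [:: 1; 13; 16; 4; 0] normal_exps.
Proof. by vm_compute. Qed.

End WeightCheck.

Section FiveVariables.
Variables (K : numClosedFieldType) (P : {mpoly K[5]}).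

Lemma ev_expand (L : seq (seq nat)) v :
    uniq L -> all (fun s => size s == 5) L -> {in msupp P, forall m, exps m \in L} ->
  ev P v = \sum_(s <- L) P@_(mn s) *
    (v (o 0) 0 ^+ nth 0%N s 0 * v (o 1) 0 ^+ nth 0%N s 1 * v (o 2) 0 ^+ nth 0%N s 2
     * v (o 3) 0 ^+ nth 0%N s 3 * v (o 4) 0 ^+ nth 0%N s 4).
Proof.
move=> uL sL PL; pose F (m : 'X_{1..5}) := P@_m * \prod_i v i 0 ^+ m i.
have -> : ev P v = \sum_(m <- map mn L) F m.
  rewrite /ev mevalE [RHS](bigID (fun m => m \in msupp P)) /= [X in _ + X]big1 ?addr0 => [|m];
    last first.
    by rewrite /F -mcoeff_eq0 => /eqP->; rewrite mul0r.
  rewrite -[RHS]big_filter; apply: perm_big; apply: uniq_perm; rewrite ?msupp_uniq ?filter_uniq //.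
    rewrite map_inj_in_uniq // => s t /(allP sL)/mnK {2}<- /(allP sL)/mnK {2}<- ->; done.
  move=> m; rewrite mem_filter; case mP: (m \in msupp P) => //=.
  by apply/esym/mapP; exists (exps m); rewrite ?expsK ?PL.
rewrite big_map; apply: eq_bigr => s _; rewrite /F prod_ord5.
by rewrite !mnmE.
Qed.

Hypothesis homP : P \is 5.-homog.

Lemma sum_exps m : m \in msupp P -> sumn (exps m) = 5%N.
Proof.
move=> /(dhomog_mf homP) <-; rewrite [RHS]mdegE sum_ord5 /=.
by rewrite addn0 !addnA.
Qed.

Lemma exps_in (w : seq nat) (L : seq (seq nat)) m :
    m \in msupp P -> (17 %| \sum_(i < 5) nth 0 w i * nth 0 (exps m) i)%N ->
    weight_check w L ->
  exps m \in L.
Proof.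
move=> /sum_exps sm wm H; move: sm wm; rewrite sum_ord5 /exps /= addn0 => sm wm.
have le6 k : (k <= 5)%N -> k \in iota 0 6 by rewrite mem_iota.
have [m0 m1 m2 m3 m4] : [/\ m (o 0) <= 5, m (o 1) <= 5, m (o 2) <= 5, m (o 3) <= 5 & m (o 4) <=
  5]%N.
  by split; lia.
move: H => /allP H; have /allP {}H := H _ (le6 _ m0); have /allP {}H := H _ (le6 _ m1).
have /allP {}H := H _ (le6 _ m2); have /allP {}H := H _ (le6 _ m3).
by move: (H _ (le6 _ m4)); rewrite wm -!addnA sm.
Qed.
End FiveVariables.

Lemma perm_of_uniq (a b c d e : 'I_5) : uniq [:: a; b; c; d; e] ->
  exists s : {perm 'I_5}, [/\ s (o 0) = a, s (o 1) = b, s (o 2) = c, s (o 3) = d & s (o 4) = e].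
Proof.
move=> u; pose h (i : 'I_5) := nth a [:: a; b; c; d; e] i.
have ih : injective h.
  by move=> i j /eqP; rewrite nth_uniq // => /eqP/val_inj.
by exists (perm ih); rewrite !permE.
Qed.

(** * Eigenvalues of an element of order 17 *)

Section Weights.
Variable K : numClosedFieldType.

Lemma prime_order_primitive p (z : K) : prime p -> z ^+ p = 1 -> z != 1 ->
  p.-primitive_root z.
Proof.
move=> pp zp z1; have [k] := prim_order_exists (prime_gt0 pp) zp.
move=> kz /(primeP pp).2 /orP[]/eqP kE; rewrite kE in kz => //.
by case/eqP: z1; have := prim_expr_order kz; rewrite expr1.
Qed.

(** Since 13 = -4 has order 4 modulo 17, a value different from 1 drags along a cycle of four
    distinct values. The fifth value is 1 or repeats one in the cycle, and a rotation of the cycle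
    makes that one the first. *)
Lemma weights17 (y : 'I_5 -> K) :
    (forall i, y i ^+ 17 = 1) -> (exists i, y i != 1) ->
    (forall i, exists j, y j = y i ^+ 13) ->
  exists z (s : {perm 'I_5}), [/\ 17.-primitive_root z,
    [/\ y (s (o 0)) = z, y (s (o 1)) = z ^+ 13, y (s (o 2)) = z ^+ 16
      & y (s (o 3)) = z ^+ 4]
    & y (s (o 4)) = 1 \/ y (s (o 4)) = z].
Proof.
move=> y17 [a ya] step; set z := y a.
have pz : 17.-primitive_root z by apply: prime_order_primitive (y17 a) ya.
have zeq i j : (i %% 17 == j %% 17)%N -> z ^+ i = z ^+ j.
  by move=> ij; apply/eqP; rewrite (eq_prim_root_expr pz).
have zneq i j : (i %% 17 != j %% 17)%N -> z ^+ i != z ^+ j.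
  by move=> ij; rewrite (eq_prim_root_expr pz).
have [b yb] := step a; have [c yc] := step b; have [d yd] := step c.
have Ya : y a = z ^+ 1 by [].
have {}yb : y b = z ^+ 13 by [].
have {}yc : y c = z ^+ 16 by rewrite yc yb -exprM; exact: zeq.
have {}yd : y d = z ^+ 4 by rewrite yd yc -exprM; exact: zeq.
have u : uniq [:: a; b; c; d].
  rewrite /= !inE !negb_or !andbT; do !(apply/andP; split); apply/negP => /eqP/(congr1 y);
    rewrite ?Ya ?yb ?yc ?yd; apply/eqP; exact: zneq.
have [e ne] : exists e, e \notin [:: a; b; c; d].
  apply: contrapT => H.
  have /(uniq_leq_size (enum_uniq 'I_5)) : {subset enum 'I_5 <= [:: a; b; c; d]}.
    by move=> i _; apply/negPn/negP => ni; apply: H; exists i.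
  by rewrite -cardT card_ord.
have uniq_rot (a' b' c' d' : 'I_5) : perm_eq [:: a'; b'; c'; d'] [:: a; b; c; d] ->
    uniq [:: a'; b'; c'; d'; e].
  move=> pe; rewrite -[X in uniq X]/(rcons [:: a'; b'; c'; d'] e) rcons_uniq.
  by rewrite (perm_mem pe) ne (perm_uniq pe).
have rotE k : perm_eq (rot k [:: a; b; c; d]) [:: a; b; c; d] by apply/permPl/perm_rot.
have fin a' b' c' d' : perm_eq [:: a'; b'; c'; d'] [:: a; b; c; d] ->
    y b' = y a' ^+ 13 -> y c' = y a' ^+ 16 -> y d' = y a' ^+ 4 -> y a' != 1 ->
    y e = 1 \/ y e = y a' ->
  exists z (s : {perm 'I_5}), [/\ 17.-primitive_root z,
    [/\ y (s (o 0)) = z, y (s (o 1)) = z ^+ 13, y (s (o 2)) = z ^+ 16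
      & y (s (o 3)) = z ^+ 4]
    & y (s (o 4)) = 1 \/ y (s (o 4)) = z].
  move=> /uniq_rot/perm_of_uniq[s [sa sb sc sd se]] Eb Ec Ed Ea Ee.
  by exists (y a'), s; rewrite sa sb sc sd se; split=> //; apply: prime_order_primitive (y17 a') Ea.
have ye : y e = 1 \/ [\/ y e = y a, y e = y b, y e = y c | y e = y d].
  have [j yj] := step e.
  have {}yj : y e = y j ^+ 4.
    rewrite yj -exprM -[LHS]expr1 -[LHS]mulr1 -(expr1n _ 3) -(y17 e) -exprM -exprD.
    by [].
  have : j \in [:: a; b; c; d; e].
    apply/negPn/negP => nj.
    have /(uniq_leq_size (_ : uniq [:: a; b; c; d; e; j])) : {subset [:: a; b; c; d; e;
      j] <= enum 'I_5}.
      by move=> i _; rewrite mem_enum.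
    rewrite -cardT card_ord => H; have // : false; apply: H.
    rewrite -[X in uniq X]/(rcons [:: a; b; c; d; e] j) rcons_uniq nj /=.
    exact: (uniq_rot a b c d).
  rewrite !inE => /or4P[/eqP jE|/eqP jE|/eqP jE|/orP[]/eqP jE]; rewrite yj jE.
  - by right; constructor 4; rewrite Ya yd -exprM; exact: zeq.
  - by right; constructor 1; rewrite Ya yb -exprM; exact: zeq.
  - by right; constructor 2; rewrite yb yc -exprM; exact: zeq.
  - by right; constructor 3; rewrite yd yc -exprM; exact: zeq.
  (* The fifth index is its own successor: its value has cube 1 and 17th power 1, hence equals its
     18th power, which is 1. *)
  - left; move: yj; rewrite jE => yj.
    have y3 : y e ^+ 3 = 1.
      apply: (mulIf (_ : y e != 0)); last by rewrite mul1r -exprSr -yj.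
      apply: contraTneq isT => e0; have := y17 e.
      by rewrite e0 expr0n => /eqP; rewrite eq_sym oner_eq0.
    by rewrite -yj -[LHS]mulr1 -(y17 e) -exprS (exprM _ 3 6) y3 expr1n.
have neq1 k : (k %% 17 != 0)%N -> z ^+ k != 1 by move=> k17; rewrite -[X in _ != X](expr0 z);
  apply: (zneq k 0%N).
case: ye => [ye|[] ye].
- by apply: (fin a b c d); rewrite ?Ya ?yb ?yc ?yd -?exprM ?neq1 //; left.
- by apply: (fin a b c d); rewrite ?ye ?Ya ?yb ?yc ?yd -?exprM ?neq1 //; right.
- apply: (fin b c d a); rewrite ?ye ?Ya ?yb ?yc ?yd -?exprM ?neq1 //; try exact: zeq.
    exact: (rotE 1).
  by right.
- apply: (fin c d a b); rewrite ?ye ?Ya ?yb ?yc ?yd -?exprM ?neq1 //; try exact: zeq.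
    exact: (rotE 2).
  by right.
- apply: (fin d a b c); rewrite ?ye ?Ya ?yb ?yc ?yd -?exprM ?neq1 //; try exact: zeq.
    exact: (rotE 3).
  by right.
Qed.
End Weights.

Definition quintic_form (K : comNzRingType) (a b c d e f : K) (x0 x1 x2 x3 x4 : K) : K :=
  x0 ^+ 4 * x1 + x1 ^+ 4 * x2 + x2 ^+ 4 * x3 + x3 ^+ 4 * x0
  + a * x4 ^+ 5 + b * x4 ^+ 3 * (x0 * x2) + c * x4 ^+ 3 * (x1 * x3)
  + d * x4 * (x0 * x2) ^+ 2 + e * x4 * (x1 * x3) ^+ 2 + f * x4 * (x0 * x2) * (x1 * x3).

Definition quintic (K : comNzRingType) (a b c d e f : K) (v : 'cV[K]_5) : K :=
  quintic_form a b c d e f (v (o 0) 0) (v (o 1) 0) (v (o 2) 0) (v (o 3) 0) (v (o 4) 0).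

Section Normalization.
Variable K : numClosedFieldType.
Implicit Types (P : {mpoly K[5]}) (A C : 'M[K]_5).

Lemma singular_at_mul n (f : 'cV[K]_n -> K) (C : 'M_n) v : C \in unitmx ->
  singular_at (fun u => f (C *m u)) v -> singular_at f (C *m v).
Proof.
move=> uC sing z; have [r rE] := sing (invmx C *m z); exists r => t.
by rewrite -rE mulmxDr -scalemxAr mulKVmx.
Qed.

Lemma prod_exps (z : 'I_5 -> K) i j k :
  \prod_l z l ^+ (U_(i) *+ k + U_(j))%MM l = z i ^+ k * z j.
Proof.
rewrite -mevalX mpolyXD mevalM mevalXU; congr (_ * _).
elim: k => [|k IHk]; first by rewrite mulm0n mpolyX0 meval1.
by rewrite mulmS mpolyXD mevalM mevalXU IHk exprS.
Qed.

(** Two rescalings are made: by [mu], so that the 17th power becomes the identity, then by [kap], so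
    that [P] becomes invariant. A monomial x_i^4 x_j at each coordinate point then gives the
    relation y_j = y_i^-4 needed by [weights17]. *)
Lemma smooth_quintic_eigenvalues P A : P \is 5.-homog -> smooth_form P ->
    A \in unitmx -> (exists2 k, k != 0 & A ^+ 17 = k%:M) -> ~~ is_scalar_mx A ->
    (exists lam, forall v, ev P (A *m v) = lam * ev P v) ->
  exists2 C, C \in unitmx & exists z w,
    [/\ 17.-primitive_root z, w = 1 \/ w = z &
        forall v, ev P (C *m (diag_mx (\row_i [:: z; z ^+ 13; z ^+ 16; z ^+ 4; w]`_i) *m v))
                  = ev P (C *m v)].
Proof.
move=> homP smP uA [k k0 Ak] nsA [lam PA].
set mu := 17.-root k^-1; have muE : mu ^+ 17 = k^-1 by rewrite rootCK.
have mu0 : mu != 0 by have := expf_eq0 mu 17; rewrite muE invr_eq0 (negPf k0) /= => <-.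
pose B := mu *: A; pose l1 := mu ^+ 5 * lam.
have B17 : B ^+ 17 = 1 by rewrite exprZn Ak muE scale_scalar_mx mulVf.
have PB v : ev P (B *m v) = l1 * ev P v.
  by rewrite -scalemxAl (ev_scale _ _ homP) PA mulrA.
have [C uC [z BC z17]] := finite_order_diagonalizable (isT : (0 < 17)%N) B17.
pose P1 := subst_mx P C; have homP1 : P1 \is 5.-homog by exact: subst_mx_homog.
have P1z v : ev P1 (diag_mx z *m v) = l1 * ev P1 v.
  by rewrite !ev_subst_mx mulmxA -BC -mulmxA PB.
have step i : exists j, z 0 i ^+ 4 * z 0 j = l1.
  have [|j nzj] := nonsingular_coef homP1 (_ : ~ singular_at _ (delta_mx i 0)).
    rewrite (_ : ev P1 = fun v => ev P (C *m v)); last by apply: funext => v; rewrite ev_subst_mx.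
    move=> /(singular_at_mul uC); apply: smooth_form_nonsingular => //.
    apply/eqP => /(congr1 (mulmx (invmx C))); rewrite mulKmx // mulmx0 => /matrixP/(_ i 0).
    by rewrite !mxE !eqxx => /eqP; rewrite oner_eq0.
  by exists j; rewrite -prod_exps; apply: semi_invariant_coef nzj.
have l17 : l1 ^+ 17 = 1.
  by have [j <-] := step (o 0); rewrite exprMn -exprM mulnC exprM !z17 expr1n mulr1.
have l10 : l1 != 0.
  by apply: contraTneq isT => l0; move/eqP: l17; rewrite l0 expr0n eq_sym oner_eq0.
(* 7 is the inverse of 5 modulo 17: this fifth root of [l1] is itself a 17th root of unity. *)
pose kap := l1 ^+ 7; have kap5 : kap ^+ 5 = l1.
  by rewrite -exprM (exprD _ (17 * 2) 1) exprM l17 expr1n mul1r.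
have kap0 : kap != 0 by rewrite expf_neq0.
have kap17 : kap ^+ 17 = 1 by rewrite -exprM mulnC exprM l17 expr1n.
pose y i := z 0 i / kap.
have y17 i : y i ^+ 17 = 1 by rewrite exprMn z17 exprVn kap17 invr1 mulr1.
have ystep i : exists j, y j = y i ^+ 13.
  have [j zj] := step i; exists j.
  have y0 : y i != 0.
    by apply: contraTneq isT => y0; have /eqP := y17 i; rewrite y0 expr0n eq_sym oner_eq0.
  apply: (mulfI (expf_neq0 4 y0)); rewrite -exprD y17 /y exprMn mulrACA zj exprVn -invfM -exprSr.
  by rewrite kap5 divff.
have yn1 : exists i, y i != 1.
  apply: contrapT => H; case/negP: nsA; apply/is_scalar_mxP; exists (mu^-1 * kap).
  have zE : diag_mx z = kap%:M.
    rewrite -diag_const_mx; congr diag_mx; apply/rowP => i; rewrite mxE.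
    have /eqP := negbNE (introN idP (fun yi => H (ex_intro _ i yi))).
    by move=> /(canRL (divfK kap0)); rewrite mul1r.
  have BE : B = kap%:M by apply: (can_inj (mulmxK uC)); rewrite BC zE scalar_mxC.
  by rewrite -scale_scalar_mx -BE scalerA mulVf // scale1r.
have [x [s [px [s0 s1 s2 s3] s4]]] := weights17 y17 yn1 ystep.
exists (col_perm s C); first by rewrite col_permE unitmx_mul uC unitmx_perm.
exists x, (y (s (o 4))); split=> // v.
have BD : B *m col_perm s C = kap *: (col_perm s C *m diag_mx (\row_i [:: x; x ^+ 13; x ^+ 16;
  x ^+ 4; y (s (o 4))]`_i)).
  rewrite {1}col_permE mulmxA BC -col_permE.
  apply/matrixP => i j; rewrite !mul_mx_diag !mxE mulrCA; congr (_ * _).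
  have <- : y (s j) = [:: x; x ^+ 13; x ^+ 16; x ^+ 4; y (s (o 4))]`_j.
    by elim/ord5_ind: j; rewrite ?s0 ?s1 ?s2 ?s3.
  by rewrite /y mulrC divfK.
apply: (mulfI l10); rewrite -{1}kap5 -(ev_scale _ _ homP) mulmxA scalemxAl -BD -mulmxA.
by rewrite PB.
Qed.

Lemma primitive_root_semi_invariant_weight P (z : K) (w : seq nat) m :
    17.-primitive_root z ->
    (forall v, ev P (diag_mx (\row_(i < 5) z ^+ nth 0%N w i) *m v) = ev P v) ->
    m \in msupp P ->
  (17 %| \sum_(i < 5) nth 0 w i * nth 0 (exps m) i)%N.
Proof.
move=> pz Pz; rewrite mcoeff_msupp => nzm.
have Pz1 v : ev P (diag_mx (\row_(i < 5) z ^+ nth 0%N w i) *m v) = 1 * ev P v.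
  by rewrite mul1r.
have /eqP := semi_invariant_coef Pz1 nzm.
rewrite (eq_bigr (fun i : 'I_5 => z ^+ (nth 0 w i * nth 0 (exps m) i)%N)); last first.
  by move=> i _; rewrite !mxE -exprM; elim/ord5_ind: i.
by rewrite prodrXr -(prim_order_dvd pz).
Qed.

(** On the line x1 = x2 = x3 = 0 the form vanishes, and its only terms of order less than 4
    transversally are x1 times a binary quartic in x0 and x4. A zero of that quartic on the line is
    a singular point. *)
Lemma degenerate_weights_singular P (z : K) : P \is 5.-homog -> 17.-primitive_root z ->
    (forall v, ev P (diag_mx (\row_i [:: z; z ^+ 13; z ^+ 16; z ^+ 4; z]`_i) *m v) = ev P v) ->
  exists2 v, v != 0 & singular_at (ev P) v.
Proof.
move=> homP pz Pz.
have PE v : ev P v = \sum_(s <- degenerate_exps) P@_(mn s) *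
    (v (o 0) 0 ^+ nth 0%N s 0 * v (o 1) 0 ^+ nth 0%N s 1 * v (o 2) 0 ^+ nth 0%N s 2
     * v (o 3) 0 ^+ nth 0%N s 3 * v (o 4) 0 ^+ nth 0%N s 4).
  apply: ev_expand => // m mP.
  apply: (exps_in homP mP _ degenerate_weight_check).
    apply: primitive_root_semi_invariant_weight pz _ mP => {}v; rewrite -[RHS]Pz.
    by congr (ev P (diag_mx _ *m v)); apply/rowP; elim/ord5_ind; rewrite !mxE.
set p4 := P@_(mn [:: 4; 1; 0; 0; 0]%N); set p3 := P@_(mn [:: 3; 1; 0; 0; 1]%N).
set p2 := P@_(mn [:: 2; 1; 0; 0; 2]%N); set p1 := P@_(mn [:: 1; 1; 0; 0; 3]%N).
set p0 := P@_(mn [:: 0; 1; 0; 0; 4]%N).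
have [[r s] nzrs q0] : exists2 rs : K * K, (rs.1 != 0) || (rs.2 != 0) &
    p4 * rs.1 ^+ 4 + p3 * rs.1 ^+ 3 * rs.2 + p2 * rs.1 ^+ 2 * rs.2 ^+ 2
    + p1 * rs.1 * rs.2 ^+ 3 + p0 * rs.2 ^+ 4 = 0.
  have [p40|p40] := eqVneq p4 0.
    by exists (1, 0) => /=; rewrite ?oner_eq0 // p40; ring.
  clearbody p4 p3 p2 p1 p0; have [r rE] := @solve_monicpoly K 4 (nth 0 [:: - p0 / p4; - p1 / p4; - p2 / p4; - p3 / p4]) isT.
  exists (r, 1); first by rewrite oner_eq0 orbT.
  by rewrite /= rE !big_ord_recl big_ord0 /=; field.
pose v : 'cV[K]_5 := \col_i [:: r; 0; 0; 0; s]`_i.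
exists v.
  apply/eqP => v0; case/orP: nzrs => /=.
    by have /matrixP/(_ (o 0) 0) := v0; rewrite !mxE /= => ->; rewrite eqxx.
  by have /matrixP/(_ (o 4) 0) := v0; rewrite !mxE /= => ->; rewrite eqxx.
move=> u; set u0 := u (o 0) 0; set u1 := u (o 1) 0; set u2 := u (o 2) 0.
set u3 := u (o 3) 0; set u4 := u (o 4) 0.
pose R : {poly K} := r%:P + u0 *: 'X; pose S : {poly K} := s%:P + u4 *: 'X.
pose q : {poly K} := p4 *: R ^+ 4 + p3 *: (R ^+ 3 * S) + p2 *: (R ^+ 2 * S ^+ 2)
  + p1 *: (R * S ^+ 3) + p0 *: S ^+ 4.
have /factor_theorem[q' qE] : root q 0.
  rewrite rootE /q /R /S; clearbody p4 p3 p2 p1 p0 u0 u4.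
  by rewrite !hornerE -[X in _ == X]q0 /=; apply/eqP; ring.
set k5 := P@_(mn [:: 0; 4; 1; 0; 0]%N); set k6 := P@_(mn [:: 0; 0; 4; 1; 0]%N).
set k7 := P@_(mn [:: 1; 0; 0; 4; 0]%N); set k8 := P@_(mn [:: 0; 0; 0; 4; 1]%N).
exists (q' * u1%:P + (k5 * u1 ^+ 4 * u2 + k6 * u2 ^+ 4 * u3) *: 'X^3
  + (k7 * u3 ^+ 4) *: ('X^2 * R) + (k8 * u3 ^+ 4) *: ('X^2 * S)) => t.
have qt : q.[t] = q'.[t] * t by rewrite qE subr0 !hornerE.
rewrite PE /degenerate_exps !big_cons big_nil /= !mxE /= -/u0 -/u1 -/u2 -/u3 -/u4.
rewrite -/p4 -/p3 -/p2 -/p1 -/p0 -/k5 -/k6 -/k7 -/k8.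
rewrite !add0r; set X0 := r + t * u0; set X4 := s + t * u4.
have Rt : R.[t] = X0 by rewrite /R !hornerE mulrC.
have St : S.[t] = X4 by rewrite /S !hornerE mulrC.
have qX : q.[t] = p4 * X0 ^+ 4 + p3 * (X0 ^+ 3 * X4) + p2 * (X0 ^+ 2 * X4 ^+ 2)
    + p1 * (X0 * X4 ^+ 3) + p0 * X4 ^+ 4.
  rewrite /q; move: (R) (S) Rt St => R' S' Rt St.
  by rewrite !(hornerD, hornerZ, hornerM, horner_exp) Rt St.
move: (R) (S) Rt St => R' S' Rt St.
rewrite !(hornerD, hornerZ, hornerM, hornerX, hornerC) Rt St.
move: qt qX; move: (q.[t]) (q'.[t]) X0 X4 {Rt St} => qt q't X0 X4 -> qX.
clearbody p4 p3 p2 p1 p0 k5 k6 k7 k8 u0 u1 u2 u3 u4.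
transitivity (q't * t * (t * u1) + (k5 * u1 ^+ 4 * u2 + k6 * u2 ^+ 4 * u3) * t ^+ 5
  + (k7 * u3 ^+ 4) * (t ^+ 4 * X0) + (k8 * u3 ^+ 4) * (t ^+ 4 * X4)); last by ring.
rewrite qX; ring.
Qed.
End Normalization.

(** * Reduction of the quintic to its normal form *)

Section NormalFormOfForm.
Variable K : numClosedFieldType.
Implicit Types (P : {mpoly K[5]}) (A C : 'M[K]_5).

(** The first three equations give [l1], [l2], [l3] in turn from [l0]; the last one becomes l0^255 =
    [c]. The abbreviations [p] and [q] are the 16th powers of [l0] and [k0]. *)
Lemma klein_scaling (k0 k1 k2 k3 : K) : k0 != 0 -> k1 != 0 -> k2 != 0 -> k3 != 0 ->
  exists l0 l1 l2 l3, [/\ l0 != 0, l1 != 0, l2 != 0 & l3 != 0] /\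
    [/\ k0 * l0 ^+ 4 * l1 = 1, k1 * l1 ^+ 4 * l2 = 1, k2 * l2 ^+ 4 * l3 = 1
      & k3 * l3 ^+ 4 * l0 = 1].
Proof.
move=> k00 k10 k20 k30; pose q := k0 ^+ 16; pose c := k3 * k1 ^+ 16 / (k2 ^+ 4 * q ^+ 4).
have q0 : q != 0 by exact: expf_neq0.
have c0 : c != 0.
  apply: mulf_neq0; first by apply: mulf_neq0 => //; exact: expf_neq0.
  by rewrite invr_neq0 // mulf_neq0 //; exact: expf_neq0.
have [l0 l00 l0c] : exists2 l, l != 0 & l ^+ 16 ^+ 16 = l * c.
  have root_ex n (n0 : (0 < n)%N) : exists2 l, l != 0 & l ^+ n = c.
    exists (n.-root c); last exact: rootCK.
    by apply: contraNneq c0 => r0; have := rootCK n0 c; rewrite r0 expr0n eqn0Ngt n0 => <-.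
  have [l l0 lc] := root_ex 255%N isT.
  by exists l; rewrite // -lc -exprM -exprS.
pose p := l0 ^+ 16; have p0 : p != 0 by exact: expf_neq0.
rewrite -/p in l0c; have pE : p = l0 ^+ 4 ^+ 4 by rewrite -exprM.
have qE : q = k0 ^+ 4 ^+ 4 by rewrite -exprM.
exists l0, (k0 * l0 ^+ 4)^-1, (k0 ^+ 4 * p / k1), (k1 ^+ 4 / (k2 * q * p ^+ 4)).
have l04 : l0 ^+ 4 != 0 by exact: expf_neq0.
have k04 : k0 ^+ 4 != 0 by exact: expf_neq0.
have p4 : p ^+ 4 != 0 by exact: expf_neq0.
have k14 : k1 ^+ 4 != 0 by exact: expf_neq0.
split; first by split=> //; rewrite ?mulf_neq0 ?invr_neq0 ?mulf_neq0.
split.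
- by rewrite mulfV // mulf_neq0.
- by rewrite pE; move: (l0 ^+ 4) l04 => u u0; field; rewrite k00 k10 u0.
- by rewrite qE; move: (k0 ^+ 4) k04 => u u0; field; rewrite u0 k10 k20 p0.
- apply: (mulIf (_ : p ^+ 16 != 0)); first exact: expf_neq0.
  rewrite mul1r {2}l0c /c; clearbody p q; field; by rewrite q0 k20 p0.
Qed.

(** For each i, [normal_exps] contains exactly one monomial x_i^4 x_j, so nonsingularity at the
    coordinate points makes five coefficients nonzero. Four of them are scaled to 1 and the fifth,
    that of w^5, is [a]. *)
Lemma normal_weights P (z : K) : P \is 5.-homog -> 17.-primitive_root z ->
    (forall v, ev P (diag_mx (\row_i [:: z; z ^+ 13; z ^+ 16; z ^+ 4; 1]`_i) *m v) = ev P v) ->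
    (forall v, v != 0 -> ~ singular_at (ev P) v) ->
  exists2 C, C \in unitmx & exists a b c d e f, a != 0 /\
    forall v, ev P (C *m v) = quintic a b c d e f v.
Proof.
move=> homP pz Pz nsP.
have exN m : m \in msupp P -> exps m \in normal_exps.
  move=> mP; apply: (exps_in homP mP _ normal_weight_check).
    apply: primitive_root_semi_invariant_weight pz _ mP => {}v; rewrite -[RHS]Pz.
    by congr (ev P (diag_mx _ *m v)); apply/rowP; elim/ord5_ind; rewrite !mxE.
have PE v : ev P v = \sum_(s <- normal_exps) P@_(mn s) *
    (v (o 0) 0 ^+ nth 0%N s 0 * v (o 1) 0 ^+ nth 0%N s 1 * v (o 2) 0 ^+ nth 0%N s 2
     * v (o 3) 0 ^+ nth 0%N s 3 * v (o 4) 0 ^+ nth 0%N s 4) by exact: ev_expand.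
have nz i : exists2 j, (mn (exps (U_(i) *+ 4 + U_(j))%MM) \in msupp P) &
    exps (U_(i) *+ 4 + U_(j))%MM \in normal_exps.
  have [|j nzj] := nonsingular_coef homP (_ : ~ singular_at _ (delta_mx i 0)).
    apply: nsP; apply/eqP => /matrixP/(_ i 0).
    by rewrite !mxE !eqxx => /eqP; rewrite oner_eq0.
  by exists j; rewrite ?expsK ?mcoeff_msupp // exN // mcoeff_msupp.
set k0 := P@_(mn [:: 4; 1; 0; 0; 0]%N); set k1 := P@_(mn [:: 0; 4; 1; 0; 0]%N).
set k2 := P@_(mn [:: 0; 0; 4; 1; 0]%N); set k3 := P@_(mn [:: 1; 0; 0; 4; 0]%N).
set k4 := P@_(mn [:: 0; 0; 0; 0; 5]%N).
have exU i j : exps (U_(i) *+ 4 + U_(j))%MM =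
  [seq ((i == k) * 4 + (j == k))%N | k <- [:: o 0; o 1; o 2; o 3; o 4]].
  by rewrite /exps /= 5!mnmDE 5!mulmnE !mnm1E.
have [k00 k10 k20 k30 k40] : [/\ k0 != 0, k1 != 0, k2 != 0, k3 != 0 & k4 != 0].
  split; [have [j Am Bm] := nz (o 0) | have [j Am Bm] := nz (o 1) | have [j Am Bm] := nz (o 2)
    | have [j Am Bm] := nz (o 3) | have [j Am Bm] := nz (o 4)];
  rewrite exU in Bm; elim/ord5_ind: j Am Bm => Am Bm; vm_compute in Bm; try discriminate Bm;
  by move: Am; rewrite exU mcoeff_msupp.
have [l0 [l1 [l2 [l3 [[l00 l10 l20 l30] [E0 E1 E2 E3]]]]]] := klein_scaling k00 k10 k20 k30.
pose D : 'rV[K]_5 := \row_i [:: l0; l1; l2; l3; 1]`_i.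
exists (diag_mx D).
  rewrite unitmxE det_diag unitfE prod_ord5 !mxE /= !mulf_neq0 ?oner_eq0 //.
exists k4, (P@_(mn [:: 1; 0; 1; 0; 3]%N) * (l0 * l2)), (P@_(mn [:: 0; 1; 0; 1; 3]%N) * (l1 * l3)),
  (P@_(mn [:: 2; 0; 2; 0; 1]%N) * (l0 * l2) ^+ 2), (P@_(mn [:: 0; 2; 0; 2; 1]%N) * (l1 * l3) ^+ 2),
  (P@_(mn [:: 1; 1; 1; 1; 1]%N) * (l0 * l2 * l1 * l3)); split=> // v.
rewrite PE /normal_exps !big_cons big_nil /= mul_diag_mx !mxE /= !mul1r /quintic /quintic_form.
rewrite -/k0 -/k1 -/k2 -/k3 -/k4.
set x0 := v (o 0) 0; set x1 := v (o 1) 0; set x2 := v (o 2) 0; set x3 := v (o 3) 0;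
  set x4 := v (o 4) 0.
transitivity (k0 * l0 ^+ 4 * l1 * (x0 ^+ 4 * x1) + k1 * l1 ^+ 4 * l2 * (x1 ^+ 4 * x2)
  + k2 * l2 ^+ 4 * l3 * (x2 ^+ 4 * x3) + k3 * l3 ^+ 4 * l0 * (x3 ^+ 4 * x0)
  + k4 * x4 ^+ 5 + P@_(mn [:: 1; 0; 1; 0; 3]%N) * (l0 * l2) * x4 ^+ 3 * (x0 * x2)
  + P@_(mn [:: 0; 1; 0; 1; 3]%N) * (l1 * l3) * x4 ^+ 3 * (x1 * x3)
  + P@_(mn [:: 2; 0; 2; 0; 1]%N) * (l0 * l2) ^+ 2 * x4 * (x0 * x2) ^+ 2
  + P@_(mn [:: 0; 2; 0; 2; 1]%N) * (l1 * l3) ^+ 2 * x4 * (x1 * x3) ^+ 2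
  + P@_(mn [:: 1; 1; 1; 1; 1]%N) * (l0 * l2 * l1 * l3) * x4 * (x0 * x2) * (x1 * x3)); last first.
  by rewrite E0 E1 E2 E3 !mul1r.
rewrite !expr0 !expr1.
move: k0 k1 k2 k3 k4 (P@__) (P@__) (P@__) (P@__) (P@__) x0 x1 x2 x3 x4 {E0 E1 E2 E3 k00 k10 k20 k30
  k40 D}.
move=> k0 k1 k2 k3 k4 k5 k6 k7 k8 k9 x0 x1 x2 x3 x4; ring.
Qed.

Lemma smooth_quintic_normal_form P A : P \is 5.-homog -> smooth_form P ->
    A \in unitmx -> (exists2 k, k != 0 & A ^+ 17 = k%:M) -> ~~ is_scalar_mx A ->
    (exists lam, forall v, ev P (A *m v) = lam * ev P v) ->
  exists2 C, C \in unitmx & exists a b c d e f, a != 0 /\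
    forall v, ev P (C *m v) = quintic a b c d e f v.
Proof.
move=> homP smP uA A17 nsA PA.
have [C uC [z [w [pz wE PC]]]] := smooth_quintic_eigenvalues homP smP uA A17 nsA PA.
pose P1 := subst_mx P C; have homP1 : P1 \is 5.-homog by exact: subst_mx_homog.
have nsP v : v != 0 -> ~ singular_at (ev P1) v.
  move=> v0; rewrite (_ : ev P1 = fun v => ev P (C *m v)); last first.
    by apply: funext => u; rewrite ev_subst_mx.
  move=> /(singular_at_mul uC); apply: smooth_form_nonsingular => //.
  apply: contraNneq v0 => /(congr1 (mulmx (invmx C))).
  by rewrite mulKmx // mulmx0 => ->.
have {}PC v : ev P1 (diag_mx (\row_i [:: z; z ^+ 13; z ^+ 16; z ^+ 4; w]`_i) *m v) = ev P1 v.
  by rewrite !ev_subst_mx PC.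
case: wE PC => -> PC; last first.
  by have [v v0 /(nsP v v0)] := degenerate_weights_singular homP1 pz PC.
have [D uD [a [b [c [d [e [f [a0 DE]]]]]]]] := normal_weights homP1 pz PC nsP.
exists (C *m D); first by rewrite unitmx_mul uC.
by exists a, b, c, d, e, f; split=> // v; rewrite -DE ev_subst_mx mulmxA.
Qed.
End NormalFormOfForm.

(** * Polars and Hessian of the normal form, and their covariance *)

Section Polars.
Variable K : numClosedFieldType.
Variables a b c d e f : K.
Implicit Types (x y z : 'cV[K]_5) (T : 'M[K]_5).

Local Notation F := (quintic a b c d e f).

Definition grad x : 'rV[K]_5 :=
  let x0 := x (o 0) 0 in let x1 := x (o 1) 0 in let x2 := x (o 2) 0 in
  let x3 := x (o 3) 0 in let w := x (o 4) 0 in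
  \row_i [:: 4 * x0 ^+ 3 * x1 + x3 ^+ 4 + b * w ^+ 3 * x2 + 2 * d * w * x0 * x2 ^+ 2 + f * w * x1 *
    x2 * x3;
    x0 ^+ 4 + 4 * x1 ^+ 3 * x2 + c * w ^+ 3 * x3 + 2 * e * w * x1 * x3 ^+ 2 + f * w * x0 * x2 * x3;
    x1 ^+ 4 + 4 * x2 ^+ 3 * x3 + b * w ^+ 3 * x0 + 2 * d * w * x0 ^+ 2 * x2 + f * w * x0 * x1 * x3;
    x2 ^+ 4 + 4 * x3 ^+ 3 * x0 + c * w ^+ 3 * x1 + 2 * e * w * x1 ^+ 2 * x3 + f * w * x0 * x1 * x2;
    5 * a * w ^+ 4 + 3 * b * w ^+ 2 * x0 * x2 + 3 * c * w ^+ 2 * x1 * x3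
      + d * x0 ^+ 2 * x2 ^+ 2 + e * x1 ^+ 2 * x3 ^+ 2 + f * x0 * x1 * x2 * x3]`_i.

Definition hess x : 'M[K]_5 :=
  let x0 := x (o 0) 0 in let x1 := x (o 1) 0 in let x2 := x (o 2) 0 in
  let x3 := x (o 3) 0 in let w := x (o 4) 0 in
  let h00 := 12 * x0 ^+ 2 * x1 + 2 * d * w * x2 ^+ 2 in
  let h11 := 12 * x1 ^+ 2 * x2 + 2 * e * w * x3 ^+ 2 in
  let h22 := 12 * x2 ^+ 2 * x3 + 2 * d * w * x0 ^+ 2 in
  let h33 := 12 * x3 ^+ 2 * x0 + 2 * e * w * x1 ^+ 2 in
  let h01 := 4 * x0 ^+ 3 + f * w * x2 * x3 in
  let h12 := 4 * x1 ^+ 3 + f * w * x0 * x3 in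
  let h23 := 4 * x2 ^+ 3 + f * w * x0 * x1 in
  let h03 := 4 * x3 ^+ 3 + f * w * x1 * x2 in
  let h02 := b * w ^+ 3 + 4 * d * w * x0 * x2 + f * w * x1 * x3 in
  let h13 := c * w ^+ 3 + f * w * x0 * x2 + 4 * e * w * x1 * x3 in
  let h44 := 20 * a * w ^+ 3 + 6 * b * w * x0 * x2 + 6 * c * w * x1 * x3 in
  let h04 := x2 * (3 * b * w ^+ 2 + 2 * d * x0 * x2 + f * x1 * x3) in
  let h24 := x0 * (3 * b * w ^+ 2 + 2 * d * x0 * x2 + f * x1 * x3) in
  let h14 := x3 * (3 * c * w ^+ 2 + 2 * e * x1 * x3 + f * x0 * x2) in
  let h34 := x1 * (3 * c * w ^+ 2 + 2 * e * x1 * x3 + f * x0 * x2) in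
  \matrix_(i, j) (nth [::] [:: [:: h00; h01; h02; h03; h04]; [:: h01; h11; h12; h13; h14];
    [:: h02; h12; h22; h23; h24]; [:: h03; h13; h23; h33; h34]; [:: h04; h14; h24; h34; h44]] i)`_j.

Definition polar1 x y : K := (grad x *m y) 0 0.
Definition polar2 x y : K := (y^T *m hess x *m y) 0 0.

(** This is the trace of C times the Hessian spelled out in scalars, so that coefficients can be
    extracted by evaluating at small integers. *)
Definition second_partials (C : 'M[K]_5) (x0 x1 x2 x3 w : K) : K :=
  C (o 0) (o 0) * (12 * x0 ^+ 2 * x1 + 2 * d * w * x2 ^+ 2)
  + C (o 1) (o 1) * (12 * x1 ^+ 2 * x2 + 2 * e * w * x3 ^+ 2)
  + C (o 2) (o 2) * (12 * x2 ^+ 2 * x3 + 2 * d * w * x0 ^+ 2)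
  + C (o 3) (o 3) * (12 * x3 ^+ 2 * x0 + 2 * e * w * x1 ^+ 2)
  + (C (o 0) (o 1) + C (o 1) (o 0)) * (4 * x0 ^+ 3 + f * w * x2 * x3)
  + (C (o 1) (o 2) + C (o 2) (o 1)) * (4 * x1 ^+ 3 + f * w * x0 * x3)
  + (C (o 2) (o 3) + C (o 3) (o 2)) * (4 * x2 ^+ 3 + f * w * x0 * x1)
  + (C (o 0) (o 3) + C (o 3) (o 0)) * (4 * x3 ^+ 3 + f * w * x1 * x2)
  + (C (o 0) (o 2) + C (o 2) (o 0)) * (b * w ^+ 3 + 4 * d * w * x0 * x2 + f * w * x1 * x3)
  + (C (o 1) (o 3) + C (o 3) (o 1)) * (c * w ^+ 3 + f * w * x0 * x2 + 4 * e * w * x1 * x3)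
  + C (o 4) (o 4) * (20 * a * w ^+ 3 + 6 * b * w * x0 * x2 + 6 * c * w * x1 * x3)
  + ((C (o 0) (o 4) + C (o 4) (o 0)) * x2 + (C (o 2) (o 4) + C (o 4) (o 2)) * x0)
    * (3 * b * w ^+ 2 + 2 * d * x0 * x2 + f * x1 * x3)
  + ((C (o 1) (o 4) + C (o 4) (o 1)) * x3 + (C (o 3) (o 4) + C (o 4) (o 3)) * x1)
    * (3 * c * w ^+ 2 + 2 * e * x1 * x3 + f * x0 * x2).

Lemma trace_hess C x : \tr (C *m hess x) =
  second_partials C (x (o 0) 0) (x (o 1) 0) (x (o 2) 0) (x (o 3) 0) (x (o 4) 0).
Proof.
rewrite /mxtrace sum_ord5 !mxE !sum_ord5 !mxE /= /second_partials.
move: (x (o 0) 0) (x (o 1) 0) (x (o 2) 0) (x (o 3) 0) (x (o 4) 0) => x0 x1 x2 x3 w.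
ring.
Qed.

Lemma polar2E x y : polar2 x y = second_partials (y *m y^T)
  (x (o 0) 0) (x (o 1) 0) (x (o 2) 0) (x (o 3) 0) (x (o 4) 0).
Proof. by rewrite -trace_hess mxtrace_mulC mulmxA mxtrace_mulC mulmxA /mxtrace big_ord1. Qed.

(** This certifies the explicit [grad] and [hess]. The factor 2 avoids a division, as [polar2] is
    twice the second Taylor coefficient; the upper half of the expansion follows from the lower one
    by exchanging x and y in degree 5. *)
Lemma quintic_taylor x y t : 2 * F (x + t *: y) = 2 * F x + t * (2 * polar1 x y)
  + t ^+ 2 * polar2 x y + t ^+ 3 * polar2 y x + t ^+ 4 * (2 * polar1 y x) + t ^+ 5 * (2 * F y).
Proof.
have yyE (z : 'cV[K]_5) i j : (z *m z^T) i j = z i 0 * z j 0 by rewrite !mxE big_ord1 mxE.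
rewrite !polar2E /second_partials !yyE /polar1 !mxE !sum_ord5 !mxE /=.
rewrite /quintic /quintic_form !mxE.
move: (x (o 0) 0) (x (o 1) 0) (x (o 2) 0) (x (o 3) 0) (x (o 4) 0) => x0 x1 x2 x3 x4.
move: (y (o 0) 0) (y (o 1) 0) (y (o 2) 0) (y (o 3) 0) (y (o 4) 0) => y0 y1 y2 y3 y4.
ring.
Qed.

End Polars.

Section Covariance.
Variable K : numClosedFieldType.

Lemma poly_coef_eq (p q : seq K) : size p = size q ->
  (forall t, (Poly p).[t] = (Poly q).[t]) -> p = q.
Proof.
move=> spq /eq_poly_everywhere pq; apply: (@eq_from_nth _ 0) => // i _.
by rewrite -[LHS]coef_Poly -[RHS]coef_Poly pq.
Qed.

Lemma symmetric_form_eq0 n (M : 'M[K]_n) : M^T = M ->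
  (forall y : 'cV_n, (y^T *m M *m y) 0 0 = 0) -> M = 0.
Proof.
move=> symM M0; have eE i j : ((delta_mx i 0 : 'cV_n)^T *m M *m (delta_mx j 0 : 'cV_n)) 0 0 = M i j.
  by rewrite trmx_delta -rowE -colE !mxE.
apply/matrixP => i j; rewrite [RHS]mxE; have := M0 (delta_mx i 0 + delta_mx j 0).
have entryD (A B : 'M[K]_1) : (A + B) 0 0 = A 0 0 + B 0 0 by rewrite mxE.
rewrite [(_ + _)^T]raddfD /= !(mulmxDl, mulmxDr) !entryD !eE.
have := M0 (delta_mx i 0); have := M0 (delta_mx j 0); rewrite !eE => -> ->.
have -> : M j i = M i j by rewrite -{1}symM mxE.
rewrite add0r addr0 -mulr2n => /eqP.
by rewrite mulrn_eq0 /= => /eqP.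
Qed.

Variables a b c d e f : K.
Local Notation F := (quintic a b c d e f).

Lemma hess_sym x : (hess a b c d e f x)^T = hess a b c d e f x.
Proof.
by apply/matrixP => i j; rewrite mxE; elim/ord5_ind: i; elim/ord5_ind: j; rewrite !mxE.
Qed.

Variable T : 'M[K]_5.
Hypothesis FT : forall x, F (T *m x) = F x.

Lemma polars_invariant x y :
  polar1 a b c d e f (T *m x) (T *m y) = polar1 a b c d e f x y /\
  polar2 a b c d e f (T *m x) (T *m y) = polar2 a b c d e f x y.
Proof.
have n2 : (2 : K) != 0 by rewrite pnatr_eq0.
pose s x y := [:: 2 * F x; 2 * polar1 a b c d e f x y; polar2 a b c d e f x y;
  polar2 a b c d e f y x; 2 * polar1 a b c d e f y x; 2 * F y].
have sE u v t : (Poly (s u v)).[t] = 2 * F (u + t *: v).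
  by rewrite quintic_taylor horner_Poly /=; ring.
have [] : s (T *m x) (T *m y) = s x y.
  by apply: poly_coef_eq => // t; rewrite !sE scalemxAr -mulmxDr FT.
by move=> _ /(mulfI n2).
Qed.

Lemma hess_covariant x : T^T *m hess a b c d e f (T *m x) *m T = hess a b c d e f x.
Proof.
apply/eqP; rewrite -subr_eq0; apply/eqP/symmetric_form_eq0 => [|y].
  by rewrite raddfB /= !trmx_mul trmxK !hess_sym mulmxA.
have [_] := polars_invariant x y; rewrite /polar2 trmx_mul !mulmxA => E.
by rewrite mulmxBr mulmxBl !mulmxA mxE [X in _ + X]mxE E subrr.
Qed.

Hypothesis uT : T \in unitmx.

Definition pull (C : 'M[K]_5) := invmx T *m C *m (invmx T)^T.

(* [\tr (C *m hess x)] is a constant-coefficient second-order operator applied to the quintic;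
   [pull] is how [T] acts on such operators. *)
Lemma trace_hess_covariant (C : 'M[K]_5) x :
  \tr (C *m hess a b c d e f (T *m x)) = \tr (pull C *m hess a b c d e f x).
Proof.
rewrite -(hess_covariant x) /pull !mulmxA [RHS]mxtrace_mulC !mulmxA mulmxV // mul1mx.
by rewrite -[C *m _ *m T^T]mulmxA -trmx_mul mulmxV // trmx1 mulmx1.
Qed.

End Covariance.

(** * Comparing coefficients of cubics; operators annihilating the quintic *)

Section CoefficientExtraction.
Variable K : numClosedFieldType.

(** With factors 1, -1, -2 and a cubic evaluated at (1,1), (1,-1) or (-1,1), and a coordinate point,
    this reads off twice the coefficient of a monomial x^2 y. *)
Lemma linear_combination3 (k1 k2 k3 A B L1 R1 L2 R2 L3 R3 : K) :
    L1 = R1 -> L2 = R2 -> L3 = R3 ->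
    A - B = k1 * (L1 - R1) + k2 * (L2 - R2) + k3 * (L3 - R3) ->
  A = B.
Proof.
by move=> -> -> -> /eqP; rewrite !subrr !mulr0 !addr0 subr_eq0 => /eqP.
Qed.

(** With factors 1, -1, -1, -1 and a cubic evaluated at (1,1,1) and its three single sign changes,
    this reads off four times the coefficient of x y z. *)
Lemma linear_combination4 (k1 k2 k3 k4 A B L1 R1 L2 R2 L3 R3 L4 R4 : K) :
    L1 = R1 -> L2 = R2 -> L3 = R3 -> L4 = R4 ->
    A - B = k1 * (L1 - R1) + k2 * (L2 - R2) + k3 * (L3 - R3) + k4 * (L4 - R4) ->
  A = B.
Proof.
by move=> -> -> -> -> /eqP; rewrite !subrr !mulr0 !addr0 subr_eq0 => /eqP.
Qed.

Variables a b c d e f : K.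

Section Cubes.
Variables (C : 'M[K]_5) (r : 'I_5 -> K) (al be ga : K) (m : 'I_5 -> K).
Hypothesis cubeE : forall x0 x1 x2 x3 w,
  (r (o 0) * x0 + r (o 1) * x1 + r (o 2) * x2 + r (o 3) * x3 + r (o 4) * w) ^+ 3 =
  second_partials a b c d e f C x0 x1 x2 x3 w + (ga * w ^+ 2 + al * (x0 * x2) + be * (x1 * x3))
    * (m (o 0) * x0 + m (o 1) * x1 + m (o 2) * x2 + m (o 3) * x3 + m (o 4) * w).

Let nat_neq0 k : (k.+1%:R : K) != 0. Proof. by rewrite pnatr_eq0. Qed.

Let mul_eq0 k (x y : K) : k.+1%:R * x ^+ 2 * y = 0 -> x * y = 0.
Proof.
move=> /eqP; rewrite expr2 !mulf_eq0 (negPf (nat_neq0 k)) orbb /= => /orP[]/eqP->.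
  by rewrite mul0r.
by rewrite mulr0.
Qed.

(** Second derivatives of F contain x_i^2 x_{i+1} but never x_{i+1}^2 x_i, with indices modulo 4,
    and neither does a multiple of the quadric in w^2, x0 x2, x1 x3. In the cube that coefficient is
    3 r_{i+1}^2 r_i. *)
Lemma cube_adjacent : [/\ r (o 0) * r (o 3) = 0, r (o 1) * r (o 0) = 0,
  r (o 2) * r (o 1) = 0 & r (o 3) * r (o 2) = 0].
Proof.
split; apply: (@mul_eq0 5).
- apply: (linear_combination3 (k1 := 1) (k2 := -1) (k3 := -2)
    (cubeE 1 0 0 1 0) (cubeE 1 0 0 (-1) 0) (cubeE 0 0 0 1 0)); rewrite /second_partials; ring.
- apply: (linear_combination3 (k1 := 1) (k2 := -1) (k3 := -2)
    (cubeE 1 1 0 0 0) (cubeE (-1) 1 0 0 0) (cubeE 1 0 0 0 0)); rewrite /second_partials; ring.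
- apply: (linear_combination3 (k1 := 1) (k2 := -1) (k3 := -2)
    (cubeE 0 1 1 0 0) (cubeE 0 (-1) 1 0 0) (cubeE 0 1 0 0 0)); rewrite /second_partials; ring.
- apply: (linear_combination3 (k1 := 1) (k2 := -1) (k3 := -2)
    (cubeE 0 0 1 1 0) (cubeE 0 0 (-1) 1 0) (cubeE 0 0 1 0 0)); rewrite /second_partials; ring.
Qed.

Let mulrn_inj k (x : K) : k.+1%:R * x = 0 -> x = 0.
Proof. by move=> /eqP; rewrite mulf_eq0 (negPf (nat_neq0 k)) => /eqP. Qed.

(** By [cube_adjacent] the coefficient of x_i^2 x_{i+1} in the cube is 0, which kills the first four
    diagonal entries of [C]; these are the only source of the monomials x_i^2 w. *)
Lemma cube_last : [/\ r (o 0) * r (o 4) = 0, r (o 1) * r (o 4) = 0,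
  r (o 2) * r (o 4) = 0 & r (o 3) * r (o 4) = 0].
Proof.
have [r03 r10 r21 r32] := cube_adjacent.
have C0 : C (o 0) (o 0) = 0.
  apply: (@mulrn_inj 23); transitivity (6 * r (o 0) * (r (o 1) * r (o 0)));
    last by rewrite r10 mulr0.
  apply/esym; apply: (linear_combination3 (k1 := 1) (k2 := -1) (k3 := -2)
    (cubeE 1 1 0 0 0) (cubeE 1 (-1) 0 0 0) (cubeE 0 1 0 0 0)); rewrite /second_partials; ring.
have C1 : C (o 1) (o 1) = 0.
  apply: (@mulrn_inj 23); transitivity (6 * r (o 1) * (r (o 2) * r (o 1)));
    last by rewrite r21 mulr0.
  apply/esym; apply: (linear_combination3 (k1 := 1) (k2 := -1) (k3 := -2)
    (cubeE 0 1 1 0 0) (cubeE 0 1 (-1) 0 0) (cubeE 0 0 1 0 0)); rewrite /second_partials; ring.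
have C2 : C (o 2) (o 2) = 0.
  apply: (@mulrn_inj 23); transitivity (6 * r (o 2) * (r (o 3) * r (o 2)));
    last by rewrite r32 mulr0.
  apply/esym; apply: (linear_combination3 (k1 := 1) (k2 := -1) (k3 := -2)
    (cubeE 0 0 1 1 0) (cubeE 0 0 1 (-1) 0) (cubeE 0 0 0 1 0)); rewrite /second_partials; ring.
have C3 : C (o 3) (o 3) = 0.
  apply: (@mulrn_inj 23); transitivity (6 * r (o 3) * (r (o 0) * r (o 3)));
    last by rewrite r03 mulr0.
  apply/esym; apply: (linear_combination3 (k1 := 1) (k2 := -1) (k3 := -2)
    (cubeE 1 0 0 1 0) (cubeE (-1) 0 0 1 0) (cubeE 1 0 0 0 0)); rewrite /second_partials; ring.
split; apply: (@mul_eq0 5).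
- transitivity (4 * d * C (o 2) (o 2)); last by rewrite C2 mulr0.
  apply: (linear_combination3 (k1 := 1) (k2 := -1) (k3 := -2)
    (cubeE 1 0 0 0 1) (cubeE 1 0 0 0 (-1)) (cubeE 0 0 0 0 1)); rewrite /second_partials; ring.
- transitivity (4 * e * C (o 3) (o 3)); last by rewrite C3 mulr0.
  apply: (linear_combination3 (k1 := 1) (k2 := -1) (k3 := -2)
    (cubeE 0 1 0 0 1) (cubeE 0 1 0 0 (-1)) (cubeE 0 0 0 0 1)); rewrite /second_partials; ring.
- transitivity (4 * d * C (o 0) (o 0)); last by rewrite C0 mulr0.
  apply: (linear_combination3 (k1 := 1) (k2 := -1) (k3 := -2)
    (cubeE 0 0 1 0 1) (cubeE 0 0 1 0 (-1)) (cubeE 0 0 0 0 1)); rewrite /second_partials; ring.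
- transitivity (4 * e * C (o 1) (o 1)); last by rewrite C1 mulr0.
  apply: (linear_combination3 (k1 := 1) (k2 := -1) (k3 := -2)
    (cubeE 0 0 0 1 1) (cubeE 0 0 0 1 (-1)) (cubeE 0 0 0 0 1)); rewrite /second_partials; ring.
Qed.

(** The entry of [C] at (0,1) governs both x0^3 and, through [f], w x2 x3. The latter has
    coefficient 6 r2 r3 r4 in the cube, zero by [cube_adjacent]; hence the former, r0^3, is zero.
    The other indices follow cyclically. *)
Lemma cube_power_last : f != 0 ->
  [/\ r (o 0) = 0, r (o 1) = 0, r (o 2) = 0 & r (o 3) = 0].
Proof.
move=> f0; have [r03 r10 r21 r32] := cube_adjacent.
have cube0 (x : K) : x ^+ 3 = 0 -> x = 0 by move=> /eqP; rewrite expf_eq0 => /eqP.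
have f_inj (x : K) : 4 * f * x = 0 -> x = 0.
  by move=> /eqP; rewrite !mulf_eq0 (negPf (nat_neq0 3)) (negPf f0) => /eqP.
split; apply: cube0.
- transitivity (4 * (C (o 0) (o 1) + C (o 1) (o 0))).
    by have := cubeE 1 0 0 0 0; rewrite /second_partials => E; transitivity (r (o 0) ^+ 3);
      [|rewrite (_ : r (o 0) = r (o 0) * 1 + r (o 1) * 0 + r (o 2) * 0 + r (o 3) * 0 + r (o 4) * 0)
        ?E]; ring.
  rewrite (_ : C (o 0) (o 1) + C (o 1) (o 0) = 0) ?mulr0 //; apply: f_inj.
  transitivity (24 * (r (o 3) * r (o 2)) * r (o 4)); last by rewrite r32 mulr0 mul0r.
  apply/esym; apply: (linear_combination4 (k1 := 1) (k2 := -1) (k3 := -1) (k4 := -1)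
    (cubeE 0 0 1 1 1) (cubeE 0 0 1 1 (-1)) (cubeE 0 0 1 (-1) 1) (cubeE 0 0 (-1) 1 1));
      rewrite /second_partials; ring.
- transitivity (4 * (C (o 1) (o 2) + C (o 2) (o 1))).
    by have := cubeE 0 1 0 0 0; rewrite /second_partials => E; transitivity (r (o 1) ^+ 3);
      [|rewrite (_ : r (o 1) = r (o 0) * 0 + r (o 1) * 1 + r (o 2) * 0 + r (o 3) * 0 + r (o 4) * 0)
        ?E]; ring.
  rewrite (_ : C (o 1) (o 2) + C (o 2) (o 1) = 0) ?mulr0 //; apply: f_inj.
  transitivity (24 * (r (o 0) * r (o 3)) * r (o 4)); last by rewrite r03 mulr0 mul0r.
  apply/esym; apply: (linear_combination4 (k1 := 1) (k2 := -1) (k3 := -1) (k4 := -1)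
    (cubeE 1 0 0 1 1) (cubeE 1 0 0 1 (-1)) (cubeE 1 0 0 (-1) 1) (cubeE (-1) 0 0 1 1));
      rewrite /second_partials; ring.
- transitivity (4 * (C (o 2) (o 3) + C (o 3) (o 2))).
    by have := cubeE 0 0 1 0 0; rewrite /second_partials => E; transitivity (r (o 2) ^+ 3);
      [|rewrite (_ : r (o 2) = r (o 0) * 0 + r (o 1) * 0 + r (o 2) * 1 + r (o 3) * 0 + r (o 4) * 0)
        ?E]; ring.
  rewrite (_ : C (o 2) (o 3) + C (o 3) (o 2) = 0) ?mulr0 //; apply: f_inj.
  transitivity (24 * (r (o 1) * r (o 0)) * r (o 4)); last by rewrite r10 mulr0 mul0r.
  apply/esym; apply: (linear_combination4 (k1 := 1) (k2 := -1) (k3 := -1) (k4 := -1)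
    (cubeE 1 1 0 0 1) (cubeE 1 1 0 0 (-1)) (cubeE 1 (-1) 0 0 1) (cubeE (-1) 1 0 0 1));
      rewrite /second_partials; ring.
- transitivity (4 * (C (o 0) (o 3) + C (o 3) (o 0))).
    by have := cubeE 0 0 0 1 0; rewrite /second_partials => E; transitivity (r (o 3) ^+ 3);
      [|rewrite (_ : r (o 3) = r (o 0) * 0 + r (o 1) * 0 + r (o 2) * 0 + r (o 3) * 1 + r (o 4) * 0)
        ?E]; ring.
  rewrite (_ : C (o 0) (o 3) + C (o 3) (o 0) = 0) ?mulr0 //; apply: f_inj.
  transitivity (24 * (r (o 2) * r (o 1)) * r (o 4)); last by rewrite r21 mulr0 mul0r.
  apply/esym; apply: (linear_combination4 (k1 := 1) (k2 := -1) (k3 := -1) (k4 := -1)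
    (cubeE 0 1 1 0 1) (cubeE 0 1 1 0 (-1)) (cubeE 0 1 (-1) 0 1) (cubeE 0 (-1) 1 0 1));
      rewrite /second_partials; ring.
Qed.

End Cubes.
End CoefficientExtraction.

Section Apolar.
Variable K : numClosedFieldType.
Variables a b c d e f : K.
Hypothesis f0 : f != 0.
Variable C : 'M[K]_5.
Hypotheses (symC : C^T = C)
  (CE : forall x0 x1 x2 x3 w, second_partials a b c d e f C x0 x1 x2 x3 w = 0).

Let nat_inj k (x : K) : k.+1%:R * x = 0 -> x = 0.
Proof. by move=> /eqP; rewrite mulf_eq0 pnatr_eq0 => /eqP. Qed.

Let f_inj k (x : K) : k.+1%:R * f * x = 0 -> x = 0.
Proof. by move=> /eqP; rewrite !mulf_eq0 pnatr_eq0 (negPf f0) => /eqP. Qed.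

Let CT i j : C i j = C j i. Proof. by rewrite -[in LHS]symC mxE. Qed.

(** Every excluded entry is the only one to multiply some monomial: x_i^2 x_{i+1} on the diagonal,
    x_i^3 for cyclic neighbours, and with coefficient [f] a product of three of x0, ..., x3 in the
    last row. The three equations are the coefficients of w^3, w x0 x2 and w x1 x3. *)
Lemma apolar_quadric : [/\
    forall i j : 'I_5, ~~ ((i : nat, j : nat) \in [:: (0, 2); (2, 0); (1, 3); (3, 1);
      (4, 4)]%N) -> C i j = 0,
    b * (2 * C (o 0) (o 2)) + c * (2 * C (o 1) (o 3)) + 20 * a * C (o 4) (o 4) = 0,
    4 * d * (2 * C (o 0) (o 2)) + f * (2 * C (o 1) (o 3)) + 6 * b * C (o 4) (o 4) = 0
  & f * (2 * C (o 0) (o 2)) + 4 * e * (2 * C (o 1) (o 3)) + 6 * c * C (o 4) (o 4) = 0].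
Proof.
have C01 : C (o 0) (o 1) = 0.
  apply: (@nat_inj 7); rewrite -[RHS](CE 1 0 0 0 0) /second_partials ?(CT (o 1) (o 0)); ring.
have C12 : C (o 1) (o 2) = 0.
  apply: (@nat_inj 7); rewrite -[RHS](CE 0 1 0 0 0) /second_partials ?(CT (o 2) (o 1)); ring.
have C23 : C (o 2) (o 3) = 0.
  apply: (@nat_inj 7); rewrite -[RHS](CE 0 0 1 0 0) /second_partials ?(CT (o 3) (o 2)); ring.
have C03 : C (o 0) (o 3) = 0.
  apply: (@nat_inj 7); rewrite -[RHS](CE 0 0 0 1 0) /second_partials ?(CT (o 3) (o 0)); ring.
have C00 : C (o 0) (o 0) = 0.
  apply: (@nat_inj 23); apply: (linear_combination3 (k1 := 1) (k2 := -1) (k3 := -2)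
      (CE 1 1 0 0 0) (CE 1 (-1) 0 0 0) (CE 0 1 0 0 0)); rewrite /second_partials; ring.
have C11 : C (o 1) (o 1) = 0.
  apply: (@nat_inj 23); apply: (linear_combination3 (k1 := 1) (k2 := -1) (k3 := -2)
      (CE 0 1 1 0 0) (CE 0 1 (-1) 0 0) (CE 0 0 1 0 0)); rewrite /second_partials; ring.
have C22 : C (o 2) (o 2) = 0.
  apply: (@nat_inj 23); apply: (linear_combination3 (k1 := 1) (k2 := -1) (k3 := -2)
      (CE 0 0 1 1 0) (CE 0 0 1 (-1) 0) (CE 0 0 0 1 0)); rewrite /second_partials; ring.
have C33 : C (o 3) (o 3) = 0.
  apply: (@nat_inj 23); apply: (linear_combination3 (k1 := 1) (k2 := -1) (k3 := -2)
      (CE 1 0 0 1 0) (CE (-1) 0 0 1 0) (CE 1 0 0 0 0)); rewrite /second_partials; ring.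
have C04 : C (o 0) (o 4) = 0.
  apply: (@f_inj 7); apply: (linear_combination4 (k1 := 1) (k2 := -1) (k3 := -1) (k4 := -1)
      (CE 0 1 1 1 0) (CE 0 1 1 (-1) 0) (CE 0 1 (-1) 1 0) (CE 0 (-1) 1 1 0));
        rewrite /second_partials (CT (o 4) (o 0)); ring.
have C14 : C (o 1) (o 4) = 0.
  apply: (@f_inj 7); apply: (linear_combination4 (k1 := 1) (k2 := -1) (k3 := -1) (k4 := -1)
      (CE 1 0 1 1 0) (CE 1 0 1 (-1) 0) (CE 1 0 (-1) 1 0) (CE (-1) 0 1 1 0));
        rewrite /second_partials (CT (o 4) (o 1)); ring.
have C24 : C (o 2) (o 4) = 0.
  apply: (@f_inj 7); apply: (linear_combination4 (k1 := 1) (k2 := -1) (k3 := -1) (k4 := -1)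
      (CE 1 1 0 1 0) (CE 1 1 0 (-1) 0) (CE 1 (-1) 0 1 0) (CE (-1) 1 0 1 0));
        rewrite /second_partials (CT (o 4) (o 2)); ring.
have C34 : C (o 3) (o 4) = 0.
  apply: (@f_inj 7); apply: (linear_combination4 (k1 := 1) (k2 := -1) (k3 := -1) (k4 := -1)
      (CE 1 1 1 0 0) (CE 1 1 (-1) 0 0) (CE 1 (-1) 1 0 0) (CE (-1) 1 1 0 0));
        rewrite /second_partials (CT (o 4) (o 3)); ring.
split.
- move=> i j; elim/ord5_ind: i; elim/ord5_ind: j; rewrite ?inE //= => _;
    by rewrite ?C01 ?C12 ?C23 ?C03 ?C00 ?C11 ?C22 ?C33 ?C04 ?C14 ?C24 ?C34 // CT ?C01 ?C12 ?C23
      ?C03 ?C00 ?C11 ?C22 ?C33 ?C04 ?C14 ?C24 ?C34.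
- rewrite -[RHS](CE 0 0 0 0 1) /second_partials (CT (o 2) (o 0)) (CT (o 3) (o 1)); ring.
- apply: (@nat_inj 3); apply: (linear_combination4 (k1 := 1) (k2 := -1) (k3 := -1) (k4 := -1)
      (CE 1 0 1 0 1) (CE 1 0 1 0 (-1)) (CE 1 0 (-1) 0 1) (CE (-1) 0 1 0 1));
        rewrite /second_partials (CT (o 2) (o 0)) (CT (o 3) (o 1)); ring.
- apply: (@nat_inj 3); apply: (linear_combination4 (k1 := 1) (k2 := -1) (k3 := -1) (k4 := -1)
      (CE 0 1 0 1 1) (CE 0 1 0 1 (-1)) (CE 0 1 0 (-1) 1) (CE 0 (-1) 0 1 1));
        rewrite /second_partials (CT (o 2) (o 0)) (CT (o 3) (o 1)); ring.
Qed.
End Apolar.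

Definition vec5 (K : nmodType) (x0 x1 x2 x3 x4 : K) : 'cV[K]_5 :=
  \col_i [:: x0; x1; x2; x3; x4]`_i.

(** * Symmetries preserve the last coordinate or the last coordinate point *)

Section DistinguishedCoordinate.
Variable K : numClosedFieldType.
Variables a b c d e f : K.
Variable T : 'M[K]_5.
Hypotheses (uT : T \in unitmx)
  (FT : forall x, quintic a b c d e f (T *m x) = quintic a b c d e f x).

Local Notation H := (hess a b c d e f).
Local Notation S := (second_partials a b c d e f).

Definition fixes_last_coordinate :=
  [/\ T (o 4) (o 0) = 0, T (o 4) (o 1) = 0, T (o 4) (o 2) = 0 & T (o 4) (o 3) = 0].

Definition fixes_last_vector :=
  [/\ T (o 0) (o 4) = 0, T (o 1) (o 4) = 0, T (o 2) (o 4) = 0 & T (o 3) (o 4) = 0].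

Lemma mul_vec5 x0 x1 x2 x3 x4 k : (T *m vec5 x0 x1 x2 x3 x4) k 0 =
  T k (o 0) * x0 + T k (o 1) * x1 + T k (o 2) * x2 + T k (o 3) * x3 + T k (o 4) * x4.
Proof. by rewrite mxE sum_ord5 !mxE. Qed.

Lemma trace_hess_mul C x0 x1 x2 x3 x4 :
  \tr (C *m H (T *m vec5 x0 x1 x2 x3 x4)) = S (pull T C) x0 x1 x2 x3 x4.
Proof. by rewrite (trace_hess_covariant FT uT) trace_hess !mxE. Qed.

Lemma trace_delta_hess i j x : \tr (delta_mx i j *m H x) = H x j i.
Proof.
rewrite /mxtrace (bigD1 i) //= big1 ?addr0 => [|k /negPf ki]; rewrite mxE.
  rewrite (bigD1 j) //= big1 ?addr0 => [|l /negPf lj]; first by rewrite mxE !eqxx mul1r.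
  by rewrite mxE eqxx lj mul0r.
by rewrite big1 // => l _; rewrite mxE ki mul0r.
Qed.

Lemma row_determined i j : i != j -> (forall l, l != o 4 -> T i l = 0) ->
  (forall l, l != o 4 -> T j l = 0) -> False.
Proof.
move=> ij Ti Tj; pose u : 'rV[K]_5 := T j (o 4) *: delta_mx 0 i - T i (o 4) *: delta_mx 0 j.
have uT0 : u *m T = 0.
  rewrite mulmxBl -!scalemxAl -!rowE; apply/rowP => l; rewrite !mxE.
  have [->|l4] := eqVneq l (o 4); first by rewrite mulrC subrr.
  by rewrite (Ti l) // (Tj l) // !mulr0 subrr.
have u0 : u = 0 by rewrite -(mulmxK uT u) uT0 mul0mx.
have Ti4 : T i (o 4) = 0.
  move/rowP/(_ j): u0; rewrite !mxE !eqxx eq_sym (negPf ij) mulr0 mulr1 sub0r => /eqP.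
  by rewrite oppr_eq0 => /eqP.
have : row i T = 0 by apply/rowP => l; rewrite !mxE; have [->|/Ti] := eqVneq l (o 4).
rewrite rowE => /(congr1 (mulmx^~ (invmx T))); rewrite mulmxK // mul0mx => /rowP/(_ i).
by rewrite !mxE !eqxx => /eqP; rewrite oner_eq0.
Qed.

(** Evaluating the identity for w^3 at [T *m x] expresses the cube of the last row of [T] in the
    form handled by [cube_power_last]: the operator is pulled back, and the quadric reproduces
    itself up to [kap]. *)
Lemma last_coordinate_of_cube C al be ga del kap : f != 0 ->
    (forall x : 'cV[K]_5, x (o 4) 0 ^+ 3 = \tr (C *m H x) +
      (ga * x (o 4) 0 ^+ 2 + al * (x (o 0) 0 * x (o 2) 0) + be * (x (o 1) 0 * x (o 3) 0))
      * (del * x (o 4) 0)) ->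
    (forall x : 'cV[K]_5, let q (x : 'cV[K]_5) := ga * x (o 4) 0 ^+ 2
       + al * (x (o 0) 0 * x (o 2) 0) + be * (x (o 1) 0 * x (o 3) 0) in
     q (T *m x) = kap * q x) ->
  fixes_last_coordinate.
Proof.
move=> f0 wE qE.
apply: (@cube_power_last _ a b c d e f (pull T C) (fun j => T (o 4) j)
  (kap * al) (kap * be) (kap * ga) (fun j => del * T (o 4) j)) => // x0 x1 x2 x3 x4.
rewrite -mul_vec5 wE /= qE trace_hess_mul mul_vec5 !mxE /=; congr (_ + _); ring.
Qed.

Lemma last_coordinate_of_partial C : f != 0 ->
    (forall x : 'cV[K]_5, x (o 4) 0 ^+ 3 = \tr (C *m H x)) ->
  fixes_last_coordinate.
Proof.
move=> f0 wE; apply: (@last_coordinate_of_cube C 0 0 0 0 1) => // x /=.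
  by rewrite wE !mul0r mulr0 addr0.
by rewrite !mul0r !addr0 mulr0.
Qed.

Lemma row_cube C k : (forall x : 'cV[K]_5, x k 0 ^+ 3 = \tr (C *m H x)) ->
  [/\ T k (o 0) * T k (o 4) = 0, T k (o 1) * T k (o 4) = 0,
      T k (o 2) * T k (o 4) = 0 & T k (o 3) * T k (o 4) = 0].
Proof.
move=> kE; apply: (@cube_last _ a b c d e f (pull T C) (fun j => T k j) 0 0 0 (fun=> 0)).
move=> x0 x1 x2 x3 x4; rewrite -mul_vec5 kE trace_hess_mul; ring.
Qed.

(** Each x_k^3 with k < 4 is a Hessian entry up to 4, so row k of [T] either has last entry 0 or is
    a multiple of w. In the second case [T] would send the last coordinate point, where F is [a], to
    the k-th one, where F is 0. *)
Lemma last_vector_of_f0 : f = 0 -> a != 0 -> fixes_last_vector.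
Proof.
move=> f0 a0.
have n4 : (4 : K) != 0 by rewrite pnatr_eq0.
have cubeH k : k != o 4 -> exists C, forall x : 'cV[K]_5, x k 0 ^+ 3 = \tr (C *m H x).
  have cube_of i j : (forall x : 'cV[K]_5, 4 * x k 0 ^+ 3 = H x j i) ->
      exists C, forall x : 'cV[K]_5, x k 0 ^+ 3 = \tr (C *m H x).
    move=> hE; exists (4^-1 *: delta_mx i j) => x.
    by rewrite -scalemxAl mxtraceZ trace_delta_hess -hE mulKf.
  elim/ord5_ind: k cube_of => // cube_of _.
  - by apply: (cube_of (o 0) (o 1)) => x; rewrite !mxE /= f0 !mul0r addr0.
  - by apply: (cube_of (o 1) (o 2)) => x; rewrite !mxE /= f0 !mul0r addr0.
  - by apply: (cube_of (o 2) (o 3)) => x; rewrite !mxE /= f0 !mul0r addr0.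
  - by apply: (cube_of (o 0) (o 3)) => x; rewrite !mxE /= f0 !mul0r addr0.
have only4 k : [/\ T k (o 0) * T k (o 4) = 0, T k (o 1) * T k (o 4) = 0,
      T k (o 2) * T k (o 4) = 0 & T k (o 3) * T k (o 4) = 0] -> T k (o 4) != 0 ->
    forall l, l != o 4 -> T k l = 0.
  by move=> [k0 k1 k2 k3] k4; elim/ord5_ind => // _; apply: (mulIf k4); rewrite mul0r.
have col4 k : k != o 4 -> T k (o 4) = 0.
  move=> k4; apply/eqP/negPn/negP => Tk4.
  have [C CE] := cubeH k k4; have Tk := only4 k (row_cube CE) Tk4.
  have other j : j != k -> T j (o 4) = 0.
    move=> jk; apply/eqP/negPn/negP => Tj4; apply: (row_determined jk _ Tk).
    have [j4|j4] := eqVneq j (o 4); last first.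
      by have [C' C'E] := cubeH j j4; exact: only4 (row_cube C'E) Tj4.
    (* As the k-th coordinate of [T *m x] is a multiple of w, pulling back the operator for x_k^3
       makes w^3 a second derivative too, so the last row obeys the same alternative. *)
    apply: only4 Tj4; apply: (@row_cube ((T k (o 4) ^+ 3)^-1 *: pull T C)) => x.
    rewrite -scalemxAl mxtraceZ -(trace_hess_covariant FT uT) -CE mxE sum_ord5.
    rewrite (Tk (o 0)) // (Tk (o 1)) // (Tk (o 2)) // (Tk (o 3)) // !mul0r !add0r exprMn mulKf
      ?expf_neq0 //.
    by rewrite j4.
  have := FT (delta_mx (o 4) 0).
  have -> : T *m (delta_mx (o 4) 0 : 'cV_5) = T k (o 4) *: (delta_mx k 0 : 'cV_5).
    rewrite -colE; apply/colP => j; rewrite !mxE eqxx andbT.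
    by have [->|/other] := eqVneq j k; rewrite ?mulr1 // mulr0.
  rewrite /quintic /quintic_form !mxE /= => E; case/eqP: a0; move: E.
  by elim/ord5_ind: k k4 {Tk4 CE Tk other C} => //= _;
    rewrite !(mulr0, mul0r, expr0n, mulr1, expr1n, add0r, addr0) /= ?(mulr0, mul0r, addr0, add0r)
      => ->.
by split; apply: col4.
Qed.
End DistinguishedCoordinate.

Definition quad_mx (K : nmodType) (p q r : K) : 'M[K]_5 := \matrix_(i, j)
  (nth [::] [:: [:: 0; 0; p; 0; 0]; [:: 0; 0; 0; q; 0]; [:: p; 0; 0; 0; 0];
                [:: 0; q; 0; 0; 0]; [:: 0; 0; 0; 0; r]] i)`_j.

Section ApolarQuadric.
Variable K : numClosedFieldType.
Variables a b c d e f : K.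
Variable T : 'M[K]_5.
Hypotheses (uT : T \in unitmx)
  (FT : forall x, quintic a b c d e f (T *m x) = quintic a b c d e f x).
Hypothesis f0 : f != 0.

Local Notation H := (hess a b c d e f).
Local Notation S := (second_partials a b c d e f).

Lemma quad_mx_sym (p q r : K) : (quad_mx p q r)^T = quad_mx p q r.
Proof.
by apply/matrixP => i j; rewrite mxE; elim/ord5_ind: i; elim/ord5_ind: j; rewrite !mxE.
Qed.

Lemma trace_quad_hess p q r x : \tr (quad_mx p q r *m H x) =
  (2 * p * b + 2 * q * c + 20 * r * a) * x (o 4) 0 ^+ 3
  + (2 * p * (4 * d) + 2 * q * f + 6 * r * b) * (x (o 4) 0 * x (o 0) 0 * x (o 2) 0)
  + (2 * p * f + 2 * q * (4 * e) + 6 * r * c) * (x (o 4) 0 * x (o 1) 0 * x (o 3) 0).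
Proof. rewrite trace_hess /second_partials !mxE /=; ring. Qed.

Lemma pull_sym C : C^T = C -> (pull T C)^T = pull T C.
Proof. by move=> sC; rewrite /pull !trmx_mul trmxK sC mulmxA. Qed.

Lemma pull_quad p q r : (forall x, \tr (quad_mx p q r *m H x) = 0) ->
  let C := pull T (quad_mx p q r) in
  [/\ C = quad_mx (C (o 0) (o 2)) (C (o 1) (o 3)) (C (o 4) (o 4)),
    4 * d * (2 * C (o 0) (o 2)) + f * (2 * C (o 1) (o 3)) + 6 * b * C (o 4) (o 4) = 0
  & f * (2 * C (o 0) (o 2)) + 4 * e * (2 * C (o 1) (o 3)) + 6 * c * C (o 4) (o 4) = 0].
Proof.
move=> trQ C.
have symC : C^T = C by apply/pull_sym/quad_mx_sym.
have CE x0 x1 x2 x3 x4 : S C x0 x1 x2 x3 x4 = 0.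
  by rewrite -(trace_hess_mul uT FT) trQ.
have [C0 _ E1 E2] := apolar_quadric f0 symC CE; split=> //.
have C20 : C (o 2) (o 0) = C (o 0) (o 2) by rewrite -[in LHS]symC mxE.
have C31 : C (o 3) (o 1) = C (o 1) (o 3) by rewrite -[in LHS]symC mxE.
apply/matrixP => i j; rewrite [RHS]mxE; elim/ord5_ind: i; elim/ord5_ind: j; rewrite //=;
  exact: C0.
Qed.

Lemma pull_mul (C : 'M_5) (v : 'cV_5) : pull T C *m v = 0 -> C *m ((invmx T)^T *m v) = 0.
Proof.
rewrite /pull -!mulmxA => /(congr1 (mulmx T)).
by rewrite mulKVmx // mulmx0.
Qed.

Lemma pull_last C : C *m (delta_mx (o 4) 0 : 'cV_5) = 0 -> pull T C *m (row (o 4) T)^T = 0.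
Proof.
move=> C4; rewrite /pull rowE trmx_mul trmx_delta -!mulmxA.
by rewrite [(invmx T)^T *m _]mulmxA -trmx_mul mulmxV // trmx1 mul1mx C4 mulmx0.
Qed.

Lemma invtr_row (v : 'cV_5) k : ((invmx T)^T *m v : 'cV_5) = k *: delta_mx (o 4) 0 ->
  forall l, v l 0 = k * T (o 4) l.
Proof.
move=> vE l; have -> : v = T^T *m ((invmx T)^T *m v).
  by rewrite mulmxA -trmx_mul mulVmx // trmx1 mul1mx.
by rewrite vE -scalemxAr -colE !mxE.
Qed.

(** The operator has rank 4 with kernel the last basis vector. Its pullback has the same shape and
    rank, which forces [P] and [Q] to be nonzero; and its kernel contains the last row of [T]. *)
Lemma last_coordinate_of_degenerate_quad p q : p != 0 -> q != 0 ->
  (forall x, \tr (quad_mx p q 0 *m H x) = 0) -> fixes_last_coordinate T.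
Proof.
move=> p0 q0 trQ; have [+ _ _] := pull_quad trQ.
set C := pull _ _; set P := C _ _; set Q := C _ _; set R := C _ _ => CE.
have kerQ (y : 'cV_5) : quad_mx p q 0 *m y = 0 -> y = y (o 4) 0 *: delta_mx (o 4) 0.
  move=> /colP Qy; apply/colP => i.
  have := (Qy (o 0), Qy (o 1), Qy (o 2), Qy (o 3)); rewrite !mxE !sum_ord5 !mxE /=.
  rewrite !mul0r !addr0 !add0r => -[[[/eqP + /eqP +] /eqP +] /eqP +].
  rewrite !mulf_eq0 (negPf p0) (negPf q0) /= => /eqP y2 /eqP y3 /eqP y0 /eqP y1.
  by elim/ord5_ind: i; rewrite ?y0 ?y1 ?y2 ?y3 ?mulr0 ?mulr1.
have dual_row k : C *m (delta_mx k 0 : 'cV_5) = 0 ->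
    exists y, forall j, (j == k)%:R = y * T (o 4) j.
  move=> /pull_mul/kerQ/invtr_row Ek.
  exists (((invmx T)^T *m (delta_mx k 0 : 'cV_5)) (o 4) 0) => j.
  by rewrite -Ek mxE eqxx andbT.
have ker2 k l : k != l -> C *m (delta_mx k 0 : 'cV_5) = 0 ->
    C *m (delta_mx l 0 : 'cV_5) = 0 -> False.
  move=> kl /dual_row[y Ey] /dual_row[z Ez].
  have /esym/eqP := Ey l; rewrite [l == k]eq_sym (negPf kl) mulf_eq0 => /orP[]/eqP E.
    by have /eqP := Ey k; rewrite eqxx E mul0r oner_eq0.
  by have /eqP := Ez l; rewrite eqxx E mulr0 oner_eq0.
have P0 : P != 0.
  apply/eqP => P0; apply: (@ker2 (o 0) (o 2)) => //; rewrite CE P0 -colE;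
  by apply/colP; elim/ord5_ind; rewrite !mxE.
have Q0 : Q != 0.
  apply/eqP => Q0; apply: (@ker2 (o 1) (o 3)) => //; rewrite CE Q0 -colE;
  by apply/colP; elim/ord5_ind; rewrite !mxE.
have : C *m (row (o 4) T)^T = 0.
  by apply: pull_last; rewrite -colE; apply/colP; elim/ord5_ind; rewrite !mxE.
rewrite CE => /colP E; have := (E (o 0), E (o 1), E (o 2), E (o 3)).
rewrite !mxE !sum_ord5 !mxE /= !mul0r !addr0 !add0r => -[[[/eqP + /eqP +] /eqP +] /eqP +].
by rewrite !mulf_eq0 (negPf P0) (negPf Q0) /= => /eqP ? /eqP ? /eqP ? /eqP ?.
Qed.

(** The vector (f, -4d) spans the kernel of ((4d, f), (f, 4e)), so the corresponding operator sends
    F to 2(fb - 4dc) w^3: either it kills F and has rank 4, or it isolates w^3. *)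
Lemma last_coordinate_singular : 16 * d * e = f ^+ 2 -> fixes_last_coordinate T.
Proof.
move=> detN; have [fb|fb] := eqVneq (f * b) (4 * d * c).
  have d0 : d != 0.
    apply: contraNneq f0 => d0; have := expf_eq0 f 2.
    by rewrite -detN d0 mulr0 mul0r eqxx.
  apply: (@last_coordinate_of_degenerate_quad f (- (4 * d))) => //.
    by rewrite oppr_eq0 mulf_neq0 // pnatr_eq0.
  move=> x; rewrite trace_quad_hess.
  rewrite [X in X * _ + _ + _](_ : _ = 2 * (f * b - 4 * d * c)); last by ring.
  rewrite fb subrr mulr0 mul0r add0r.
  rewrite [X in X * _ + _](_ : _ = 0) ?mul0r ?add0r; last by ring.
  rewrite [X in X * _](_ : _ = 2 * (f ^+ 2 - 16 * d * e)); last by ring.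
  by rewrite detN subrr mulr0 mul0r.
have k0 : 2 * (f * b - 4 * d * c) != 0 by rewrite mulf_neq0 ?subr_eq0 // pnatr_eq0.
apply: (@last_coordinate_of_partial _ a b c d e f T uT FT
  ((2 * (f * b - 4 * d * c))^-1 *: quad_mx f (- (4 * d)) 0)) => // x.
rewrite -scalemxAl mxtraceZ trace_quad_hess.
rewrite [X in _ * (X * _ + _ + _)](_ : _ = 2 * (f * b - 4 * d * c)); last by ring.
rewrite [X in _ * (_ + X * _ + _)](_ : _ = 0); last by ring.
rewrite [X in _ * (_ + _ + X * _)](_ : _ = 2 * (f ^+ 2 - 16 * d * e)); last by ring.
by rewrite detN subrr mulr0 !mul0r !addr0 mulKf.
Qed.
End ApolarQuadric.

Section NonsingularQuadric.
Variable K : numClosedFieldType.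
Variables a b c d e f : K.
Variable T : 'M[K]_5.
Hypotheses (uT : T \in unitmx)
  (FT : forall x, quintic a b c d e f (T *m x) = quintic a b c d e f x).
Hypotheses (a0 : a != 0) (f0 : f != 0) (detN : 16 * d * e - f ^+ 2 != 0).
Variables al be : K.
Hypotheses (bE : b = 4 * d * al + f * be) (cE : c = f * al + 4 * e * be).

Local Notation H := (hess a b c d e f).
Let k0 := 20 * a - 6 * (al * b + be * c).
Let D := quad_mx (- 3 * al) (- 3 * be) 1.

Lemma trace_dual_hess x : \tr (D *m H x) = k0 * x (o 4) 0 ^+ 3.
Proof.
rewrite trace_quad_hess /k0 bE cE; move: (x _ _) (x _ _) (x _ _) (x _ _) (x _ _) => *; ring.
Qed.

(* When [k0 != 0] the operator [D] sends the quintic to a multiple of w^3. Otherwise [D] is, up to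
   scaling, the only operator annihilating the quintic, so [T] preserves the quadric [D]. *)
Lemma last_coordinate_generic : k0 != 0 -> fixes_last_coordinate T.
Proof.
move=> k00; apply: (@last_coordinate_of_partial _ a b c d e f T uT FT (k0^-1 *: D)) => // x.
by rewrite -scalemxAl mxtraceZ trace_dual_hess mulKf.
Qed.

Hypothesis k0E : k0 = 0.

(** The pullback also kills F, and since the determinant is nonzero its two off-diagonal parameters
    are determined by its corner entry. *)
Lemma pull_dual : exists2 r, r != 0 & pull T D = r *: D.
Proof.
have trD x : \tr (D *m H x) = 0 by rewrite trace_dual_hess k0E mul0r.
have [CE E1 E2] := pull_quad uT FT f0 trD.
move: E1 E2 CE; set P := pull T D _ _; set Q := pull T D _ _; set r := pull T D _ _ => E1 E2 CE.
have n2 : (2 : K) != 0 by rewrite pnatr_eq0.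
have PE : P = - 3 * al * r.
  apply: (mulfI n2); apply: (mulfI detN); apply/eqP; rewrite -subr_eq0; apply/eqP.
  transitivity (4 * e * (4 * d * (2 * P) + f * (2 * Q) + 6 * b * r)
      - f * (f * (2 * P) + 4 * e * (2 * Q) + 6 * c * r)); last by rewrite E1 E2 !mulr0 subrr.
  rewrite bE cE; ring.
have QE : Q = - 3 * be * r.
  apply: (mulfI n2); apply: (mulfI detN); apply/eqP; rewrite -subr_eq0; apply/eqP.
  transitivity (4 * d * (f * (2 * P) + 4 * e * (2 * Q) + 6 * c * r)
      - f * (4 * d * (2 * P) + f * (2 * Q) + 6 * b * r)); last by rewrite E1 E2 !mulr0 subrr.
  rewrite bE cE; ring.
have rD : pull T D = r *: D.
  rewrite CE PE QE; apply/matrixP => i j; rewrite !mxE.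
  by elim/ord5_ind: i; elim/ord5_ind: j; rewrite /= ?mulr0 ?mulr1 // mulrC.
exists r => //; apply/eqP => r0; move: rD; rewrite r0 scale0r => /(congr1 (fun M => T *m M *m T^T)).
rewrite /pull !mulmxA mulmxV // mul1mx -mulmxA -trmx_mul mulmxV // trmx1 mulmx1 mulmx0 mul0mx.
by move=> /matrixP/(_ (o 4) (o 4)); rewrite !mxE /= => /eqP; rewrite oner_eq0.
Qed.

Lemma last_coordinate_nondegenerate : al != 0 -> be != 0 -> fixes_last_coordinate T.
Proof.
move=> al0 be0; have [r r0 rD] := pull_dual.
have n3 : (3 : K) != 0 by rewrite pnatr_eq0.
have n7 : (7 : K) != 0 by rewrite pnatr_eq0.
pose Q := quad_mx (- (3 * al)^-1) (- (3 * be)^-1) 1.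
have DQ : D *m Q = 1%:M.
  apply/matrixP => i j; rewrite mxE sum_ord5 !mxE.
  by elim/ord5_ind: i; elim/ord5_ind: j; rewrite /= ?(mul0r, mulr0, addr0, add0r, mulr1) //;
    by field; rewrite ?n3 ?al0 ?be0.
have QT : T^T *m Q *m T = r^-1 *: Q.
  suff E : T^T *m Q *m T *m (r *: D) = 1%:M.
    have E2 : (r^-1 *: Q) *m (r *: D) = 1%:M.
      by rewrite -scalemxAl -scalemxAr scalerA mulVf // scale1r (mulmx1C DQ).
    by rewrite -[LHS]mulmx1 -(mulmx1C E2) mulmxA E mul1mx.
  rewrite -rD /pull !mulmxA -[_ *m T *m invmx T]mulmxA mulmxV // mulmx1.
  rewrite -[_ *m Q *m D]mulmxA (mulmx1C DQ) mulmx1.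
  by rewrite -trmx_mul mulVmx // trmx1.
have qE (x : 'cV[K]_5) : (x^T *m Q *m x) 0 0 = 1 * x (o 4) 0 ^+ 2
    + - (2 / (3 * al)) * (x (o 0) 0 * x (o 2) 0) + - (2 / (3 * be)) * (x (o 1) 0 * x (o 3) 0).
  rewrite mxE sum_ord5 !mxE !sum_ord5 !mxE /=; field.
  by rewrite ?n3 ?al0 ?be0.
(* The dual quadric [Q] is preserved too, and w^3 is the sum of a second-order derivative of the
   quintic and of a multiple of [w * Q]. *)
pose u := 2 / (7 * al); pose v := 2 / (7 * be); pose dt := 16 * d * e - f ^+ 2.
(* [p] and [q] solve 4d p + f q = u and f p + 4e q = v, which cancels the mixed terms of 3/7 w [Q].
   The w^3 produced is then al u + be v = 4/7, and the remaining 3/7 comes from w [Q] itself. *)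
pose p := (4 * e * u - f * v) / dt; pose q := (4 * d * v - f * u) / dt.
apply: (@last_coordinate_of_cube _ a b c d e f T uT FT (quad_mx (p / 2) (q / 2) 0)
  (- (2 / (3 * al))) (- (2 / (3 * be))) 1 (3 / 7) r^-1) => // x /=; last first.
  rewrite -!qE trmx_mul (_ : _ *m _ = x^T *m (T^T *m Q *m T) *m x); last by rewrite !mulmxA.
  by rewrite QT -scalemxAr -scalemxAl mxE.
rewrite trace_quad_hess bE cE /p /q /u /v /dt; field.
by rewrite ?n3 ?n7 ?al0 ?be0 ?detN.
Qed.

End NonsingularQuadric.

Section RankThreeQuadric.
Variable K : numClosedFieldType.
Variables a b c d e f : K.
Variable T : 'M[K]_5.
Hypotheses (uT : T \in unitmx)
  (FT : forall x, quintic a b c d e f (T *m x) = quintic a b c d e f x).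
Hypotheses (a0 : a != 0) (f0 : f != 0) (detN : 16 * d * e - f ^+ 2 != 0).
Variable be : K.
Hypotheses (bE : b = f * be) (cE : c = 4 * e * be) (aE : 20 * a = 6 * be * c).

(* The quadric [D] of the previous section now has rank 3; its kernel makes [T] preserve the plane
   x0 = x2 = 0, hence the line x0 = x2 = w = 0. The first polar at (0, x1, 0, x3, 0) is
   x3^4 z0 + x1^4 z2 + e (x1 x3)^2 z4, and [T] permutes these linear forms in z. *)
Lemma last_coordinate_rank3 : fixes_last_coordinate T.
Proof.
have be0 : be != 0.
  apply: contraNneq a0 => be0; have : 20 * a = 0 by rewrite aE be0 mulr0 mul0r.
  by move=> /eqP; rewrite mulf_eq0 pnatr_eq0.
have e0 : e != 0.
  apply: contraNneq a0 => e0; have : 20 * a = 0 by rewrite aE cE e0 mulr0 mul0r mulr0.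
  by move=> /eqP; rewrite mulf_eq0 pnatr_eq0.
have bE' : b = 4 * d * 0 + f * be by rewrite mulr0 add0r.
have cE' : c = f * 0 + 4 * e * be by rewrite mulr0 add0r.
have kE : 20 * a - 6 * (0 * b + be * c) = 0 by rewrite aE; ring.
have [r r0 rD] := pull_dual uT FT f0 detN bE' cE' kE.
set D := quad_mx _ _ _ in rD.
have row_ker (v : 'cV[K]_5) : D *m v = 0 -> D *m (T^T *m v) = 0.
  move=> Dv; have {Dv}: T *m (r *: D) *m T^T *m v = 0.
    by rewrite -rD /pull !mulmxA mulmxV // mul1mx -[D *m _ *m _]mulmxA -trmx_mul mulmxV //
      trmx1 mulmx1.
  rewrite -!mulmxA => /(congr1 (mulmx (invmx T))); rewrite mulKmx // mulmx0 -scalemxAl => /eqP.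
  by rewrite scaler_eq0 (negPf r0) => /eqP.
have rows k : k = o 0 \/ k = o 2 -> [/\ T k (o 1) = 0, T k (o 3) = 0 & T k (o 4) = 0].
  move=> kk; have : D *m (T^T *m (delta_mx k 0 : 'cV_5)) = 0.
    apply: row_ker; rewrite -colE /D; apply/colP; elim/ord5_ind; rewrite !mxE;
    by case: kk => -> /=; rewrite ?mulr0.
  rewrite -colE => /colP E; have := (E (o 3), E (o 1), E (o 4)).
  rewrite /D !mxE !sum_ord5 !mxE /= !mul0r !addr0 !add0r mul1r.
  move=> [[/eqP + /eqP +] T4]; rewrite !mulf_eq0 oppr_eq0 pnatr_eq0 (negPf be0) /=.
  by move=> /eqP T1 /eqP T3.
have [T01 T03 T04] := rows (o 0) (or_introl erefl).
have [T21 T23 T24] := rows (o 2) (or_intror erefl).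
have T41 : T (o 4) (o 1) = 0.
  (* The test vector has x0 = x2 = x3 = 0 and last coordinate 1, so F equals [a] there; its image
     lies in x0 = x2 = w = 0, where F vanishes. *)
  apply/eqP/negPn/negP => T41; case/eqP: a0.
  have := FT (vec5 0 (- T (o 4) (o 4) / T (o 4) (o 1)) 0 0 1).
  rewrite /quintic !mul_vec5 T01 T04 T21 T24 !mxE /= /quintic_form => E.
  rewrite (_ : a = quintic_form a b c d e f 0 (- T (o 4) (o 4) / T (o 4) (o 1)) 0 0 1);
    last by rewrite /quintic_form; ring.
  rewrite /quintic_form -{}E.
  rewrite [X in a * X ^+ 5](_ : _ = 0); last by field.
  rewrite [X in b * X ^+ 3](_ : _ = 0); last by field.
  rewrite [X in c * X ^+ 3](_ : _ = 0); last by field.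
  rewrite [X in d * X * _](_ : _ = 0); last by field.
  rewrite [X in e * X * _](_ : _ = 0); last by field.
  rewrite [X in f * X * _ * _](_ : _ = 0); last by field.
  ring.
have T43 : T (o 4) (o 3) = 0.
  apply/eqP/negPn/negP => T43; case/eqP: a0.
  have := FT (vec5 0 0 0 (- T (o 4) (o 4) / T (o 4) (o 3)) 1).
  rewrite /quintic !mul_vec5 T03 T04 T23 T24 !mxE /= /quintic_form => E.
  rewrite (_ : a = quintic_form a b c d e f 0 0 0 (- T (o 4) (o 4) / T (o 4) (o 3)) 1);
    last by rewrite /quintic_form; ring.
  rewrite /quintic_form -{}E.
  rewrite [X in a * X ^+ 5](_ : _ = 0); last by field.
  rewrite [X in b * X ^+ 3](_ : _ = 0); last by field.
  rewrite [X in c * X ^+ 3](_ : _ = 0); last by field.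
  rewrite [X in d * X * _](_ : _ = 0); last by field.
  rewrite [X in e * X * _](_ : _ = 0); last by field.
  rewrite [X in f * X * _ * _](_ : _ = 0); last by field.
  ring.
(* [p] and [q] give the action of [T] on the preserved line x0 = x2 = w = 0. Their product vanishes
   wherever y1 y3 does, so [T] is monomial on this line and fourth powers become additive at (1,
   1). *)
pose p y1 y3 := T (o 1) (o 1) * y1 + T (o 1) (o 3) * y3.
pose q y1 y3 := T (o 3) (o 1) * y1 + T (o 3) (o 3) * y3.
have polarE k y1 y3 : q y1 y3 ^+ 4 * T (o 0) k + p y1 y3 ^+ 4 * T (o 2) k
    + e * (p y1 y3 * q y1 y3) ^+ 2 * T (o 4) k =
    (o 0 == k)%:R * y3 ^+ 4 + (o 2 == k)%:R * y1 ^+ 4 + (o 4 == k)%:R * (e * (y1 * y3) ^+ 2).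
  have [+ _] := polars_invariant FT (vec5 0 y1 0 y3 0) (delta_mx k 0).
  have -> : T *m vec5 0 y1 0 y3 0 = vec5 0 (p y1 y3) 0 (q y1 y3) 0.
    apply/colP; elim/ord5_ind; rewrite mul_vec5 mxE /= ?T01 ?T03 ?T21 ?T23 ?T41 ?T43 /p /q; ring.
  have polar_plane x y (z : 'cV[K]_5) : polar1 a b c d e f (vec5 0 x 0 y 0) z =
      y ^+ 4 * z (o 0) 0 + x ^+ 4 * z (o 2) 0 + e * (x * y) ^+ 2 * z (o 4) 0.
    rewrite /polar1 mxE sum_ord5 !mxE /=.
    move: (z _ _) (z _ _) (z _ _) (z _ _) (z _ _) => z0 z1 z2 z3 z4; ring.
  rewrite !polar_plane -colE !mxE !eqxx !andbT => ->.
  by congr (_ + _ + _); rewrite mulrC.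
have pq2 y1 y3 : (p y1 y3 * q y1 y3) ^+ 2 * T (o 4) (o 4) = (y1 * y3) ^+ 2.
  by apply: (mulfI e0); have := polarE (o 4) y1 y3;
    rewrite T04 T24 /= !mulr0 !mul0r !add0r mul1r -mulrA.
have pq11 : p 1 1 * q 1 1 != 0.
  apply: contraTneq isT => pq0; have := pq2 1 1.
  by rewrite pq0 mulr1 expr1n expr0n mul0r => /eqP; rewrite eq_sym oner_eq0.
have T44 : T (o 4) (o 4) != 0.
  apply: contraTneq isT => T44; have := pq2 1 1.
  by rewrite T44 mulr1 expr1n mulr0 => /eqP; rewrite eq_sym oner_eq0.
have pq0 y1 y3 : y1 * y3 = 0 -> p y1 y3 * q y1 y3 = 0.
  move=> y0; apply/eqP; have /eqP := pq2 y1 y3.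
  by rewrite y0 expr0n mulf_eq0 expf_eq0 (negPf T44) orbF.
have p10 : p 1 0 = T (o 1) (o 1) by rewrite /p; ring.
have p01 : p 0 1 = T (o 1) (o 3) by rewrite /p; ring.
have q10 : q 1 0 = T (o 3) (o 1) by rewrite /q; ring.
have q01 : q 0 1 = T (o 3) (o 3) by rewrite /q; ring.
have p11 : p 1 1 = p 1 0 + p 0 1 by rewrite /p; ring.
have q11 : q 1 1 = q 1 0 + q 0 1 by rewrite /q; ring.
have pq10 := pq0 1 0 (mulr0 _); have pq01 := pq0 0 1 (mul0r _).
have pp : p 1 1 ^+ 4 = p 1 0 ^+ 4 + p 0 1 ^+ 4.
  rewrite p11; have [->|p10n] := eqVneq (p 1 0) 0; first by rewrite expr0n !add0r.
  have [->|p01n] := eqVneq (p 0 1) 0; first by rewrite expr0n !addr0.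
  case/eqP: pq11; move/eqP: pq10; move/eqP: pq01; rewrite !mulf_eq0 (negPf p10n) (negPf p01n) /=.
  by move=> /eqP q01n /eqP q10n; rewrite q11 q01n q10n addr0 mulr0.
have qq : q 1 1 ^+ 4 = q 1 0 ^+ 4 + q 0 1 ^+ 4.
  rewrite q11; have [->|q10n] := eqVneq (q 1 0) 0; first by rewrite expr0n !add0r.
  have [->|q01n] := eqVneq (q 0 1) 0; first by rewrite expr0n !addr0.
  case/eqP: pq11; move/eqP: pq10; move/eqP: pq01; rewrite !mulf_eq0 (negPf q10n) (negPf q01n) !orbF.
  by move=> /eqP p01n /eqP p10n; rewrite p11 p01n p10n addr0 mul0r.
(* The polar identity at (1,1) minus those at (1,0) and (0,1) leaves only the term with
   [T (o 4) k]. *)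
have sep k : k != o 4 -> T (o 4) k = 0.
  move=> k4; have := polarE k 1 1; have := polarE k 1 0; have := polarE k 0 1.
  rewrite pq10 pq01 pp qq !mulr0 !mul0r !mulr1 !expr1n !expr0n [o 4 == k]eq_sym (negPf k4) /= =>
    E1 E2 E3.
  have : e * (p 1 1 * q 1 1) ^+ 2 * T (o 4) k = 0.
    apply: (linear_combination3 (k1 := 1) (k2 := -1) (k3 := -1) E3 E2 E1); ring.
  have nz : e * (p 1 1 * q 1 1) ^+ 2 != 0 by rewrite mulf_neq0 ?expf_neq0.
  by move=> /eqP; rewrite mulf_eq0 (negPf nz) => /eqP.
by split; exact: sep.
Qed.
End RankThreeQuadric.

Section CyclicShift.
Variable K : numClosedFieldType.

Definition shift_mx : 'M[K]_5 := \matrix_(i, j)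
  (nth [::] [:: [:: 0; 1; 0; 0; 0]; [:: 0; 0; 1; 0; 0]; [:: 0; 0; 0; 1; 0];
                [:: 1; 0; 0; 0; 0]; [:: 0; 0; 0; 0; 1]] i)`_j.

Lemma shift_mx_unit : shift_mx \in unitmx.
Proof.
suff /mulmx1_unit[] : shift_mx *m shift_mx^T = 1%:M by [].
apply/matrixP => i j; rewrite mxE sum_ord5 !mxE.
by elim/ord5_ind: i; elim/ord5_ind: j; rewrite /= ?(mul0r, mulr0, mul1r, addr0, add0r).
Qed.

(** The swap of [b] with [c] and [d] with [e] serves twice: it exchanges the roles of the two pairs
    of opposite coordinates, and applied twice it gives an involution preserving F. *)
Lemma quintic_shift a b c d e f (x : 'cV[K]_5) :
  quintic a b c d e f (shift_mx *m x) = quintic a c b e d f x.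
Proof.
have sE k : (shift_mx *m x) k 0 = x [:: o 1; o 2; o 3; o 0; o 4]`_k 0.
  by rewrite mxE sum_ord5 !mxE; elim/ord5_ind: k => /=;
    rewrite ?(mul0r, mul1r, addr0, add0r).
rewrite /quintic /quintic_form !sE /=; ring.
Qed.
End CyclicShift.

Section DistinguishedHyperplane.
Variable K : numClosedFieldType.

Lemma fixes_last a b c d e f (T : 'M[K]_5) : T \in unitmx ->
    (forall x, quintic a b c d e f (T *m x) = quintic a b c d e f x) -> a != 0 ->
  fixes_last_coordinate T \/ fixes_last_vector T.
Proof.
move=> uT FT a0; have [f0|f0] := eqVneq f 0; first by right; apply: last_vector_of_f0 FT f0 a0.
left; have [/eqP detN|detN] := eqVneq (16 * d * e - f ^+ 2) 0.
  by apply: (last_coordinate_singular uT FT f0); apply/eqP; rewrite -subr_eq0.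
pose al := (4 * e * b - f * c) / (16 * d * e - f ^+ 2).
pose be := (4 * d * c - f * b) / (16 * d * e - f ^+ 2).
have bE : b = 4 * d * al + f * be by rewrite /al /be; field.
have cE : c = f * al + 4 * e * be by rewrite /al /be; field.
have [k0|k0] := eqVneq (20 * a - 6 * (al * b + be * c)) 0; last first.
  exact: (last_coordinate_generic uT FT f0 bE cE k0).
have [al0|al0] := eqVneq al 0.
  apply: (last_coordinate_rank3 uT FT a0 f0 detN (be := be)).
  - by rewrite {1}bE al0 mulr0 add0r.
  - by rewrite {1}cE al0 mulr0 add0r.
  - by apply/eqP; rewrite -subr_eq0 -k0 al0; apply/eqP; ring.
have [be0|be0] := eqVneq be 0; last first.
  exact: (last_coordinate_nondegenerate uT FT f0 detN bE cE k0 al0 be0).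
(* Conjugating by the shift exchanges [al] and [be], which reduces [be = 0] to the case [al = 0]
   already treated; the last row is only permuted. *)
have uS := shift_mx_unit K; pose S := shift_mx K; pose T' := invmx S *m T *m S.
have uT' : T' \in unitmx by rewrite !unitmx_mul unitmx_inv uS uT.
have ST : S *m T' = T *m S by rewrite /T' -mulmxA mulKVmx.
have FT' x : quintic a c b e d f (T' *m x) = quintic a c b e d f x.
  by rewrite -quintic_shift mulmxA ST -mulmxA FT quintic_shift.
have detN' : 16 * e * d - f ^+ 2 != 0 by rewrite mulrAC.
have [] := last_coordinate_rank3 uT' FT' a0 f0 detN' (be := al).
- by rewrite {1}cE be0 mulr0 addr0.
- by rewrite {1}bE be0 mulr0 addr0.
- by apply/eqP; rewrite -subr_eq0 -k0 be0; apply/eqP; ring.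
have rowE j : T' (o 4) j = (T *m S) (o 4) j.
  have S4 k : S (o 4) k = (k == o 4)%:R by elim/ord5_ind: k; rewrite mxE.
  rewrite -ST [RHS]mxE [RHS](bigD1 (o 4)) //= S4 eqxx mul1r big1 ?addr0 // => k /negPf k4.
  by rewrite S4 k4 mul0r.
rewrite !rowE !mxE !sum_ord5 /S !mxE /= !(mulr0, mulr1, addr0, add0r).
by move=> ? ? ? ?; split.
Qed.
End DistinguishedHyperplane.

(** * Linear symmetries of the normal form are monomial *)

Section MonomialStabilizer.
Variable K : numClosedFieldType.
Variables a b c d e f : K.
Variable T : 'M[K]_5.
Hypotheses (uT : T \in unitmx)
  (FT : forall x, quintic a b c d e f (T *m x) = quintic a b c d e f x).
Hypothesis a0 : a != 0.

Definition shift_ord (i : 'I_5) : 'I_5 := nth (o 4) [:: o 1; o 2; o 3; o 0; o 4] i.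

Let basis (j : 'I_5) : 'cV[K]_5 := delta_mx j 0.

Let TbE j : T *m basis j = col j T. Proof. by rewrite colE. Qed.

Let last_row_of_last_col : fixes_last_vector T -> fixes_last_coordinate T.
Proof.
move=> [T04 T14 T24 T34].
have T44 : T (o 4) (o 4) != 0.
  apply/eqP => T44; have : T *m basis (o 4) = 0.
    by rewrite TbE; apply/colP; elim/ord5_ind; rewrite !mxE.
  move=> /(congr1 (mulmx (invmx T))); rewrite mulKmx // mulmx0 => /colP/(_ (o 4)).
  by rewrite !mxE !eqxx => /eqP; rewrite oner_eq0.
have col4 : col (o 4) T = vec5 0 0 0 0 (T (o 4) (o 4)).
  by apply/colP; elim/ord5_ind; rewrite !mxE.
have polar_last t (y : 'cV[K]_5) : polar1 a b c d e f (vec5 0 0 0 0 t) y =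
    5 * a * t ^+ 4 * y (o 4) 0.
  rewrite /polar1 mxE sum_ord5 !mxE /=.
  move: (y _ _) (y _ _) (y _ _) (y _ _) (y _ _) => y0 y1 y2 y3 y4; ring.
have b4 : basis (o 4) = vec5 0 0 0 0 1 by apply/colP; elim/ord5_ind; rewrite !mxE.
have row4 j : j != o 4 -> T (o 4) j = 0.
  move=> j4; have [+ _] := polars_invariant FT (basis (o 4)) (basis j).
  rewrite !TbE col4 b4 !polar_last !mxE eq_sym (negPf j4) mulr0 => /eqP.
  have nz : 5 * a * T (o 4) (o 4) ^+ 4 != 0 by rewrite !mulf_neq0 ?expf_neq0 ?pnatr_eq0.
  by rewrite mulf_eq0 (negPf nz) => /eqP.
by split; exact: row4.
Qed.

Let row4 j : j != o 4 -> T (o 4) j = 0.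
Proof.
have [T40 T41 T42 T43] : fixes_last_coordinate T.
  by have [//|/last_row_of_last_col] := fixes_last uT FT a0.
by elim/ord5_ind: j.
Qed.

Let T44 : T (o 4) (o 4) != 0.
Proof.
apply/eqP => T44; have : row (o 4) T = 0.
  by apply/rowP => j; rewrite !mxE; have [->|/row4] := eqVneq j (o 4).
rewrite rowE => /(congr1 (mulmx^~ (invmx T))); rewrite mulmxK // mul0mx => /rowP/(_ (o 4)).
by rewrite !mxE !eqxx => /eqP; rewrite oner_eq0.
Qed.

Lemma polar2_hyperplane x0 x1 x2 x3 y0 y1 y2 y3 :
  polar2 a b c d e f (vec5 x0 x1 x2 x3 0) (vec5 y0 y1 y2 y3 0) =
  12 * (x0 ^+ 2 * x1 * y0 ^+ 2 + x1 ^+ 2 * x2 * y1 ^+ 2 + x2 ^+ 2 * x3 * y2 ^+ 2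
        + x3 ^+ 2 * x0 * y3 ^+ 2)
  + 8 * (x0 ^+ 3 * (y0 * y1) + x1 ^+ 3 * (y1 * y2) + x2 ^+ 3 * (y2 * y3) + x3 ^+ 3 * (y3 * y0)).
Proof.
rewrite /polar2 -trace_mx11 mxtrace_mulC mulmxA trace_hess /second_partials.
rewrite !mxE !big_ord1 !mxE /=; ring.
Qed.

Let vec5E (v : 'cV[K]_5) : v (o 4) 0 = 0 ->
  v = vec5 (v (o 0) 0) (v (o 1) 0) (v (o 2) 0) (v (o 3) 0) 0.
Proof. by move=> v4; apply/colP; elim/ord5_ind; rewrite !mxE. Qed.

(** On w = 0 the second polar in the direction of the i-th basis vector is 12 x_i^2 x_{i+1}, which
    ignores the other coordinates; invariance carries this over to the columns of [T]. *)
Let polar2_shift i j (u : 'cV[K]_5) s : i != o 4 -> j != o 4 -> j != i -> j != shift_ord i ->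
  u (o 4) 0 = 0 ->
  polar2 a b c d e f (u + s *: col j T) (col i T) = polar2 a b c d e f u (col i T).
Proof.
move=> i4 j4 ji jni u4.
have [v uE] : exists v, u = T *m v by exists (invmx T *m u); rewrite mulKVmx.
have v4 : v (o 4) 0 = 0.
  move: u4; rewrite uE mxE (bigD1 (o 4)) //= big1 ?addr0 => [|k k4].
    by move=> /eqP; rewrite mulf_eq0 (negPf T44) => /eqP.
  by rewrite row4 // mul0r.
have [_ E1] := polars_invariant FT (v + s *: basis j) (basis i).
have [_ E2] := polars_invariant FT v (basis i).
rewrite -!TbE uE scalemxAr -mulmxDr E1 E2 {E1 E2}.
have -> : v + s *: basis j = vec5 (v (o 0) 0 + s * (0%N == j :> nat)%:R) (v (o 1) 0 + s * (1%N == j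
  :> nat)%:R)
    (v (o 2) 0 + s * (2%N == j :> nat)%:R) (v (o 3) 0 + s * (3%N == j :> nat)%:R) 0.
  apply/colP; elim/ord5_ind; rewrite !mxE ?andbT //=.
  by rewrite v4 [o 4 == j]eq_sym (negPf j4) mulr0 addr0.
rewrite [v in RHS](vec5E v4).
have -> : basis i = vec5 (0%N == i :> nat)%:R (1%N == i :> nat)%:R (2%N == i :> nat)%:R (3%N == i
  :> nat)%:R 0.
  by apply/colP; elim/ord5_ind; rewrite !mxE ?andbT //= eq_sym (negPf i4).
rewrite !polar2_hyperplane.
move: (v (o 0) 0) (v (o 1) 0) (v (o 2) 0) (v (o 3) 0) => v0 v1 v2 v3.
by elim/ord5_ind: i i4 ji jni => // _; elim/ord5_ind: j j4 => // _ _ _ /=; ring.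
Qed.

Let disjoint_cols i j k : i != o 4 -> j != o 4 -> k != o 4 -> i != j ->
  T k i * T k j = 0.
Proof.
move=> i4 j4 k4; wlog jni : i j i4 j4 / j != shift_ord i => [wl|] ij.
  have [jE|jni] := eqVneq j (shift_ord i); last exact: wl.
  rewrite mulrC; apply: wl; rewrite // 1?eq_sym //.
  by rewrite jE; move: i4; elim/ord5_ind: (i).
have ji : j != i by rewrite eq_sym.
pose g (u : 'cV[K]_5) := polar2 a b c d e f u (col i T).
have gE (u : 'cV[K]_5) : u (o 4) 0 = 0 -> g (u + 1 *: col j T) = g u by exact: polar2_shift.
(* The mixed second difference of [g] along [p] and [q] sees only the term 12 u_k^2 u_{k+1} [T k i]
   ^ 2, and its value at column j exceeds that at 0 by 24 [T k i] ^ 2 times [T k j]. *)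
pose p := basis k; pose q := basis (shift_ord k).
have p4 : p (o 4) 0 = 0 by rewrite mxE eq_sym (negPf k4).
have q4 : q (o 4) 0 = 0 by rewrite mxE; move: k4; elim/ord5_ind: (k).
have pq4 : (p + q) (o 4) 0 = 0 by rewrite mxE p4 q4 addr0.
have z4 : (0 : 'cV[K]_5) (o 4) 0 = 0 by rewrite mxE.
have := (gE _ p4, gE _ q4, gE _ pq4, gE _ z4); rewrite /g.
have colE4 l : l != o 4 -> col l T = vec5 (T (o 0) l) (T (o 1) l) (T (o 2) l) (T (o 3) l) 0.
  by move=> l4; apply/colP; elim/ord5_ind; rewrite !mxE //= row4.
rewrite (colE4 i) // (colE4 j) // scale1r.
have vecD (x0 x1 x2 x3 y0 y1 y2 y3 : K) : vec5 x0 x1 x2 x3 0 + vec5 y0 y1 y2 y3 0 =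
    vec5 (x0 + y0) (x1 + y1) (x2 + y2) (x3 + y3) 0.
  by apply/colP; elim/ord5_ind; rewrite !mxE //= addr0.
have vec0 : (0 : 'cV[K]_5) = vec5 0 0 0 0 0 by apply/colP; elim/ord5_ind; rewrite !mxE.
have basisE l : l != o 4 -> basis l = vec5 (0%N == l :> nat)%:R (1%N == l :> nat)%:R (2%N == l :>
  nat)%:R (3%N == l :> nat)%:R 0.
  by move=> l4; apply/colP; elim/ord5_ind; rewrite !mxE ?andbT //= eq_sym (negPf l4).
have nk4 : shift_ord k != o 4 by move: k4; elim/ord5_ind: (k).
rewrite vec0 /p /q !basisE // !vecD !polar2_hyperplane => -[[[E1 E2] E3] E4].
have n24 : (24 : K) != 0 by rewrite pnatr_eq0.
suff E : 24 * (T k i ^+ 2 * T k j) = 0.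
  move: E => /eqP; rewrite !mulf_eq0 (negPf n24) /= => /orP[|/eqP->]; last by rewrite mulr0.
  by rewrite orbb => /eqP ->; rewrite mul0r.
move: E1 E2 E3 E4; elim/ord5_ind: k k4 {p q p4 q4 pq4 nk4 gE g} => // _ /= E1 E2 E3 E4;
  apply: (linear_combination4 (k1 := -1) (k2 := -1) (k3 := 1) (k4 := 1) E1 E2 E3 E4); ring.
Qed.

Let col_neq0 j : j != o 4 -> exists2 k, k != o 4 & T k j != 0.
Proof.
move=> j4; apply: contrapT => H; have : T *m basis j = 0.
  rewrite TbE; apply/colP => k; rewrite !mxE; have [->|k4] := eqVneq k (o 4); first exact: row4.
  by apply/eqP/negPn/negP => Tkj; apply: H; exists k.
move=> /(congr1 (mulmx (invmx T))); rewrite mulKmx // mulmx0 => /colP/(_ j).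
by rewrite !mxE !eqxx => /eqP; rewrite oner_eq0.
Qed.

Let monomial : exists (s : {perm 'I_5}) (t : 'I_5 -> K),
  [/\ s (o 4) = o 4, forall j, t j != 0 &
      forall k j, k != o 4 -> j != o 4 -> T k j = (k == s j)%:R * t j].
Proof.
have /fin_all_exists[s sP] (j : 'I_5) : exists k, (T k j != 0) /\ ((k == o 4) = (j == o 4)).
  have [->|j4] := eqVneq j (o 4); first by exists (o 4); rewrite eqxx.
  by have [k k4 Tkj] := col_neq0 j4; exists k; rewrite (negPf k4).
have s_inj : injective s.
  move=> i j sij; apply/eqP/negPn/negP => ij.
  have [i4|i4] := eqVneq i (o 4).
    by case/eqP: ij; apply/eqP; rewrite i4 eq_sym -(sP j).2 -sij (sP i).2 i4.
  have j4 : j != o 4 by rewrite -(sP j).2 -sij (sP i).2.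
  have k4 : s i != o 4 by rewrite (sP i).2.
  have /eqP := disjoint_cols i4 j4 k4 ij.
  by rewrite mulf_eq0 (negPf (sP i).1) sij (negPf (sP j).1).
exists (perm s_inj), (fun j => T (s j) j); split=> [|j|k j k4 j4].
- by apply/eqP; rewrite permE (sP _).2.
- exact: (sP j).1.
rewrite permE; have [->|ksj] := eqVneq k (s j); first by rewrite mul1r.
pose i := (perm s_inj)^-1%g k; have si : s i = k by rewrite -(permE s_inj) permKV.
have i4 : i != o 4 by rewrite -(sP i).2 si.
have ij : i != j by apply: contraNneq ksj => <-; rewrite si.
have /eqP := disjoint_cols i4 j4 k4 ij.
by rewrite mulf_eq0 -{1}si (negPf (sP i).1) mul0r => /eqP.
Qed.

Let quintic_pair p q x y : p != o 4 -> q != o 4 -> p != q ->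
  quintic a b c d e f (x *: basis p + y *: basis q) =
  (q == shift_ord p)%:R * (x ^+ 4 * y) + (p == shift_ord q)%:R * (y ^+ 4 * x).
Proof.
move=> p4 q4 pq; rewrite /quintic /quintic_form !mxE !andbT.
by elim/ord5_ind: p p4 pq => // _; elim/ord5_ind: q q4 => // _ _; rewrite -!val_eqE /=; ring.
Qed.

Lemma quintic_stabilizer : exists (s : {perm 'I_5}) (t : 'I_5 -> K),
  [/\ forall k j, T k j = (k == s j)%:R * t j, s (o 4) = o 4,
     forall j, j != o 4 -> s (shift_ord j) = shift_ord (s j),
     forall j, j != o 4 -> t j ^+ 4 * t (shift_ord j) = 1
   & t (o 4) ^+ 5 = 1].
Proof.
have [s [t [s4 t0 TE]]] := monomial.
have sj4 j : j != o 4 -> s j != o 4.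
  by apply: contraNneq => sj; rewrite -(inj_eq (@perm_inj _ s)) sj s4.
have colE' j : j != o 4 -> T *m basis j = t j *: basis (s j).
  move=> j4; rewrite TbE; apply/colP => k; rewrite !mxE eqxx andbT mulrC.
  have [->|k4] := eqVneq k (o 4); last exact: TE.
  by rewrite row4 // eq_sym (negPf (sj4 _ j4)) mul0r.
have step j : j != o 4 -> s (shift_ord j) = shift_ord (s j) /\ t j ^+ 4 * t (shift_ord j) = 1.
  move=> j4; have nj4 : shift_ord j != o 4 by move: j4; elim/ord5_ind: (j).
  have jn : j != shift_ord j by move: j4; elim/ord5_ind: (j).
  have jnn : (j == shift_ord (shift_ord j)) = false by move: j4; elim/ord5_ind: (j).
  have sjn : s j != s (shift_ord j) by rewrite (inj_eq (@perm_inj _ s)).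
  have E y := FT (1 *: basis j + y *: basis (shift_ord j)).
  have {}E y : (s (shift_ord j) == shift_ord (s j))%:R * (t j ^+ 4 * (y * t (shift_ord j)))
      + (s j == shift_ord (s (shift_ord j)))%:R * ((y * t (shift_ord j)) ^+ 4 * t j) = y.
    have := E y; rewrite mulmxDr -!scalemxAr !colE' // !scalerA mul1r !quintic_pair ?sj4 //.
    by rewrite eqxx jnn expr1n !mul1r mul0r addr0.
  (* The identity reads A y + B y^4 = y. Adding its instances at 1 and -1 gives B = 0, and then A =
     1 forces the permutation to commute with the cycle. *)
  have E1 := E 1; have E2 := E (- 1).
  have n2 : (2 : K) != 0 by rewrite pnatr_eq0.
  have B0 : (s j == shift_ord (s (shift_ord j)))%:R * (t (shift_ord j) ^+ 4 * t j) = 0.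
    apply: (mulfI n2); rewrite mulr0.
    apply: (linear_combination3 (k1 := 1) (k2 := 1) (k3 := 0) E1 E2 (erefl 0)); ring.
  move: E1; rewrite !mul1r B0 addr0; case: eqP => [-> |_]; rewrite ?mul1r ?mul0r //.
  by move=> /esym/eqP; rewrite oner_eq0.
have lastcol k : k != o 4 -> T k (o 4) = 0.
  (* [m] is the cyclic predecessor of [k]. The first polar at the m-th basis vector is the
     coordinate [k], so comparing polars at the preimage of [m] in the direction of the last basis
     vector yields the entry [T k (o 4)]. *)
  move=> k4; pose m := shift_ord (shift_ord (shift_ord k)).
  have m4 : m != o 4 by rewrite /m; move: k4; elim/ord5_ind: (k).
  have mk : shift_ord m = k by rewrite /m; move: k4; elim/ord5_ind: (k).
  pose j := (s^-1)%g m; have sj : s j = m by rewrite permKV.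
  have j4 : j != o 4 by apply: contraNneq m4 => j4; rewrite -sj j4 s4.
  have [+ _] := polars_invariant FT (basis j) (basis (o 4)).
  have polar_basis i x (y : 'cV[K]_5) : i != o 4 ->
      polar1 a b c d e f (x *: basis i) y = x ^+ 4 * y (shift_ord i) 0.
    move=> i4; rewrite /polar1 mxE sum_ord5 !mxE !andbT.
    by elim/ord5_ind: i i4 => // _; rewrite -!val_eqE /=;
      move: (y _ _) (y _ _) (y _ _) (y _ _) (y _ _) => y0 y1 y2 y3 y4; rewrite /shift_ord /=; ring.
  have nj4 : (shift_ord j == o 4) = false by move: j4; elim/ord5_ind: (j).
  rewrite colE' // TbE -[basis j]scale1r !polar_basis ?sj4 // !mxE sj mk nj4 mulr0 => /eqP.
  by rewrite mulf_eq0 expf_eq0 (negPf (t0 j)) andbF => /eqP.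
have lastE x : quintic a b c d e f (x *: basis (o 4)) = a * x ^+ 5.
  by rewrite /quintic /quintic_form !mxE !andbT -!val_eqE /=; ring.
have T445 : T (o 4) (o 4) ^+ 5 = 1.
  have col4 : T *m basis (o 4) = T (o 4) (o 4) *: basis (o 4).
    rewrite TbE; apply/colP => k; rewrite !mxE eqxx andbT.
    by have [->|/lastcol] := eqVneq k (o 4); rewrite ?mulr1 // mulr0.
  have := FT (basis (o 4)); rewrite col4 -[X in _ = quintic _ _ _ _ _ _ X]scale1r !lastE.
  by rewrite expr1n => /(mulfI a0).
exists s, (fun j => if j == o 4 then T (o 4) (o 4) else t j); split=> //.
- move=> k j; have [->|j4] := eqVneq j (o 4).
    by rewrite s4; have [->|/lastcol->] := eqVneq k (o 4); rewrite ?mul1r // mul0r.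
  have [->|k4] := eqVneq k (o 4); last exact: TE.
  by rewrite row4 // eq_sym (negPf (sj4 _ j4)) mul0r.
- by move=> j j4; have [] := step j j4.
- move=> j j4; have nj4 : (shift_ord j == o 4) = false by move: j4; elim/ord5_ind: (j).
  by rewrite nj4 (negPf j4); have [] := step j j4.
Qed.

End MonomialStabilizer.

(** * Matrix representatives of projective transformations *)

Section Representatives.
Variables (F : fieldType) (n : nat).
Implicit Types (g h : PGL F n.+1) (M N : 'M[F]_n.+1).

Definition represents g M := exists2 A : GL F n.+1, val A = M & g = \pi_(PGL F n.+1) A.

Lemma represents_repr g : represents g (val (repr g)).
Proof. by exists (repr g); rewrite ?reprK. Qed.

Lemma represents_unit g M : represents g M -> M \in unitmx.
Proof. by case=> A <- _; apply: valP. Qed.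

Lemma represents1 : represents 1%g 1.
Proof. by exists (GL1 F n.+1). Qed.

Lemma representsM g h M N : represents g M -> represents h N -> represents (g * h)%g (M * N).
Proof. by move=> [A <- ->] [B <- ->]; exists (GLmul A B) => //; apply: PGLmul_pi. Qed.

Lemma representsX g M k : represents g M -> represents (g ^+ k)%g (M ^+ k).
Proof.
move=> gM; elim: k => [|k IHk]; first exact: represents1.
by rewrite expgS exprS; apply: representsM.
Qed.

Lemma representsV g M : represents g M -> represents g^-1%g (invmx M).
Proof. by move=> [A <- ->]; exists (GLinv A) => //; apply: PGLinv_pi. Qed.

Lemma eq_represents g h M N c :
  c != 0 -> represents g M -> represents h N -> M = c *: N -> g = h.
Proof.
by move=> c0 [A <- ->] [B <- ->] AB; apply/eqP/PGL_eqP; exists c.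
Qed.

Lemma represents_inj g M N :
  represents g M -> represents g N -> exists2 c, c != 0 & M = c *: N.
Proof. by move=> [A <- ->] [B <- /eqP/PGL_eqP]. Qed.

End Representatives.

(** * Roots of unity and the generators of [G13] *)

Section RootsOfUnity.
Variable R : realType.
Local Notation xi := (xi R).

Lemma xiX k m :
  xi k ^+ m = Complex (cos (m%:R * (2 * pi / k%:R))) (sin (m%:R * (2 * pi / k%:R))).
Proof.
elim: m => [|m IHm]; first by rewrite mul0r cos0 sin0.
rewrite exprSr IHm /Defs.xi -[m.+1%:R]natr1 (mulrDl m%:R) mul1r cosD sinD.
by apply/eqP; rewrite eq_complex /= eqxx /= addrC [X in _ == _ + X]mulrC mulrC eqxx.
Qed.

(** For p > 2 the angle lies strictly between 0 and pi, where the sine is positive, so [xi p] is not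
    1. *)
Lemma xi_primitive p : prime p -> odd p -> p.-primitive_root (xi p).
Proof.
move=> p_pr p_odd; have p2 : (2 < p)%N by rewrite odd_prime_gt2.
have p0 : 0 < p%:R :> R by rewrite ltr0n (ltn_trans _ p2).
apply: prime_order_primitive => //.
  rewrite xiX mulrC divfK ?gt_eqF // mulr_natl cos2pi sin2pi.
  by apply/eqP; rewrite eq_complex /= !eqxx.
apply/eqP => /eqP; rewrite eq_complex /= => /andP[_].
rewrite gt_eqF // sin_gt0_pi // divr_gt0 ?mulr_gt0 ?pi_gt0 //=.
by rewrite ltr_pdivrMr // mulrC ltr_pM2l ?pi_gt0 // ltr_nat.
Qed.

End RootsOfUnity.

(* [256 = 1 mod 255] splits as [8 * 15 + 85 + 51]. *)
Lemma unity_root255 (K : fieldType) (z17 z3 z5 t : K) :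
    17.-primitive_root z17 -> 3.-primitive_root z3 -> 5.-primitive_root z5 ->
    t ^+ 255 = 1 ->
  exists i : 'I_17, exists j : 'I_3, exists l : 'I_5,
    t = z17 ^+ (8 * i) * z3 ^+ j * z5 ^+ l.
Proof.
move=> p17 p3 p5 t255.
have [i iE] := prim_rootP p17 (etrans (esym (exprM t 15 17)) t255).
have [j jE] := prim_rootP p3 (etrans (esym (exprM t 85 3)) t255).
have [l lE] := prim_rootP p5 (etrans (esym (exprM t 51 5)) t255).
exists i, j, l; rewrite mulnC exprM -iE -jE -lE -exprM -!exprD.
by rewrite -[LHS]mulr1 -t255 -exprS.
Qed.

Section MonomialDecomposition.
Variable R : realType.
Local Notation K := R[i].
Local Notation xi := (xi R).

Definition D17 : 'M[K]_5 := diag5 (xi 17) (xi 17 ^- 4) (xi 17 ^+ 16) (xi 17 ^+ 4) 1.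
Definition D3 : 'M[K]_5 := diag5 (xi 3) (xi 3 ^+ 2) (xi 3) (xi 3 ^+ 2) 1.
Definition D5 : 'M[K]_5 := diag5 1 1 1 1 (xi 5).

Lemma mul_diag5 (a b c d e a' b' c' d' e' : K) :
  diag5 a b c d e * diag5 a' b' c' d' e' = diag5 (a * a') (b * b') (c * c') (d * d') (e * e').
Proof.
rewrite /diag5 [LHS]mulmx_diag; congr diag_mx; apply/rowP.
by elim/ord5_ind; rewrite !mxE.
Qed.

Lemma diag5X (a b c d e : K) k :
  diag5 a b c d e ^+ k = diag5 (a ^+ k) (b ^+ k) (c ^+ k) (d ^+ k) (e ^+ k).
Proof.
elim: k => [|k IHk]; last by rewrite exprS IHk mul_diag5 !exprS.
by rewrite !expr0; apply/matrixP; elim/ord5_ind; elim/ord5_ind; rewrite !mxE.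
Qed.

Lemma mul_mx_diag5 (M : 'M[K]_5) a b c d e k j :
  (M * diag5 a b c d e) k j = M k j * [:: a; b; c; d; e]`_j.
Proof. by rewrite -[_ * _]/(_ *m _) mul_mx_diag !mxE. Qed.

Lemma mx_shiftX m k j : (mx_shift R ^+ m) k j = (iter m shift_ord k == j)%:R.
Proof.
elim: m k => [|m IHm] k; first by rewrite expr0 mxE.
rewrite exprS iterSr mxE (bigD1 (shift_ord k)) //= big1 ?addr0.
  by rewrite IHm; elim/ord5_ind: k; rewrite mxE /= mul1r.
move=> i; elim/ord5_ind: k; elim/ord5_ind: i => // _; by rewrite mxE /= mul0r.
Qed.

(** The four entries are t, t^-4, t^16, t^-64 with t^255 = 1. The 17-part of t gives a power of
    [D17], as -64 = 4 modulo 17, and the 3-part one of [D3]. The 5-part is constant on the four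
    coordinates because -4 = 1 modulo 5: it becomes the scalar in front, and the summand 4l in the
    exponent of [D5] undoes it on the last coordinate. *)
Lemma monomial_decomposition (T : 'M[K]_5) (s : {perm 'I_5}) (t : 'I_5 -> K) :
    (forall k j, T k j = (k == s j)%:R * t j) ->
    s (o 4) = o 4 -> (forall j, j != o 4 -> s (shift_ord j) = shift_ord (s j)) ->
    (forall j, j != o 4 -> t j ^+ 4 * t (shift_ord j) = 1) -> t (o 4) ^+ 5 = 1 ->
  exists (r : 'I_4) (i : 'I_17) (j : 'I_3) (n l : 'I_5),
    T = xi 5 ^+ l *: (mx_shift R ^+ r * (D17 ^+ (8 * i) * D3 ^+ j * D5 ^+ (n + 4 * l))).
Proof.
move=> TE s4 sn tn t45.
have p17 : 17.-primitive_root (xi 17) by apply: xi_primitive.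
have p3 : 3.-primitive_root (xi 3) by apply: xi_primitive.
have p5 : 5.-primitive_root (xi 5) by apply: xi_primitive.
have z17 := prim_expr_order p17; have z3 := prim_expr_order p3; have z5 := prim_expr_order p5.
have tV j : j != o 4 -> t (shift_ord j) = t j ^- 4.
  move=> /tn tj; apply: (@mulfI _ (t j ^+ 4)); last by rewrite tj divff //;
    apply: contra_eqN tj => /eqP->; rewrite mul0r eq_sym oner_eq0.
  by apply: contra_eqN tj => /eqP->; rewrite mul0r eq_sym oner_eq0.
have t1 : t (o 1) = t (o 0) ^- 4 := tV (o 0) isT.
have t2 : t (o 2) = t (o 0) ^+ 16 by rewrite (tV (o 1) isT) t1 exprVn invrK -exprM.
have t3 : t (o 3) = t (o 0) ^- 64 by rewrite (tV (o 2) isT) t2 -exprM.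
have t00 : t (o 0) != 0.
  by apply: contra_eqN (tn (o 0) isT) => /eqP->; rewrite expr0n mul0r eq_sym oner_eq0.
have t0 : t (o 0) ^+ 255 = 1.
  apply: (mulIf t00); rewrite -exprSr mul1r.
  by rewrite [RHS](tV (o 3) isT) t3 exprVn invrK -exprM.
have [i [j [l t0E]]] := unity_root255 p17 p3 p5 t0.
have [n t4E] := prim_rootP p5 t45.
have [r rE] : exists r : 'I_4, iter r shift_ord (s (o 0)) = o 0.
  have : s (o 0) != o 4 by rewrite -s4 (inj_eq perm_inj).
  by elim/ord5_ind: (s (o 0)) => // _;
    [exists (inord 0)|exists (inord 3)|exists (inord 2)|exists (inord 1)]; rewrite inordK.
have sE k m : (k == s m) = (iter r shift_ord k == m).
  have s1 := sn (o 0) isT; have s2 := sn (o 1) isT; have s3 := sn (o 2) isT.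
  have n0 : shift_ord (o 0) = o 1 by []. have n1 : shift_ord (o 1) = o 2 by [].
  have n2 : shift_ord (o 2) = o 3 by [].
  rewrite n0 in s1; rewrite n1 s1 in s2; rewrite n2 s2 in s3.
  have : s (o 0) != o 4 by rewrite -s4 (inj_eq perm_inj).
  elim/ord5_ind: m; rewrite ?s4 ?s3 ?s2 ?s1; move: rE {s1 s2 s3};
  elim/ord5_ind: (s (o 0)) => //; case: r => -[|[|[|[|//]]]] ? //= _ _; by elim/ord5_ind: k.
exists r, i, j, n, l; apply/matrixP => k m; rewrite TE sE mxE.
rewrite /D17 /D3 /D5 !diag5X !mul_diag5 mul_mx_diag5 mx_shiftX.
rewrite mulrCA; congr (_ * _).
rewrite [xi 5 ^+ (n + _)]exprD [xi 5 ^+ (4 * _)]exprM.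
move: (8 * i)%N (j : nat) (l : nat) (n : nat) t0E t4E => {}i {}j {}l {}n t0E t4E.
have x17 : (xi 17 ^+ i) ^+ 17 = 1 by rewrite exprAC z17 expr1n.
have y3 : (xi 3 ^+ j) ^+ 3 = 1 by rewrite exprAC z3 expr1n.
have w5 : (xi 5 ^+ l) ^+ 5 = 1 by rewrite exprAC z5 expr1n.
rewrite !expr1n exprVn [(_ ^+ 16) ^+ _]exprAC ![(xi 17 ^+ 4) ^+ _]exprAC ![(xi 3 ^+ 2) ^+ _]exprAC
  [(_ ^+ 4) ^+ l]exprAC.
move: (xi 17 ^+ i) (xi 3 ^+ j) (xi 5 ^+ l) (xi 5 ^+ n) x17 y3 w5 t0E t4E =>
  x y w v x17 y3 w5 t0E t4E.
have expVE (z : K) p q c : z ^+ p = 1 -> (q + c = p * ((q + c) %/ p))%N -> z ^- q = z ^+ c.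
  move=> zp qc; have zqc : z ^+ q * z ^+ c = 1 by rewrite -exprD qc exprM zp expr1n.
  by rewrite -[LHS]mulr1 -zqc mulKf //; apply: contra_eqN zqc => /eqP->;
    rewrite mul0r eq_sym oner_eq0.
have expE (z : K) p q c : z ^+ p = 1 -> (q = c + p * (q %/ p))%N -> z ^+ q = z ^+ c.
  by move=> zp ->; rewrite exprD exprM zp expr1n mulr1.
have expVM q : (x * y * w) ^- q = x ^- q * y ^- q * w ^- q.
  by rewrite -!exprVn !invfM !exprMn.
elim/ord5_ind: m {sE}; rewrite ?t1 ?t2 ?t3 ?t4E ?t0E /= ?(expVM, exprMn) !mulr1.
- by rewrite mulrC.
- by rewrite (expVE y 3%N 4%N 2%N y3) // (expVE w 5%N 4%N 1%N w5) // mulrC.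
- by rewrite (expE y 3%N 16%N 1%N y3) // (expE w 5%N 16%N 1%N w5) // mulrC.
- by rewrite (expVE x 17%N 64%N 4%N x17) // (expVE y 3%N 64%N 2%N y3) // (expVE w 5%N 64%N 1%N w5)
  // mulrC.
- by rewrite mul1r mulrCA -exprS w5 mulr1.
Qed.
End MonomialDecomposition.

(** * Generated subgroups, conjugation and parity of the order *)

Section Subgroups.
Variable G : groupType.
Implicit Types (H S : set G) (g h : G).

Lemma subgroup_generatedP S : subgroup (subgroup_generated S).
Proof.
split=> [|g h]; first by apply/mem_set => A [[/set_mem A1 _] _].
move=> /set_mem gS /set_mem hS; apply/mem_set => A [[A1 AV] SA].
by apply/set_mem/AV; apply/mem_set; [apply: gS | apply: hS].
Qed.

Lemma subgroupX S g k : subgroup S -> S g -> S (g ^+ k)%g.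
Proof.
move=> Sg Sx; elim: k => [|k IHk]; first by apply/set_mem; case: Sg.
by rewrite expgS; apply/set_mem/(group_closedM Sg); apply/mem_set.
Qed.

Lemma subgroupM S g h : subgroup S -> S g -> S h -> S (g * h)%g.
Proof. by move=> Sg gS hS; apply/set_mem/(group_closedM Sg); apply/mem_set. Qed.

Lemma isomorphic_conj H c : subgroup H ->
  subgroup [set (h ^ c)%g | h in H] /\ isomorphic H [set (h ^ c)%g | h in H].
Proof.
move=> Hg; split.
  split=> [|_ _ /set_mem[g gH <-] /set_mem[h hH <-]]; apply/mem_set.
    by exists 1%g; rewrite ?conj1g //; apply/set_mem; case: Hg.
  exists (g / h)%g; last by rewrite conjMg conjVg.
  by case: Hg => _ HV; apply/set_mem/HV; apply/mem_set.
exists (fun h => (h ^ c)%g); split; last by move=> x y _ _; apply: conjMg.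
split=> [h Hh|x y _ _|_ [h Hh <-]]; [by exists h | exact: conjg_inj | by exists h].
Qed.

(** Right multiplication by [g] is an involution of [H] without fixed points. *)
Lemma even_card_subgroup H g : subgroup H -> finite_set H ->
  H g -> g != 1%g -> (g * g = 1)%g -> exists2 N, (H #= `I_N)%card & (2 %| N)%N.
Proof.
move=> Hg /finite_fsetP[A HA] Hg0 g1 gg.
exists #|` A|; first by rewrite HA; apply/card_eq_fsetP.
have AM (x : A) : (val x * g)%g \in A.
  have: H (val x * g)%g by apply: subgroupM => //; rewrite HA /=; apply: valP.
  by rewrite HA.
pose f (x : A) : A := [` AM x]%fset.
have fK : involutive f by move=> x; apply: val_inj; rewrite /= -mulgA gg mulg1.
have fN x : f x != x.
  apply: contra_neq g1 => /(congr1 val) /= E.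
  by apply: (mulgI (val x)); rewrite E mulg1.
(* [S] selects one element of each pair [{h, h * g}]. *)
pose S : {set A} := [set x | (enum_rank x < enum_rank (f x))%N]%SET.
have SC : (~: S = f @^-1: S)%SET.
  apply/setP => x; rewrite !inE fK -leqNgt [LHS]leq_eqVlt.
  by rewrite val_eqE (inj_eq enum_rank_inj) (negPf (fN x)).
by rewrite cardfE -(cardsC S)%SET SC card_preimset ?addnn ?dvdn2 ?odd_double //; apply: can_inj fK.
Qed.

End Subgroups.

Theorem theorem5p13 (R : realType) (X : set (projspace R[i] 4)) :
  smooth_hypersurface 5 X ->
  (exists2 g : PGL R[i] 5, Aut X g & has_order g 17) ->
  (exists L : set (PGL R[i] 5),
      [/\ subgroup L, L `<=` G13 R & isomorphic (Aut X) L])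
  /\ (exists2 N : nat, (Aut X #= `I_N)%card & (2 %| N)%N).
Proof.
move=> [P [homP P0 smP XE]] [g Xg [_ g17 gord]].
have semi_inv h : Aut X h ->
    exists2 lam, lam != 0 & forall v, ev P (val (repr h) *m v) = lam * ev P v.
  by move=> Xh; apply: (Aut_proj_zeros_semi_invariant homP P0 smP); rewrite reprK -XE.
have rg := represents_repr g; have uA := represents_unit rg.
have A17 : exists2 k, k != 0 & val (repr g) ^+ 17 = k%:M.
  have := representsX 17 rg; rewrite g17 => /represents_inj/(_ (represents1 _ _))[k k0 ->].
  by exists k => //; rewrite scalemx1.
have A_nonscalar : ~~ is_scalar_mx (val (repr g)).
  apply: contra_notN (gord 1%N isT) => /is_scalar_mxP[k Ak]; rewrite expg1.
  have k0 : k != 0 by move: uA; rewrite Ak unitmxE det_scalar unitfE expf_eq0.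
  by apply: (eq_represents k0 rg (represents1 _ _)); rewrite Ak scalemx1.
have [lam _ lamE] := semi_inv g Xg.
have [C uC [a [b [c [d [e [f [a0 CE]]]]]]]] :=
  smooth_quintic_normal_form homP smP uA A17 A_nonscalar (ex_intro _ lam lamE).
pose gam := \pi_(PGL R[i] 5) (mkGL uC).
have rgam : represents gam C by exists (mkGL uC).
pose g17' := \pi_(PGL R[i] 5) (mkGL (diag17_unit R)).
pose g3 := \pi_(PGL R[i] 5) (mkGL (diag3_unit R)).
pose gs := \pi_(PGL R[i] 5) (mkGL (mx_shift_unit R)).
pose g5 := \pi_(PGL R[i] 5) (mkGL (diag1_unit R)).
have r17 : represents g17' (D17 R) by exists (mkGL (diag17_unit R)).
have r3 : represents g3 (D3 R) by exists (mkGL (diag3_unit R)).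
have rs : represents gs (mx_shift R) by exists (mkGL (mx_shift_unit R)).
have r5 : represents g5 (D5 R) by exists (mkGL (diag1_unit R)).
(* Words are indexed by a finite type, so that writing each conjugated automorphism as a word proves
   both the inclusion in [G13] and the finiteness of [Aut X]. *)
pose word (w : 'I_4 * 'I_17 * 'I_3 * 'I_5 * 'I_5) : PGL R[i] 5 :=
  let: (r, i, j, n, l) := w in
  (gs ^+ r * (g17' ^+ (8 * i) * g3 ^+ j * g5 ^+ (n + 4 * l)))%g.
have rword (r i j n l : nat) : represents (gs ^+ r * (g17' ^+ (8 * i) * g3 ^+ j * g5 ^+ (n + 4 *
  l)))%g
    (mx_shift R ^+ r * (D17 R ^+ (8 * i) * D3 R ^+ j * D5 R ^+ (n + 4 * l))).
  exact: (representsM (representsX _ rs) (representsM (representsM (representsX _ r17) (representsX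
    _ r3)) (representsX _ r5))).
have AutE h : Aut X h -> exists w, (h ^ gam)%g = word w.
  move=> /semi_inv[mu mu0 muE].
  have rh : represents (h ^ gam)%g (invmx C * (val (repr h) * C)).
    by apply: representsM (representsV rgam) (representsM (represents_repr h) rgam).
  (* Scaling by [nu] multiplies a quintic by nu^5, which turns semi-invariance into invariance. *)
  pose nu := 5.-root mu^-1; have nu5 : nu ^+ 5 = mu^-1 by rewrite rootCK.
  have nu0 : nu != 0 by rewrite rootC_eq0 // invr_eq0.
  pose T := nu *: (invmx C * (val (repr h) * C)).
  have uT : T \in unitmx by rewrite unitmxZ ?unitfE // (represents_unit rh).
  have FT x : quintic a b c d e f (T *m x) = quintic a b c d e f x.
    rewrite -!CE -scalemxAl -scalemxAr (ev_scale _ _ homP) nu5 -!mulmxA mulKVmx //.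
    by rewrite muE mulKf.
  have [s [t [TE s4 sn tn t4]]] := quintic_stabilizer uT FT a0.
  have [r [i [j [n [l TM]]]]] := monomial_decomposition TE s4 sn tn t4.
  exists (r, i, j, n, l).
  apply: (@eq_represents _ _ _ _ _ _ (nu^-1 * xi R 5 ^+ l) _ rh).
  - by apply: mulf_neq0; [rewrite invr_eq0 | apply/expf_neq0/xi_neq0].
  - exact: (rword r i j n l).
  - by rewrite -scalerA -TM scalerK.
have subAut := Aut_subgroup X.
have [subL isoL] := isomorphic_conj gam subAut.
split.
  exists [set (h ^ gam)%g | h in Aut X]; split=> // _ [h /AutE[[[[[r i] j] n] l] ->] <-].
  have G13_gp : subgroup (G13 R) by apply: subgroup_generatedP.
  have gen k x : [set g17'; g3; gs; g5] x -> G13 R (x ^+ k)%g.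
    by move=> xS; apply: (subgroupX k G13_gp (sub_gen_smallest xS)).
  apply: (subgroupM G13_gp (gen _ _ _) (subgroupM G13_gp (subgroupM G13_gp
    (gen _ _ _) (gen _ _ _)) (gen _ _ _))); rewrite /=; tauto.
have finAut : finite_set (Aut X).
  apply: (@sub_finite_set _ _ [set (word w ^ gam^-1)%g | w in setT]).
    by move=> h /AutE[w hw]; exists w => //; rewrite -hw conjgK.
  exact: finite_image finite_finset.
(* The square of the shift carried back to the original coordinates; it is an involution, nontrivial
   because its matrix has a nonzero entry at (0,2). *)
pose g2 := (gam * ((gs * gs) * gam^-1))%g.
have [A2 A2E g2E] : represents g2 (C * (mx_shift R * mx_shift R * invmx C)).
  exact: (representsM rgam (representsM (representsM rs rs) (representsV rgam))).
apply: (@even_card_subgroup _ _ g2) => //.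
- rewrite XE g2E; apply: (semi_invariant_Aut_proj_zeros homP (oner_neq0 _)) => v.
  rewrite A2E mul1r -[in RHS](mulKVmx uC v) -!mulmxA !CE.
  by rewrite !(quintic_shift _ _ _ _ _ _ _).
- apply/eqP => g21; have [k _ Ak] : exists2 k, k != 0 & val A2 = k *: 1%:M.
    by apply: represents_inj (represents1 _ _); exists A2 => //; rewrite -g21.
  have /matrixP/(_ (@Ordinal 5 0 isT) (@Ordinal 5 2 isT)) : mx_shift R ^+ 2 = k *: 1%:M.
    have := congr1 (fun M => invmx C *m M *m C) Ak; rewrite A2E -[C * _]/(C *m _) mulKmx //.
    by rewrite -[_ * invmx C]/(_ *m invmx C) mulmxKV // -scalemxAr mulmx1 -scalemxAl mulVmx //
      -expr2.
  by rewrite mx_shiftX !mxE /= mulr0 => /eqP; rewrite oner_eq0.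
have gs4 : (gs ^+ 4 = 1)%g.
  apply: (eq_represents (oner_neq0 _) (representsX 4 rs) (represents1 _ _)).
  by rewrite scale1r; apply/matrixP => k j; rewrite mx_shiftX mxE; elim/ord5_ind: k.
rewrite /g2 !mulgA mulgVK -!mulgA.
have -> : (gs * (gs * (gs * (gs * gam^-1))) = gs ^+ 4 * gam^-1)%g by rewrite !expgS mulg1 -!mulgA.
by rewrite gs4 mul1g mulgV.
Qed.
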